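(* Let $p$ be a prime. Then, as graded rings, $$H^*_{cont}\Bigl(\varprojlim_n \mathrm{Hol}(\mathbb{Z}_{p^n});\mathbb{F}_p\Bigr)\cong\begin{cases}\Lambda(x)\otimes\mathbb{F}_2[u,y]/(u^2=ux+uy),\quad |x|=|u|=|y|=1, & p=2,\\ \Lambda(x),\quad |x|=1, & p\text{ odd}.\end{cases}$$ The Poincaré series of $H^*_{cont}\bigl(\varprojlim_n \mathrm{Hol}(\mathbb{Z}_{2^n});\mathbb{F}_2\bigr)$ is $\dfrac{(1+t)^2}{1-t}$.
   Context: $\mathbb{Z}_m$ is the cyclic group of order $m$. For a group $K$, the holomorph $\mathrm{Hol}(K)$ is the group of pairs $(f,x)$, $f\in\mathrm{Aut}(K)$, $x\in K$, with multiplication $(f,x)(g,y)=(fg,g^{-1}(x)y)$. The inverse limit is taken over the surjections $\mathrm{Hol}(\mathbb{Z}_{p^{n+1}})\to\mathrm{Hol}(\mathbb{Z}_{p^n})$ induced by reduction $\mathbb{Z}_{p^{n+1}}\to\mathbb{Z}_{p^n}$ (and the induced maps of automorphism groups). For $G=\varprojlim G_n$ with surjective transition maps and constant trivial coefficients $\mathbb{F}_p$, the continuous cohomology is $H^*_{cont}(G;\mathbb{F}_p)=\varinjlim_n H^*(G_n;\mathbb{F}_p)$. $\Lambda$ denotes an exterior algebra over $\mathbb{F}_p$ and $|\cdot|$ denotes degree. *)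

(* Defs.v *)
From HB Require Import structures.
From mathcomp Require Import all_boot all_order all_algebra all_fingroup.
From mathcomp Require Import generic_quotient ring_quotient.
From mathcomp Require Import boolp.
From mathcomp Require Import mpoly.
From mathcomp Require Import zify.

Set Implicit Arguments.
Unset Strict Implicit.
Unset Printing Implicit Defensive.

Import GRing.Theory.
Local Open Scope ring_scope.

Definition gcast (V : nat -> Type) m n (e : m = n) (x : V m) : V n :=
  eq_rect m V x n e.

(* Graded F-algebras are given by their homogeneous components; [gcast] only
   transports along equalities between degrees. *)
Record gradedAlg (F : fieldType) := GradedAlg {
  gcomp :> nat -> lmodType F;
  gone : gcomp 0%N;
  gmul : forall m n, gcomp m -> gcomp n -> gcomp (m + n)%N;
  gmul_linl : forall m n a (x y : gcomp m) (z : gcomp n),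
    gmul (a *: x + y) z = a *: gmul x z + gmul y z;
  gmul_linr : forall m n a (z : gcomp m) (x y : gcomp n),
    gmul z (a *: x + y) = a *: gmul z x + gmul z y;
  gmulA : forall m n k (x : gcomp m) (y : gcomp n) (z : gcomp k),
    @gcast gcomp _ _ (addnA m n k) (gmul x (gmul y z)) = gmul (gmul x y) z;
  gmul1l : forall n (x : gcomp n), gmul gone x = x;
  gmul1r : forall n (x : gcomp n), @gcast gcomp _ _ (addn0 n) (gmul x gone) = x
}.
Arguments gone {F} g.
Arguments gmul {F g m n}.

(* F-linearity of phi is automatic for a unital graded ring isomorphism when F
   is a prime field. *)
Definition gradedAlg_iso (F : fieldType) (A B : gradedAlg F) : Prop :=
  exists phi : forall n, {linear A n -> B n},
    [/\ forall n, bijective (phi n),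
        phi 0%N (gone A) = gone B
      & forall m n (x : A m) (y : A n),
          phi (m + n)%N (gmul x y) = gmul (phi m x) (phi n y)].

Section Subquotient.
Variables (F : fieldType) (V : lmodType F).

Record submod := Submod {
  smem :> V -> Prop;
  smem0 : smem 0;
  smemP : forall a x y, smem x -> smem y -> smem (a *: x + y)
}.

Definition insm (W : submod) : {pred V} := fun x => `[< W x >].

Lemma insmP (W : submod) x : reflect (W x) (x \in insm W).
Proof. exact: asboolP. Qed.

Lemma insm_submod (W : submod) : submod_closed (insm W).
Proof.
split; first by apply/insmP/smem0.
by move=> a x y /insmP hx /insmP hy; apply/insmP/smemP.
Qed.
HB.instance Definition _ W :=
  GRing.isSubmodClosed.Build F V (insm W) (insm_submod W).

Record subm (W : submod) := Subm { subm_val : V; _ : subm_val \in insm W }.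
HB.instance Definition _ W := [isSub for @subm_val W].
HB.instance Definition _ W := [Choice of subm W by <:].
HB.instance Definition _ W := [SubChoice_isSubLmodule of subm W by <:].

Variables (Z B : submod).

(* The subquotient Z / (Z \cap B) of V. *)
Definition bdry : {pred subm Z} := fun z => val z \in insm B.

Lemma bdry_submod : submod_closed bdry.
Proof.
split; first by rewrite /in_mem /= /bdry raddf0 rpred0.
by move=> a x y hx hy; rewrite /in_mem /= /bdry linearP rpredD // rpredZ.
Qed.
HB.instance Definition _ := GRing.isSubmodClosed.Build F (subm Z) bdry bdry_submod.

Definition subquot : Type := Quotient.quot (bdry : zmodClosed _).
HB.instance Definition _ := GRing.Zmodule.on subquot.

(* The class of x; only meaningful when Z x holds, it is 0 otherwise. *)
Definition sqcls (x : V) : subquot := \pi_subquot%qT (insubd (0 : subm Z) x).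
Definition sqrep (c : subquot) : V := val (repr c).

Lemma sqrepP c : Z (sqrep c).
Proof. exact/insmP/(valP (repr c)). Qed.

Lemma sqrepK c : sqcls (sqrep c) = c.
Proof. by rewrite /sqcls /sqrep valKd reprK. Qed.

Lemma sqcls_eq x y : Z x -> Z y -> sqcls x = sqcls y <-> B (x - y).
Proof.
move=> /insmP hx /insmP hy; rewrite /sqcls; split.
  move/eqP; rewrite -Quotient.idealrBE.
  by rewrite /in_mem /= /bdry raddfB /= !insubdK // => /insmP.
move=> hB; apply/eqP; rewrite -Quotient.idealrBE.
by rewrite /in_mem /= /bdry raddfB /= !insubdK //; apply/insmP.
Qed.

Lemma sqrep_cls x : Z x -> B (sqrep (sqcls x) - x).
Proof. by move=> hx; apply/(sqcls_eq (sqrepP _) hx); rewrite sqrepK. Qed.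

Lemma sqclsD x y : Z x -> Z y -> sqcls (x + y) = sqcls x + sqcls y.
Proof.
move=> /insmP hx /insmP hy; rewrite /sqcls -raddfD; congr (\pi_subquot%qT _).
by apply: val_inj; rewrite raddfD /= !insubdK // rpredD.
Qed.

Definition sqscale (a : F) (c : subquot) : subquot := sqcls (a *: sqrep c).

Lemma submZ (W : submod) a x : W x -> W (a *: x).
Proof. by move=> hx; rewrite -[_ *: _]addr0; apply/smemP/smem0. Qed.
Lemma submD (W : submod) x y : W x -> W y -> W (x + y).
Proof. by move=> hx hy; rewrite -[x]scale1r; apply/smemP. Qed.
Lemma submN (W : submod) x : W x -> W (- x).
Proof. by move=> hx; rewrite -scaleN1r; apply/submZ. Qed.

Lemma sqscale_cls a x : Z x -> sqscale a (sqcls x) = sqcls (a *: x).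
Proof.
move=> hx; apply/sqcls_eq; [exact/submZ/sqrepP|exact/submZ|].
by rewrite -scalerBr; apply/submZ/sqrep_cls.
Qed.

Lemma sqscaleA a b c : sqscale a (sqscale b c) = sqscale (a * b) c.
Proof. by rewrite {2}/sqscale sqscale_cls ?scalerA //; apply/submZ/sqrepP. Qed.
Lemma sqscale1 : left_id 1 sqscale.
Proof. by move=> c; rewrite /sqscale scale1r sqrepK. Qed.
Lemma sqscaleDr : right_distributive sqscale +%R.
Proof.
move=> a c d; rewrite -[c]sqrepK -[d]sqrepK.
have := sqrepP c; have := sqrepP d; move: (sqrep c) (sqrep d) => x y hy hx.
rewrite -sqclsD // !sqscale_cls //; last exact: submD.
by rewrite scalerDr sqclsD //; apply/submZ.
Qed.
Lemma sqscaleDl c : {morph sqscale^~ c : a b / a + b}.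
Proof.
move=> a b; rewrite -[c]sqrepK; have := sqrepP c; move: (sqrep c) => x hx.
by rewrite !sqscale_cls // scalerDl sqclsD //; apply/submZ.
Qed.
HB.instance Definition _ := GRing.Zmodule_isLmodule.Build F subquot
  sqscaleA sqscale1 sqscaleDr sqscaleDl.

Lemma sqclsP a x y : Z x -> Z y -> sqcls (a *: x + y) = a *: sqcls x + sqcls y.
Proof.
move=> hx hy; rewrite sqclsD ?[_ *: sqcls _]sqscale_cls //; exact: submZ.
Qed.

End Subquotient.

Section SubquotientAlgebra.
Variables (F : fieldType) (C : gradedAlg F).

(* A graded subalgebra [gsub] of C and graded subspaces [gidl] on which it acts
   on both sides; [subquotAlg] below is the graded algebra
   gsub / (gsub \cap gidl). *)
Record gradedIdealPair := GradedIdealPair {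
  gsub : forall n, submod (C n);
  gidl : forall n, submod (C n);
  gsub1 : gsub 0%N (gone C);
  gsubM : forall m n (x : C m) (y : C n),
    gsub m x -> gsub n y -> gsub (m + n)%N (gmul x y);
  gidlMr : forall m n (x : C m) (y : C n),
    gidl m x -> gsub n y -> gidl (m + n)%N (gmul x y);
  gidlMl : forall m n (x : C m) (y : C n),
    gsub m x -> gidl n y -> gidl (m + n)%N (gmul x y)
}.

Variable P : gradedIdealPair.
Local Notation H n := (subquot (gsub P n) (gidl P n)).
Local Notation cl n := (@sqcls _ _ (gsub P n) (gidl P n)).

Definition sq_one : H 0%N := cl 0%N (gone C).
Definition sq_mul m n (c : H m) (d : H n) : H (m + n)%N :=
  cl (m + n)%N (gmul (sqrep c) (sqrep d)).

Lemma gmulBl m n (x y : C m) (z : C n) : gmul (x - y) z = gmul x z - gmul y z.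
Proof. by rewrite -[- y]scaleN1r addrC gmul_linl scaleN1r addrC. Qed.
Lemma gmulBr m n (z : C m) (x y : C n) : gmul z (x - y) = gmul z x - gmul z y.
Proof. by rewrite -[- y]scaleN1r addrC gmul_linr scaleN1r addrC. Qed.

Lemma sq_mul_cls m n (x : C m) (y : C n) :
  gsub P m x -> gsub P n y -> sq_mul (cl m x) (cl n y) = cl (m + n)%N (gmul x y).
Proof.
move=> hx hy; have [zx zy] := (sqrepP (cl m x), sqrepP (cl n y)).
have [bx by_] := (sqrep_cls (gidl P m) hx, sqrep_cls (gidl P n) hy).
rewrite /sq_mul; set x' := sqrep _ in zx bx *; set y' := sqrep _ in zy by_ *.
apply/sqcls_eq; [exact: gsubM|exact: gsubM|].
have -> : gmul x' y' - gmul x y = gmul (x' - x) y' + gmul x (y' - y).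
  by rewrite gmulBl gmulBr addrA subrK.
by apply: submD; [apply: gidlMr|apply: gidlMl].
Qed.

Lemma sq_cast m n (e : m = n) (x : C m) :
  @gcast (fun i => H i) m n e (cl m x) = cl n (@gcast (fun i => C i) m n e x).
Proof. by case: n / e. Qed.

Lemma sq_linl m n a (x y : H m) (z : H n) :
  sq_mul (a *: x + y) z = a *: sq_mul x z + sq_mul y z.
Proof.
rewrite -[x]sqrepK -[y]sqrepK -[z]sqrepK.
have := (sqrepP x, sqrepP y, sqrepP z).
move: (sqrep x) (sqrep y) (sqrep z) => u v w [[hu hv] hw].
rewrite -sqclsP // !sq_mul_cls //; last exact: smemP.
by rewrite -sqclsP ?gmul_linl //; apply: gsubM.
Qed.

Lemma sq_linr m n a (z : H m) (x y : H n) :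
  sq_mul z (a *: x + y) = a *: sq_mul z x + sq_mul z y.
Proof.
rewrite -[x]sqrepK -[y]sqrepK -[z]sqrepK.
have := (sqrepP x, sqrepP y, sqrepP z).
move: (sqrep x) (sqrep y) (sqrep z) => u v w [[hu hv] hw].
rewrite -sqclsP // !sq_mul_cls //; last exact: smemP.
by rewrite -sqclsP ?gmul_linr //; apply: gsubM.
Qed.

Lemma sq_mulA m n k (x : H m) (y : H n) (z : H k) :
  @gcast (fun i => H i) _ _ (addnA m n k) (sq_mul x (sq_mul y z)) =
  sq_mul (sq_mul x y) z.
Proof.
rewrite -[x]sqrepK -[y]sqrepK -[z]sqrepK.
have := (sqrepP x, sqrepP y, sqrepP z).
move: (sqrep x) (sqrep y) (sqrep z) => u v w [[hu hv] hw].
rewrite (sq_mul_cls hv hw) (sq_mul_cls hu hv).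
rewrite sq_mul_cls ?sq_mul_cls //; try exact: gsubM.
by rewrite sq_cast gmulA.
Qed.

Lemma sq_mul1l n (x : H n) : sq_mul sq_one x = x.
Proof.
rewrite -[x]sqrepK; have := sqrepP x; move: (sqrep x) => u hu.
by rewrite sq_mul_cls ?gmul1l //; apply: gsub1.
Qed.

Lemma sq_mul1r n (x : H n) :
  @gcast (fun i => H i) _ _ (addn0 n) (sq_mul x sq_one) = x.
Proof.
rewrite -[x]sqrepK; have := sqrepP x; move: (sqrep x) => u hu.
by rewrite sq_mul_cls ?sq_cast ?gmul1r //; apply: gsub1.
Qed.

Definition subquotAlg : gradedAlg F :=
  @GradedAlg F (fun n => H n : lmodType F) sq_one sq_mul
    sq_linl sq_linr sq_mulA sq_mul1l sq_mul1r.

End SubquotientAlgebra.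

Section Cohomology.
Variables (F : fieldType) (G : finGroupType).

(* Inhomogeneous cochains of G with constant coefficients F. The default
   element 1 in [nth 1%g t _] is never used below: all indices are in range. *)
Definition cochain (n : nat) : lmodType F := {ffun n.-tuple G -> F^o}.

Definition slice (s : seq G) k n : n.-tuple G :=
  [tuple nth 1%g s (k + i)%N | i < n].

Definition cup_one : cochain 0 := [ffun => 1].
Definition cup m n (f : cochain m) (g : cochain n) : cochain (m + n) :=
  [ffun t : (m + n).-tuple G => f (slice t 0 m) * g (slice t m n)].

(* The i-th face of (t_0, ..., t_n), for 0 <= i <= n + 1, multiplies t_(i-1) and
   t_i; it drops t_0 when i = 0 and t_n when i = n + 1. *)
Definition face n (i : nat) (t : n.+1.-tuple G) : n.-tuple G :=
  [tuple (if j.+1 < i then nth 1%g t j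
          else if j.+1 == i then (nth 1%g t j * nth 1%g t j.+1)%g
          else nth 1%g t j.+1)%N | j < n].
Definition cobound n (f : cochain n) : cochain n.+1 :=
  [ffun t : n.+1.-tuple G => \sum_(i < n.+2) (-1) ^+ i * f (face i t)].

Lemma cup_linl m n a (x y : cochain m) (z : cochain n) :
  cup (a *: x + y) z = a *: cup x z + cup y z.
Proof. by apply/ffunP=> t; rewrite !ffunE mulrDl -scalerAl. Qed.
Lemma cup_linr m n a (z : cochain m) (x y : cochain n) :
  cup z (a *: x + y) = a *: cup z x + cup z y.
Proof. by apply/ffunP=> t; rewrite !ffunE mulrDr -scalerAr. Qed.

Lemma nth_slice s k n i : (i < n)%N -> nth 1%g (slice s k n) i = nth 1%g s (k + i).
Proof. by move=> lt_in; rewrite -[i]/(val (Ordinal lt_in)) nth_mktuple. Qed.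

Lemma nth_face n i (t : n.+1.-tuple G) j : (j < n)%N ->
  nth 1%g (face i t) j =
  (if j.+1 < i then nth 1%g t j
   else if j.+1 == i then (nth 1%g t j * nth 1%g t j.+1)%g
   else nth 1%g t j.+1)%N.
Proof. by move=> lt_jn; rewrite -[j]/(val (Ordinal lt_jn)) nth_mktuple. Qed.

Lemma eq_tuple1 n (s t : n.-tuple G) :
  (forall i, (i < n)%N -> nth 1%g s i = nth 1%g t i) -> s = t.
Proof. by move=> h; apply: eq_from_tnth => i; rewrite !(tnth_nth 1%g) h. Qed.

Lemma cochain_cast m n (e : m = n) (f : cochain m) (t : n.-tuple G) :
  @gcast (fun i => cochain i) m n e f t = f (slice t 0 m).
Proof.
by case: n / e t => t /=; congr (f _); apply: eq_tuple1 => i /nth_slice ->.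
Qed.

Lemma cupA m n k (x : cochain m) (y : cochain n) (z : cochain k) :
  @gcast (fun i => cochain i) _ _ (addnA m n k) (cup x (cup y z)) =
  cup (cup x y) z.
Proof.
apply/ffunP=> t; rewrite cochain_cast !ffunE mulrA.
have le_i i : (i < n)%N -> (m + i < m + n)%N by rewrite ltn_add2l.
congr (x _ * y _ * z _); apply: eq_tuple1 => i hi.
- by rewrite !nth_slice // ltn_addr.
- by rewrite !nth_slice ?add0n ?ltn_add2l // ltn_addr.
- by rewrite !nth_slice ?ltn_add2l // add0n addnA.
Qed.
Lemma cup1l n (x : cochain n) : cup cup_one x = x.
Proof.
apply/ffunP=> t; rewrite !ffunE mul1r; congr (x _).
by apply: eq_tuple1 => i /nth_slice ->.
Qed.
Lemma cup1r n (x : cochain n) :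
  @gcast (fun i => cochain i) _ _ (addn0 n) (cup x cup_one) = x.
Proof.
apply/ffunP=> t; rewrite cochain_cast !ffunE mulr1; congr (x _).
by apply: eq_tuple1 => i hi; rewrite !nth_slice ?addn0.
Qed.

Definition cochainAlg : gradedAlg F :=
  @GradedAlg F cochain cup_one cup cup_linl cup_linr cupA cup1l cup1r.

Lemma coboundP n a (f g : cochain n) :
  cobound (a *: f + g) = a *: cobound f + cobound g.
Proof.
apply/ffunP=> t; rewrite !ffunE scaler_sumr -big_split /=.
by apply: eq_bigr => i _; rewrite !ffunE mulrDr scalerAr.
Qed.
Lemma cobound0 n : cobound (0 : cochain n) = 0.
Proof. by apply/ffunP=> t; rewrite !ffunE big1 // => i _; rewrite ffunE mulr0. Qed.

Lemma cobound_cup m n (f : cochain m) (g : cochain n)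
    (t : (m + n).+1.-tuple G) :
  cobound (cup f g) t =
    cobound f (slice t 0 m.+1) * g (slice t m.+1 n)
    + (-1) ^+ m * (f (slice t 0 m) * cobound g (slice t m n.+1)).
Proof.
rewrite !ffunE.
set tl := slice t 0 m.+1; set tl' := slice t 0 m.
set tr := slice t m.+1 n; set tr' := slice t m n.+1.
have El (i : nat) : (i <= m)%N -> cup f g (face i t) = f (face i tl) * g tr.
  move=> le_im; rewrite ffunE; congr (f _ * g _); apply: eq_tuple1 => j hj.
    by rewrite nth_slice ?nth_face ?ltn_addr // !nth_slice // ltnW.
  rewrite !nth_slice // nth_face ?ltn_add2l //.
  have lt_i : (i < (m + j).+1)%N by rewrite ltnS (leq_trans le_im) ?leq_addr.
  by rewrite ltnNge ltnW //= gtn_eqF.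
have Er (i : nat) : cup f g (face (m.+1 + i) t) = f tl' * g (face i.+1 tr').
  rewrite ffunE; congr (f _ * g _); apply: eq_tuple1 => j hj.
    by rewrite !nth_slice // nth_face ?ltn_addr // add0n ifT // addSn ltnS ltn_addr.
  rewrite !nth_slice // !nth_face ?ltn_add2l // addSnnS -addnS ltn_add2l eqn_add2l.
  by rewrite !nth_slice // ltnW.
have Etl : face m.+1 tl = tl'.
  by apply: eq_tuple1 => j hj; rewrite nth_face // ltnS hj !nth_slice // ltnW.
have Etr : face 0 tr' = tr.
  by apply: eq_tuple1 => j hj; rewrite nth_face //= !nth_slice // addSnnS.
rewrite [in X in _ = X * _ + _]big_ord_recr /= [in X in _ = _ + X]big_ord_recl /=.
rewrite Etl Etr expr0 mul1r.
transitivity (\sum_(i < m.+1 + n.+1) (-1) ^+ i * cup f g (face i t) : F).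
  rewrite -!(big_mkord xpredT (fun i => (-1) ^+ i * cup f g (face i t))).
  by rewrite addSn addnS.
rewrite big_split_ord /=.
rewrite (eq_bigr (fun i : 'I_m.+1 => (-1) ^+ i * f (face i tl) * g tr)); last first.
  by move=> i _; rewrite El -1?ltnS // mulrA.
rewrite -mulr_suml.
rewrite (eq_bigr (fun i : 'I_n.+1 => (-1) ^+ m * (f tl' *
    ((-1) ^+ bump 0 i * g (face (bump 0 i) tr')))) ); last first.
  move=> i _; rewrite Er /bump /= add1n addSnnS exprD -!mulrA; congr (_ * _).
  by rewrite mulrCA.
rewrite -2!mulr_sumr; set S1 := \sum_(_ < _) _; set S2 := \sum_(_ < _) _.
rewrite exprS !mulrDl !mulrDr !mulN1r !mulNr -!mulrA.
by rewrite -[in RHS]addrA addKr.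
Qed.

Lemma face_face n (t : n.+2.-tuple G) i j : (j <= i)%N ->
  face j (face i.+1 t) = face i (face j t).
Proof.
move=> le_ji; apply: eq_tuple1 => l hl.
rewrite ![in LHS]nth_face //; last exact: ltnW.
rewrite ![in RHS]nth_face //.
case: (ltngtP l.+1 j) => hj; case: (ltngtP l.+1 i) => hi;
  do ?case: ltngtP => ?; rewrite ?mulgA //; try lia.
all: try by exfalso; lia.
exact: ltnW.
Qed.

Lemma cobound_cobound n (f : cochain n) : cobound (cobound f) = 0.
Proof.
apply/ffunP=> t; rewrite !ffunE.
pose a i j : F := (-1) ^+ (i + j) * f (face j (face i t)).
transitivity (\sum_(i < n.+3) \sum_(j < n.+2) a i j).
  apply: eq_bigr => i _; rewrite ffunE mulr_sumr; apply: eq_bigr => j _.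
  by rewrite mulrA -exprD.
have aS i j : (j <= i)%N -> a i.+1 j = - a j i.
  by move=> le_ji; rewrite /a face_face // addSn exprS mulN1r mulNr addnC.
transitivity (\sum_(i < n.+3) \sum_(j < n.+2 | (j < i)%N) a i j
   + \sum_(i < n.+3) \sum_(j < n.+2 | (i <= j)%N) a i j).
  rewrite -big_split; apply: eq_bigr => i _ /=.
  rewrite (bigID (fun j : 'I_n.+2 => (j < i)%N)) /=; congr (_ + _).
  by apply: eq_bigl => j; rewrite -leqNgt.
rewrite big_ord_recl big_pred0 ?add0r => [|j]; last by rewrite ltn0.
rewrite [X in _ + X]big_ord_recr /= [X in _ + (_ + X)]big_pred0; last first.
  by move=> j; rewrite leqNgt ltn_ord.
rewrite addr0 (eq_bigr (fun i : 'I_n.+2 =>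
    - \sum_(j < n.+2 | (j <= i)%N) a j i)); last first.
  by move=> i _; rewrite -sumrN; apply: eq_bigr => j le_ji; rewrite -aS.
rewrite sumrN [X in - X](exchange_big_dep xpredT) //= addrC.
exact: subrr.
Qed.
Lemma cocyclesP n a (f g : cochain n) :
  cobound f = 0 -> cobound g = 0 -> cobound (a *: f + g) = 0.
Proof. by move=> hf hg; rewrite coboundP hf hg scaler0 addr0. Qed.

Definition cocycles n : submod (cochainAlg n) :=
  @Submod F (cochainAlg n) (fun f => cobound f = 0) (cobound0 n) (@cocyclesP n).

Definition is_cobound n : cochain n -> Prop :=
  match n with
  | 0 => fun f => f = 0
  | k.+1 => fun f => exists g : cochain k, f = cobound g
  end.

Lemma is_cobound0 n : is_cobound (0 : cochain n).
Proof. by case: n => //= n; exists 0; rewrite cobound0. Qed.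
Lemma is_coboundP n a (f g : cochain n) :
  is_cobound f -> is_cobound g -> is_cobound (a *: f + g).
Proof.
case: n f g => [f g -> ->|n f g [f' ->] [g' ->]] /=; first by rewrite scaler0 addr0.
by exists (a *: f' + g'); rewrite coboundP.
Qed.

Definition coboundaries n : submod (cochainAlg n) :=
  @Submod F (cochainAlg n) (@is_cobound n) (is_cobound0 n) (@is_coboundP n).

Lemma cocycles1 : cobound cup_one = 0.
Proof.
apply/ffunP=> t; rewrite !ffunE big_ord_recl big_ord1 /= !ffunE.
by rewrite expr0 expr1 mulN1r mul1r subrr.
Qed.

Lemma cocyclesM m n (f : cochain m) (g : cochain n) :
  cobound f = 0 -> cobound g = 0 -> cobound (cup f g) = 0.
Proof.
move=> hf hg; apply/ffunP=> t.
by rewrite cobound_cup hf hg !ffunE mul0r !mulr0 addr0.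
Qed.

Lemma cobound_cupr m n (f : cochain m) (g : cochain n) :
  is_cobound f -> cobound g = 0 -> is_cobound (cup f g).
Proof.
case: m f => [f -> _|m _ [f ->] hg].
  rewrite (_ : cup 0 g = 0); first exact: is_cobound0.
  by apply/ffunP=> t; rewrite !ffunE mul0r.
exists (cup f g); apply/ffunP=> t; rewrite cobound_cup hg.
rewrite ffunE [(0 : cochain _) _]ffunE !mulr0 addr0.
by congr (cobound f _ * g _); apply: eq_tuple1 => j hj; rewrite !nth_mktuple1.
Qed.

Lemma is_cobound_cast k n (e : k.+1 = n) (g : cochain k) (f : cochain n) :
  (forall t : n.-tuple G, f t = cobound g (slice t 0 k.+1)) ->
  is_cobound f.
Proof.
case: n / e f => f hf; exists g; apply/ffunP=> t; rewrite hf.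
by congr (cobound g _); apply: eq_tuple1 => i /nth_slice ->.
Qed.

Lemma cobound_cupl m n (f : cochain m) (g : cochain n) :
  cobound f = 0 -> is_cobound g -> is_cobound (cup f g).
Proof.
case: n g => [g _ ->|n _ hf [g ->]].
  rewrite (_ : cup f 0 = 0); first exact: is_cobound0.
  by apply/ffunP=> t; rewrite !ffunE mulr0.
apply: (@is_cobound_cast (m + n) _ _ ((-1) ^+ m *: cup f g)) => [|t].
  by rewrite addnS.
rewrite -[_ *: _]addr0 coboundP cobound0 addr0 [RHS]ffunE cobound_cup hf.
rewrite [(0 : cochain _) _]ffunE mul0r add0r.
rewrite /GRing.scale /= mulrA -exprD addnn -signr_odd odd_double mul1r.
rewrite [LHS]ffunE; congr (f _ * cobound g _); apply: eq_tuple1 => j hj.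
- by rewrite !nth_slice // ltnS ltnW // ltn_addr.
- by rewrite !nth_slice // -[(m + n).+1]addnS ltn_add2l.
Qed.

Definition cocycle_pair : gradedIdealPair (cochainAlg) :=
  @GradedIdealPair F cochainAlg cocycles coboundaries
    cocycles1 cocyclesM cobound_cupr cobound_cupl.

Definition cohomology : gradedAlg F := subquotAlg cocycle_pair.

Definition cohcls n (f : cochain n) : cohomology n :=
  sqcls (cocycles n) (coboundaries n) f.
Definition cohrep n (c : cohomology n) : cochain n := sqrep c.

Lemma cohrepP n (c : cohomology n) : cobound (cohrep c) = 0.
Proof. exact: (sqrepP c). Qed.
Lemma cohrepK n (c : cohomology n) : cohcls (cohrep c) = c.
Proof. exact: sqrepK. Qed.
Lemma cohcls_eq n (f g : cochain n) : cobound f = 0 -> cobound g = 0 ->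
  cohcls f = cohcls g <-> is_cobound (f - g).
Proof. exact: (@sqcls_eq _ _ (cocycles n) (coboundaries n)). Qed.
Lemma cohclsP n a (f g : cochain n) : cobound f = 0 -> cobound g = 0 ->
  cohcls (a *: f + g) = a *: cohcls f + cohcls g.
Proof. exact: (@sqclsP _ _ (cocycles n) (coboundaries n)). Qed.
Lemma cohclsM m n (f : cochain m) (g : cochain n) :
  cobound f = 0 -> cobound g = 0 ->
  gmul (cohcls f) (cohcls g) = cohcls (cup f g).
Proof. exact: (@sq_mul_cls _ _ cocycle_pair). Qed.
Lemma cohcls1 : cohcls cup_one = gone cohomology.
Proof. by []. Qed.

End Cohomology.

Section Functoriality.
Variables (F : fieldType) (G H : finGroupType) (r : G -> H).
Hypothesis rM : {morph r : x y / (x * y)%g}.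

Lemma morph1g : r 1%g = 1%g.
Proof. by apply: (mulgI (r 1%g)); rewrite -rM !mulg1. Qed.

Definition pullback n (f : cochain F H n) : cochain F G n :=
  [ffun t : n.-tuple G => f (map_tuple r t)].

Lemma nth_mapr (s : seq G) i : nth 1%g (map r s) i = r (nth 1%g s i).
Proof.
case: (ltnP i (size s)) => hi; first by rewrite (nth_map 1%g).
by rewrite !nth_default ?size_map // morph1g.
Qed.

Lemma pullbackP n a (f g : cochain F H n) :
  pullback (a *: f + g) = a *: pullback f + pullback g.
Proof. by apply/ffunP=> t; rewrite !ffunE. Qed.

Lemma pullback0 n : pullback (0 : cochain F H n) = 0.
Proof. by apply/ffunP=> t; rewrite !ffunE. Qed.

Lemma pullback_cup m n (f : cochain F H m) (g : cochain F H n) :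
  pullback (cup f g) = cup (pullback f) (pullback g).
Proof.
apply/ffunP=> t; rewrite !ffunE; congr (f _ * g _);
  by apply: eq_tuple1 => i hi; rewrite nth_slice // !nth_mapr nth_slice.
Qed.

Lemma pullback_one : pullback (cup_one F H) = cup_one F G.
Proof. by apply/ffunP=> t; rewrite !ffunE. Qed.

Lemma pullback_cobound n (f : cochain F H n) :
  pullback (cobound f) = cobound (pullback f).
Proof.
apply/ffunP=> t; rewrite !ffunE; apply: eq_bigr => i _; rewrite ffunE.
congr (_ * f _); apply: eq_tuple1 => j hj.
by rewrite nth_face // !nth_mapr nth_face //; case: ifP => // _; case: ifP.
Qed.

Lemma pullback_cocycle n (f : cochain F H n) :
  cobound f = 0 -> cobound (pullback f) = 0.
Proof. by rewrite -pullback_cobound => ->; rewrite pullback0. Qed.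

Lemma pullback_is_cobound n (f : cochain F H n) :
  is_cobound f -> is_cobound (pullback f).
Proof.
case: n f => [f ->|n f [g ->]] /=; first by rewrite pullback0.
by exists (pullback g); rewrite pullback_cobound.
Qed.

Definition inflation n (c : cohomology F H n) : cohomology F G n :=
  cohcls (pullback (cohrep c)).

Lemma inflation_cls n (f : cochain F H n) : cobound f = 0 ->
  inflation (cohcls f) = cohcls (pullback f).
Proof.
move=> hf; have hr := cohrepP (cohcls f).
apply/cohcls_eq; try exact: pullback_cocycle.
have -> : pullback (cohrep (cohcls f)) - pullback f =
    pullback (cohrep (cohcls f) - f) by apply/ffunP=> t; rewrite !ffunE.
by apply/pullback_is_cobound/cohcls_eq; rewrite // cohrepK.
Qed.

Lemma inflationP n a (x y : cohomology F H n) :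
  inflation (a *: x + y) = a *: inflation x + inflation y.
Proof.
rewrite -[x]cohrepK -[y]cohrepK; have := (cohrepP x, cohrepP y).
move: (cohrep x) (cohrep y) => u v [hu hv].
rewrite -cohclsP // !inflation_cls //; last exact: cocyclesP.
by rewrite pullbackP cohclsP //; apply: pullback_cocycle.
Qed.

Lemma inflationM m n (x : cohomology F H m) (y : cohomology F H n) :
  inflation (gmul x y) = gmul (inflation x) (inflation y).
Proof.
rewrite -[x]cohrepK -[y]cohrepK; have := (cohrepP x, cohrepP y).
move: (cohrep x) (cohrep y) => u v [hu hv].
rewrite cohclsM // !inflation_cls //; last exact: cocyclesM.
by rewrite pullback_cup cohclsM //; apply: pullback_cocycle.
Qed.

Lemma inflation1 : inflation (gone (cohomology F H)) = gone (cohomology F G).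
Proof. by rewrite -!cohcls1 inflation_cls ?pullback_one //; apply: cocycles1. Qed.

End Functoriality.

(* A tower stands for the profinite group \lim_k tgrp k. *)
Record tower := Tower {
  tgrp :> nat -> finGroupType;
  tmap : forall k, tgrp k.+1 -> tgrp k;
  tmapM : forall k, {morph @tmap k : x y / (x * y)%g};
  tmap_surj : forall k (y : tgrp k), exists x, tmap x = y
}.

Section SeqProduct.
Variables (F : fieldType).

Definition seqprod (V : nat -> lmodType F) : Type := forall k, V k.

Section Lmod.
Variable V : nat -> lmodType F.
Implicit Types u v w : seqprod V.
HB.instance Definition _ := Choice.copy (seqprod V) (forall k, V k).

Definition sp0 : seqprod V := fun k => 0.
Definition spN u : seqprod V := fun k => - u k.
Definition spD u v : seqprod V := fun k => u k + v k.
Definition spZ a u : seqprod V := fun k => a *: u k.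

Lemma spDA : associative spD.
Proof. by move=> u v w; apply: functional_extensionality_dep => k; apply: addrA. Qed.
Lemma spDC : commutative spD.
Proof. by move=> u v; apply: functional_extensionality_dep => k; apply: addrC. Qed.
Lemma sp0D : left_id sp0 spD.
Proof. by move=> u; apply: functional_extensionality_dep => k; apply: add0r. Qed.
Lemma spND : left_inverse sp0 spN spD.
Proof. by move=> u; apply: functional_extensionality_dep => k; apply: addNr. Qed.
HB.instance Definition _ := GRing.isZmodule.Build (seqprod V) spDA spDC sp0D spND.

Lemma spZA a b u : spZ a (spZ b u) = spZ (a * b) u.
Proof. by apply: functional_extensionality_dep => k; apply: scalerA. Qed.
Lemma sp1Z : left_id 1 spZ.
Proof. by move=> u; apply: functional_extensionality_dep => k; apply: scale1r. Qed.
Lemma spZDr : right_distributive spZ +%R.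
Proof. by move=> a u v; apply: functional_extensionality_dep => k; apply: scalerDr. Qed.
Lemma spZDl u : {morph spZ^~ u : a b / a + b}.
Proof. by move=> a b; apply: functional_extensionality_dep => k; apply: scalerDl. Qed.
HB.instance Definition _ :=
  GRing.Zmodule_isLmodule.Build F (seqprod V) spZA sp1Z spZDr spZDl.
End Lmod.

Variable A : nat -> gradedAlg F.
Local Notation P n := (seqprod (fun k => A k n)).

Definition sp_one : P 0%N := fun k => gone (A k).
Definition sp_mul m n (u : P m) (v : P n) : P (m + n)%N :=
  fun k => gmul (u k) (v k).
Lemma sp_linl m n a (x y : P m) (z : P n) :
  sp_mul (a *: x + y) z = a *: sp_mul x z + sp_mul y z.
Proof. by apply: functional_extensionality_dep => k; apply: gmul_linl. Qed.
Lemma sp_linr m n a (z : P m) (x y : P n) :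
  sp_mul z (a *: x + y) = a *: sp_mul z x + sp_mul z y.
Proof. by apply: functional_extensionality_dep => k; apply: gmul_linr. Qed.
Lemma sp_cast m n (e : m = n) (x : P m) k :
  @gcast (fun i => P i) m n e x k = @gcast (fun i => A k i) m n e (x k).
Proof. by case: n / e. Qed.
Lemma sp_mulA m n l (x : P m) (y : P n) (z : P l) :
  @gcast (fun i => P i) _ _ (addnA m n l) (sp_mul x (sp_mul y z)) =
  sp_mul (sp_mul x y) z.
Proof. by apply: functional_extensionality_dep => k; rewrite sp_cast; apply: gmulA. Qed.
Lemma sp_mul1l n (x : P n) : sp_mul sp_one x = x.
Proof. by apply: functional_extensionality_dep => k; apply: gmul1l. Qed.
Lemma sp_mul1r n (x : P n) :
  @gcast (fun i => P i) _ _ (addn0 n) (sp_mul x sp_one) = x.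
Proof. by apply: functional_extensionality_dep => k; rewrite sp_cast; apply: gmul1r. Qed.

Definition seqprodAlg : gradedAlg F :=
  @GradedAlg F (fun n => P n : lmodType F) sp_one sp_mul
    sp_linl sp_linr sp_mulA sp_mul1l sp_mul1r.
End SeqProduct.

Section ContinuousCohomology.
Variables (F : fieldType) (G : tower).

Let C := seqprodAlg (fun k => cohomology F (G k)).

(* H^*_cont(\lim_k G_k; F) is the direct limit of the H^*(G_k; F) along the
   inflation maps, realized as the sequences that are eventually compatible with
   inflation, modulo the eventually zero ones; addition and cup product are
   taken termwise. Lemmas [colim_incl_inflation], [colim_incl_surj] and
   [colim_incl_eq0] below identify it with the usual direct limit. *)
Definition ev_compatible n (s : C n) : Prop :=
  exists N, forall k, (N <= k)%N -> s k.+1 = inflation (@tmap G k) (s k).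
Definition ev_zero n (s : C n) : Prop :=
  exists N, forall k, (N <= k)%N -> s k = 0.

Lemma inflation0 k n : inflation (@tmap G k) (0 : cohomology F (G k) n) = 0.
Proof.
have := inflationP (@tmapM G k) 1 (0 : cohomology F (G k) n) 0.
by rewrite !scale1r addr0 => e; apply: (addrI (inflation (@tmap G k) 0)); rewrite -e addr0.
Qed.

Lemma ev_compatible0 n : ev_compatible (0 : C n).
Proof. by exists 0%N => k _; rewrite inflation0. Qed.
Lemma ev_compatibleP n a (s t : C n) :
  ev_compatible s -> ev_compatible t -> ev_compatible (a *: s + t).
Proof.
move=> [N hN] [M hM]; exists (maxn N M) => k; rewrite geq_max => /andP[/hN hs /hM ht].
have -> : (a *: s + t) k = a *: s k + t k by [].
by rewrite (inflationP (@tmapM G k)) -hs -ht.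
Qed.
Lemma ev_zero0 n : ev_zero (0 : C n).
Proof. by exists 0%N. Qed.
Lemma ev_zeroP n a (s t : C n) : ev_zero s -> ev_zero t -> ev_zero (a *: s + t).
Proof.
move=> [N hN] [M hM]; exists (maxn N M) => k; rewrite geq_max => /andP[/hN hs /hM ht].
have -> : (a *: s + t) k = a *: s k + t k by [].
by rewrite hs ht scaler0 addr0.
Qed.

Definition compatible_sub n : submod (C n) :=
  @Submod F (C n) (@ev_compatible n) (ev_compatible0 n) (@ev_compatibleP n).
Definition zero_sub n : submod (C n) :=
  @Submod F (C n) (@ev_zero n) (ev_zero0 n) (@ev_zeroP n).

Lemma ev_compatible1 : ev_compatible (gone C).
Proof. by exists 0%N => k _; apply/esym/(inflation1 F (@tmapM G k)). Qed.
Lemma ev_compatibleM m n (s : C m) (t : C n) :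
  ev_compatible s -> ev_compatible t -> ev_compatible (gmul s t).
Proof.
move=> [N hN] [M hM]; exists (maxn N M) => k; rewrite geq_max => /andP[/hN hs /hM ht].
have E i : (gmul s t) i = @gmul _ (cohomology F (G i)) m n (s i) (t i) by [].
by rewrite !E hs ht (inflationM (@tmapM G k)).
Qed.
Lemma ev_zeroMr m n (s : C m) (t : C n) :
  ev_zero s -> ev_compatible t -> ev_zero (gmul s t).
Proof.
move=> [N hN] _; exists N => k /hN hs.
rewrite -[LHS]/(@gmul _ (cohomology F (G k)) m n (s k) (t k)) hs.
by rewrite -(subrr 0) gmulBl subrr.
Qed.
Lemma ev_zeroMl m n (s : C m) (t : C n) :
  ev_compatible s -> ev_zero t -> ev_zero (gmul s t).
Proof.
move=> _ [N hN]; exists N => k /hN hs.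
rewrite -[LHS]/(@gmul _ (cohomology F (G k)) m n (s k) (t k)) hs.
by rewrite -(subrr 0) gmulBr subrr.
Qed.

Definition colimit_pair : gradedIdealPair C :=
  @GradedIdealPair F C compatible_sub zero_sub
    ev_compatible1 ev_compatibleM ev_zeroMr ev_zeroMl.

Definition contCohomology : gradedAlg F := subquotAlg colimit_pair.

End ContinuousCohomology.

Section Colimit.
Variables (F : fieldType) (G : tower) (n : nat).
Local Notation H k := (cohomology F (G k) n).
Let C := seqprodAlg (fun k => cohomology F (G k)).

(* The sequence that is 0 before k, is a at k and is its iterated inflation
   afterwards. *)
Fixpoint tail_seq k (a : H k) (j : nat) : H j :=
  match @eqP _ k j with
  | ReflectT e => @gcast (fun j => H j) k j e a
  | ReflectF _ =>
      match j return H j with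
      | 0 => 0
      | i.+1 => inflation (@tmap G i) (tail_seq a i)
      end
  end.

Definition colim_incl k (a : H k) : contCohomology F G n :=
  sqcls (compatible_sub F G n) (zero_sub F G n) (tail_seq a : C n).

Lemma tail_seq_id k (a : H k) : tail_seq a k = a.
Proof.
by case: k a => [|k] a /=; case: eqP => // e; rewrite (eq_irrelevance e erefl).
Qed.

Lemma tail_seqS k (a : H k) j : (k <= j)%N ->
  tail_seq a j.+1 = inflation (@tmap G j) (tail_seq a j).
Proof.
move=> le_kj /=; case: eqP => // e.
by exfalso; move: le_kj; rewrite e ltnn.
Qed.

Lemma tail_seq_compatible k (a : H k) : compatible_sub F G n (tail_seq a : C n).
Proof. by exists k => j /tail_seqS ->. Qed.

Lemma tail_seq_inflation k (a : H k) j : (k < j)%N ->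
  tail_seq (inflation (@tmap G k) a) j = tail_seq a j.
Proof.
elim: j => // j IHj; rewrite ltnS leq_eqVlt => /orP[/eqP <-|lt_kj].
  by rewrite tail_seq_id tail_seqS ?tail_seq_id.
by rewrite !tail_seqS ?IHj // ltnW.
Qed.

Lemma colim_incl_inflation k (a : H k) :
  colim_incl (inflation (@tmap G k) a) = colim_incl a.
Proof.
apply/sqcls_eq; try exact: tail_seq_compatible.
exists k.+1 => j lt_kj; rewrite -[LHS]/(tail_seq _ j - tail_seq _ j).
by rewrite tail_seq_inflation // subrr.
Qed.

Lemma colim_incl_surj (c : contCohomology F G n) : exists k a, c = @colim_incl k a.
Proof.
have [N hN] := sqrepP c; pose s : C n := sqrep c.
exists N, (s N); rewrite -[LHS]sqrepK.
apply/sqcls_eq; [exact: sqrepP|exact: tail_seq_compatible|].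
exists N => k le_Nk; rewrite -[LHS]/(s k - tail_seq (s N) k).
apply/eqP; rewrite subr_eq0; apply/eqP.
elim: k le_Nk => [|k IHk]; first by rewrite leqn0 => /eqP ->; rewrite tail_seq_id.
rewrite leq_eqVlt => /orP[/eqP <-|]; first by rewrite tail_seq_id.
by rewrite ltnS => le_Nk; rewrite tail_seqS // -IHk //; apply: hN.
Qed.

Lemma tail_seq0 k (a : H k) j l :
  (k <= j)%N -> (j <= l)%N -> tail_seq a j = 0 -> tail_seq a l = 0.
Proof.
move=> le_kj; elim: l => [|l IHl]; first by rewrite leqn0 => /eqP ->.
rewrite leq_eqVlt => /orP[/eqP <- //|]; rewrite ltnS => le_jl aj0.
by rewrite tail_seqS ?(leq_trans le_kj) // IHl // inflation0.
Qed.

Lemma colim_incl_eq0 k (a : H k) :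
  colim_incl a = 0 <-> exists2 j, (k <= j)%N & tail_seq a j = 0.
Proof.
have E0 : sqcls (compatible_sub F G n) (zero_sub F G n) (0 : C n) = 0.
  apply: (addrI (sqcls (compatible_sub F G n) (zero_sub F G n) (0 : C n))).
  by rewrite -sqclsD ?addr0 //; apply: smem0.
rewrite -E0; split.
  move/sqcls_eq => /(_ (tail_seq_compatible a) (smem0 _)) [N hN].
  exists (maxn k N); rewrite ?leq_maxl //.
  by have := hN _ (leq_maxr k N); rewrite subr0.
case=> j le_kj aj0; apply/sqcls_eq; [exact: tail_seq_compatible|exact: smem0|].
by exists j => l le_jl; rewrite subr0; apply: tail_seq0 aj0.
Qed.

Lemma colim_inclP k c (a b : H k) :
  colim_incl (c *: a + b) = c *: colim_incl a + colim_incl b.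
Proof.
rewrite -sqclsP; try exact: tail_seq_compatible.
apply/sqcls_eq; [exact: tail_seq_compatible|apply: smemP; exact: tail_seq_compatible|].
exists k => j le_kj.
rewrite -[LHS]/(tail_seq _ j - (c *: tail_seq a j + tail_seq b j)).
apply/eqP; rewrite subr_eq0; apply/eqP.
elim: j le_kj => [|j IHj]; first by rewrite leqn0 => /eqP e; subst k; rewrite !tail_seq_id.
rewrite leq_eqVlt => /orP[/eqP e|]; first by subst k; rewrite !tail_seq_id.
by rewrite ltnS => le_kj; rewrite !tail_seqS // IHj // (inflationP (@tmapM G j)).
Qed.

End Colimit.

Lemma colim_inclM (F : fieldType) (G : tower) m n k
    (a : cohomology F (G k) m) (b : cohomology F (G k) n) :
  colim_incl (gmul a b) = gmul (colim_incl a) (colim_incl b).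
Proof.
pose C := seqprodAlg (fun k => cohomology F (G k)).
have hM := @sq_mul_cls F C (colimit_pair F G) m n (tail_seq a : C m)
  (tail_seq b : C n) (tail_seq_compatible a) (tail_seq_compatible b).
rewrite [RHS]hM; apply/sqcls_eq; first exact: tail_seq_compatible.
  by apply: ev_compatibleM; apply: tail_seq_compatible.
exists k => j le_kj.
rewrite -[LHS]/(tail_seq _ j - @gmul _ (cohomology F (G j)) m n (tail_seq a j) (tail_seq b j)).
apply/eqP; rewrite subr_eq0; apply/eqP.
elim: j le_kj => [|j IHj]; first by rewrite leqn0 => /eqP e; subst k; rewrite !tail_seq_id.
rewrite leq_eqVlt => /orP[/eqP e|]; first by subst k; rewrite !tail_seq_id.
by rewrite ltnS => le_kj; rewrite !tail_seqS // IHj // (inflationM (@tmapM G j)).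
Qed.

Definition aut_app (K : finGroupType) (f : [subg Aut [set: K]]) (x : K) : K :=
  (sgval f : {perm K}) x.

Section Holomorph.
Variable K : finGroupType.

Record hol := Hol { hol_aut : [subg Aut [set: K]]; hol_elt : K }.

Definition pair_of_hol (a : hol) := (hol_aut a, hol_elt a).
Definition hol_of_pair p := Hol p.1 p.2.
Lemma pair_of_holK : cancel pair_of_hol hol_of_pair.
Proof. by case. Qed.
HB.instance Definition _ := Finite.copy hol (can_type pair_of_holK).

Implicit Types f g : [subg Aut [set: K]].
Lemma autM f x y : aut_app f (x * y)%g = (aut_app f x * aut_app f y)%g.
Proof. by rewrite /aut_app (morphicP (Aut_morphic (valP f))) ?inE. Qed.
Lemma aut_mul f g x : aut_app (f * g)%g x = aut_app g (aut_app f x).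
Proof. by rewrite /aut_app -permM. Qed.
Lemma aut_one x : aut_app (1%g : [subg Aut [set: K]]) x = x.
Proof. by rewrite -[RHS]perm1. Qed.

Definition hol_one := Hol 1%g 1%g.
(* (f, x) (g, y) = (f g, g^-1(x) y), where f g is the composite z |-> f (g z);
   the product of permutations composes in the opposite order. *)
Definition hol_mul (a b : hol) : hol :=
  let: (Hol f x, Hol g y) := (a, b) in
  Hol (g * f)%g (aut_app g^-1%g x * y)%g.
Definition hol_inv (a : hol) : hol :=
  let: Hol f x := a in Hol f^-1%g (aut_app f x^-1)%g.

Lemma hol_mulA : associative hol_mul.
Proof.
move=> [f x] [g y] [h z]; rewrite /hol_mul; congr Hol; first by rewrite mulgA.
by rewrite invMg aut_mul autM mulgA.
Qed.
Lemma hol_mul1 : left_id hol_one hol_mul.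
Proof.
move=> [f x]; rewrite /hol_mul /=; congr Hol; first by rewrite mulg1.
by rewrite -[RHS]mul1g; congr (_ * _)%g; apply: (mulgI (aut_app f^-1%g 1%g));
  rewrite -autM !mulg1.
Qed.
Lemma hol_mulV : left_inverse hol_one hol_inv hol_mul.
Proof.
move=> [f x]; rewrite /hol_mul /hol_inv; congr Hol; first by rewrite mulgV.
by rewrite -aut_mul mulgV aut_one mulVg.
Qed.
HB.instance Definition _ := Finite_isGroup.Build hol hol_mulA hol_mul1 hol_mulV.

End Holomorph.

Section HolomorphMap.
Variables (K L : finGroupType) (r : K -> L).

(* The automorphism g of L such that g \o r = r \o f. The default value is
   irrelevant here: for the maps r used below g exists ([induced_autP]) and is
   unique ([induced_aut_uniq]). *)
Definition induced_aut (f : [subg Aut [set: K]]) : [subg Aut [set: L]] :=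
  odflt 1%g [pick g : [subg Aut [set: L]] |
    [forall z : K, aut_app g (r z) == r (aut_app f z)]].

Definition hol_map (a : hol K) : hol L :=
  Hol (induced_aut (hol_aut a)) (r (hol_elt a)).

Hypothesis rM : {morph r : x y / (x * y)%g}.
Hypothesis r_surj : forall y, exists x, r x = y.
Hypothesis r_desc : forall f : [subg Aut [set: K]],
  exists g : [subg Aut [set: L]], forall z, aut_app g (r z) = r (aut_app f z).
Hypothesis r_lift : forall g : [subg Aut [set: L]],
  exists f : [subg Aut [set: K]], forall z, aut_app g (r z) = r (aut_app f z).

Lemma induced_autP f z : aut_app (induced_aut f) (r z) = r (aut_app f z).
Proof.
rewrite /induced_aut; case: pickP => [g /forallP/(_ z)/eqP //|h].
by have [g hg] := r_desc f; have /forallP[] := h g => w; rewrite hg.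
Qed.

Lemma induced_aut_uniq f g :
  (forall z, aut_app g (r z) = r (aut_app f z)) -> induced_aut f = g.
Proof.
move=> h; apply/val_inj/permP => y; have [x <-] := r_surj y.
by rewrite -[LHS]/(aut_app _ _) induced_autP -h.
Qed.

Lemma hol_mapM : {morph hol_map : a b / (a * b)%g}.
Proof.
move=> [f x] [g y]; rewrite /hol_map /=; congr Hol.
  by apply: induced_aut_uniq => z; rewrite !aut_mul !induced_autP.
rewrite rM; congr (_ * _)%g; rewrite -induced_autP; congr (aut_app _ _).
apply: induced_aut_uniq => z; apply: (@perm_inj _ (sgval (induced_aut g))).
by rewrite -!/(aut_app _ _) -aut_mul mulVg aut_one induced_autP -aut_mul mulVg aut_one.
Qed.

Lemma hol_map_surj b : exists a, hol_map a = b.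
Proof.
case: b => g y; have [f hf] := r_lift g; have [x hx] := r_surj y.
by exists (Hol f x); rewrite /hol_map /= hx (induced_aut_uniq hf).
Qed.
End HolomorphMap.

Section CyclicHolomorph.
Variables (p : nat) (p_pr : prime p).

(* 'Z_m is the additive cyclic group of order m as m = p ^ k.+1 > 1; levels
   are numbered from k = 0, so that level k carries Hol(Z_(p^(k+1))). *)
Definition Zpow (k : nat) : finGroupType := 'Z_(p ^ k.+1).

Definition Zpow_red (k : nat) (x : Zpow k.+1) : Zpow k :=
  (nat_of_ord (x : 'Z_(p ^ k.+2)))%:R : 'Z_(p ^ k.+1).

Lemma Zpow_gt1 k : (1 < p ^ k.+1)%N.
Proof. by rewrite -{1}(exp1n k.+1) ltn_exp2r // prime_gt1. Qed.

Lemma Zpow_red_nat k (a : nat) : @Zpow_red k (a%:R : 'Z_(p ^ k.+2)) = (a%:R : 'Z_(p ^ k.+1)).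
Proof.
rewrite /Zpow_red val_Zp_nat ?Zpow_gt1 //; apply: val_inj.
by rewrite /= !val_Zp_nat ?Zpow_gt1 // modn_dvdm // [(p ^ k.+2)%N]expnS dvdn_mull.
Qed.

Lemma Zpow_nat k (x : Zpow k) : exists a : nat, x = (a%:R : 'Z_(p ^ k.+1)).
Proof. by exists (nat_of_ord (x : 'Z_(p ^ k.+1))); apply/esym/natr_Zp. Qed.

Lemma Zpow_mulE k (a b : nat) :
  ((a%:R : 'Z_(p ^ k.+1)) * (b%:R : 'Z_(p ^ k.+1)))%g = (a + b)%:R :> Zpow k.
Proof. by rewrite natrD. Qed.

Lemma Zpow_addE k (x y : 'Z_(p ^ k.+1)) : ((x : Zpow k) * y)%g = x + y.
Proof. by []. Qed.

Lemma Zpow_redM k : {morph @Zpow_red k : x y / (x * y)%g}.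
Proof.
move=> x y; have [a ->] := Zpow_nat x; have [b ->] := Zpow_nat y.
by rewrite Zpow_mulE !Zpow_red_nat Zpow_mulE.
Qed.

Lemma Zpow_red_surj k (y : Zpow k) : exists x, Zpow_red x = y.
Proof.
by exists ((nat_of_ord (y : 'Z_(p ^ k.+1)))%:R : 'Z_(p ^ k.+2)); rewrite Zpow_red_nat natr_Zp.
Qed.

Lemma Zpow_aut_mul k (f : [subg Aut [set: Zpow k]]) :
  exists2 a : nat, coprime p a &
    forall b : nat, aut_app f (b%:R : 'Z_(p ^ k.+1)) = ((b * a)%:R : 'Z_(p ^ k.+1)).
Proof.
have fE (g : [subg Aut [set: Zpow k]]) (b : nat) :
    aut_app g (b%:R : 'Z_(p ^ k.+1)) =
    ((b * nat_of_ord (aut_app g (1%R : 'Z_(p ^ k.+1)) : 'Z_(p ^ k.+1)))%:R : 'Z_(p ^ k.+1)).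
  rewrite natrM natr_Zp; elim: b => [|b IHb].
    rewrite mul0r; have := autM g 1%g 1%g; rewrite mulg1 => e.
    by apply: (mulgI (aut_app g 1%g)); rewrite -[X in (_ * X)%g = _]/(aut_app g 1%g) -e; exact/esym/mulg1.
  by rewrite -[b.+1]addn1 -[X in aut_app g X]Zpow_mulE autM IHb natrD mulrDl mul1r.
exists (nat_of_ord (aut_app f (1%R : 'Z_(p ^ k.+1)) : 'Z_(p ^ k.+1))) => //.
set a := nat_of_ord _; pose b := nat_of_ord (aut_app f^-1%g (1%R : 'Z_(p ^ k.+1)) : 'Z_(p ^ k.+1)).
have : (b * a)%:R = 1 :> 'Z_(p ^ k.+1).
  by rewrite -fE natr_Zp -aut_mul mulVg aut_one.
move/(congr1 (fun x : 'Z_(p ^ k.+1) => nat_of_ord x)).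
rewrite (val_Zp_nat (Zpow_gt1 k)) => e.
rewrite prime_coprime //; apply/negP => p_a.
have : (p %| (b * a) %% p ^ k.+1)%N.
  by rewrite /dvdn modn_dvdm ?dvdn_exp //; apply: dvdn_mull.
by rewrite e dvdn1 => /eqP p1; move: p_pr; rewrite p1.
Qed.

Lemma Zpow_mul_aut k (a : nat) : coprime p a ->
  exists f : [subg Aut [set: Zpow k]],
    forall b : nat, aut_app f (b%:R : 'Z_(p ^ k.+1)) = ((b * a)%:R : 'Z_(p ^ k.+1)).
Proof.
move=> cpa; pose h (x : Zpow k) : Zpow k := ((x : 'Z_(p ^ k.+1)) * a%:R : 'Z_(p ^ k.+1)).
have ua : (a%:R : 'Z_(p ^ k.+1)) \is a GRing.unit.
  by rewrite unitZpE ?Zpow_gt1 // coprimeXl.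
have h_inj : injective h by move=> x y /(mulIr ua).
have hA : perm h_inj \in Aut [set: Zpow k].
  rewrite inE; apply/andP; split; first by apply/subsetP => x; rewrite inE.
  apply/morphicP => x y _ _; rewrite !permE /h.
  exact: (mulrDl (x : 'Z_(p ^ k.+1)) y a%:R).
by exists (Subg hA) => b; rewrite /aut_app /= permE /h natrM.
Qed.

Lemma Zpow_desc k (f : [subg Aut [set: Zpow k.+1]]) :
  exists g : [subg Aut [set: Zpow k]],
    forall z, aut_app g (Zpow_red z) = Zpow_red (aut_app f z).
Proof.
have [a ca fE] := Zpow_aut_mul f; have [g gE] := Zpow_mul_aut k ca.
exists g => z; have [b ->] := Zpow_nat z.
by rewrite Zpow_red_nat gE fE Zpow_red_nat.
Qed.

Lemma Zpow_lift k (g : [subg Aut [set: Zpow k]]) :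
  exists f : [subg Aut [set: Zpow k.+1]],
    forall z, aut_app g (Zpow_red z) = Zpow_red (aut_app f z).
Proof.
have [a ca gE] := Zpow_aut_mul g; have [f fE] := Zpow_mul_aut k.+1 ca.
exists f => z; have [b ->] := Zpow_nat z.
by rewrite Zpow_red_nat gE fE Zpow_red_nat.
Qed.

Definition hol_tower : tower :=
  @Tower (fun k => hol (Zpow k)) (fun k => hol_map (@Zpow_red k))
    (fun k => hol_mapM (@Zpow_redM k) (@Zpow_red_surj k) (@Zpow_desc k))
    (fun k => hol_map_surj (@Zpow_red_surj k) (@Zpow_desc k) (@Zpow_lift k)).

End CyclicHolomorph.

Section ConstantAlgebra.
Variables (F : fieldType) (A : algType F).

Lemma const_cast m n (e : m = n) (x : A) : @gcast (fun=> A) m n e x = x.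
Proof. by case: n / e. Qed.
Lemma const_linl (a : F) (x y z : A) : (a *: x + y) * z = a *: (x * z) + y * z.
Proof. by rewrite mulrDl scalerAl. Qed.
Lemma const_linr (a : F) (z x y : A) : z * (a *: x + y) = a *: (z * x) + z * y.
Proof. by rewrite mulrDr scalerAr. Qed.
Lemma const_mulA m n k (x y z : A) :
  @gcast (fun=> A) _ _ (addnA m n k) (x * (y * z)) = x * y * z.
Proof. by rewrite const_cast mulrA. Qed.
Lemma const_mul1r n (x : A) : @gcast (fun=> A) _ _ (addn0 n) (x * 1) = x.
Proof. by rewrite const_cast mulr1. Qed.

Definition constAlg : gradedAlg F :=
  @GradedAlg F (fun=> A : lmodType F) 1 (fun m n => *%R)
    (fun m n => const_linl) (fun m n => const_linr) const_mulA
    (fun n => @mul1r A) const_mul1r.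
End ConstantAlgebra.

Section Presentation.
Variables (F : fieldType) (k : nat) (rels : seq {mpoly F[k]}).
Let C := constAlg ({mpoly F[k]} : algType F).

Definition in_ideal (q : {mpoly F[k]}) : Prop :=
  exists c : nat -> {mpoly F[k]}, q = \sum_(i < size rels) c i * rels`_i.

Lemma in_ideal0 : in_ideal 0.
Proof. by exists (fun=> 0); rewrite big1 // => i _; rewrite mul0r. Qed.
Lemma in_idealP a q r : in_ideal q -> in_ideal r -> in_ideal (a *: q + r).
Proof.
move=> [c ->] [d ->]; exists (fun i => a *: c i + d i).
rewrite scaler_sumr -big_split; apply: eq_bigr => i _.
by rewrite mulrDl scalerAl.
Qed.
Lemma in_idealM q r : in_ideal r -> in_ideal (q * r).
Proof.
move=> [c ->]; exists (fun i => q * c i).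
by rewrite mulr_sumr; apply: eq_bigr => i _; rewrite mulrA.
Qed.

Lemma homog0 n : (0 : {mpoly F[k]}) \is n.-homog.
Proof. exact: dhomog0. Qed.
Lemma homogP n a (q r : {mpoly F[k]}) :
  q \is n.-homog -> r \is n.-homog -> a *: q + r \is n.-homog.
Proof. by move=> hq hr; rewrite dhomogD ?dhomogZ. Qed.

Definition homog_sub n : submod (C n) :=
  @Submod F (C n) (fun q => q \is n.-homog) (homog0 n) (@homogP n).
Definition ideal_sub n : submod (C n) :=
  @Submod F (C n) in_ideal in_ideal0 in_idealP.

Definition presentation_pair : gradedIdealPair C :=
  @GradedIdealPair F C homog_sub ideal_sub (dhomog1 _ _)
    (fun m n x y hx hy => dhomogM hx hy)
    (fun m n x y hx _ => ltac:(rewrite /= mulrC; exact: in_idealM))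
    (fun m n x y _ hy => in_idealM x hy).

(* F[X_0, ..., X_(k-1)] / (rels), all variables having degree 1. The ideal is
   graded when the elements of rels are homogeneous; component n is the space
   of homogeneous polynomials of degree n modulo those lying in the ideal. *)
Definition presentedAlg : gradedAlg F := subquotAlg presentation_pair.
End Presentation.

(* The exterior algebra on a single generator x is F[x] / (x^2). *)
Definition exteriorAlg1 (F : fieldType) : gradedAlg F :=
  let x : {mpoly F[1]} := 'X_0 in
  @presentedAlg F 1 [:: x ^+ 2].

(* \Lambda(x) \otimes F[u, y] / (u^2 = u x + u y), as a quotient of F[x, u, y].
   This presentation by commuting variables is the graded tensor product in
   characteristic 2, where no signs occur. *)
Definition exterior_xuyAlg (F : fieldType) : gradedAlg F :=
  let x : {mpoly F[3]} := 'X_0 in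
  let u : {mpoly F[3]} := 'X_1 in
  let y : {mpoly F[3]} := 'X_2 in
  @presentedAlg F 3 [:: x ^+ 2; u ^+ 2 - (u * x + u * y)].

Definition has_dim (F : fieldType) (V : lmodType F) (d : nat) : Prop :=
  exists e : 'I_d -> V,
    forall v, exists! c : {ffun 'I_d -> F}, v = \sum_i c i *: e i.

Definition poincare_series (F : fieldType) (A : gradedAlg F) (s : nat -> int) : Prop :=
  forall n, exists2 d : nat, has_dim (A n) d & s n = d%:Z.

(* s is the coefficient sequence of the formal power series P / Q. *)
Definition expands_to (R : comUnitRingType) (P Q : {poly R}) (s : nat -> R) : Prop :=
  Q`_0 \is a GRing.unit /\
  forall n, \sum_(i < n.+1) Q`_i * s (n - i)%N = P`_n.

(* Main.v *)
Require Import Defs.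
From HB Require Import structures.
From mathcomp Require Import all_boot all_order all_algebra all_fingroup.
From mathcomp Require Import cyclic finfield mpoly.
From mathcomp Require Import boolp functions.
From mathcomp Require Import ring zify.

(* Let X be the monoid of the affine maps z |-> a z + b with a, b integers and p
   prime to a. It maps onto each Hol(Z_(p^n)), so continuous cochains of the
   limit are the homogeneous cochains on X that factor through some level and are
   invariant under left translations. Invariance is imposed one generator t at a
   time. If A is the complex of the cochains invariant under the previous
   generators and B that of the t-invariant ones among them, then
   0 -> B -> A -> D -> 0, with second map f |-> t f - f, is exact for D = A when t
   generates a copy of Z_p up to a finite group of order prime to p (sum along
   the orbits of t, at a higher level where the sum over a period vanishes), and
   for D = B when p = 2 and t = -1. The connecting map is the cup product with a
   class of degree 1. All cochains on X form an acyclic complex; the generator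
   z + 1 adds a class u of degree 1.
   For p odd, let t be the multiplication by some r generating all the groups
   (Z/p^n)^*: it multiplies u by r <> 1 mod p, so only H^0 contributes, and the
   result is spanned by 1 and one class x.
   For p = 2 the multiplications by 5 and by -1 fix u and add classes x, with
   x^2 = 0, and w, with u^2 = u w; finally y = w + x. *)

Set Implicit Arguments.
Unset Strict Implicit.
Unset Printing Implicit Defensive.

Import Order.TTheory GRing.Theory Num.Theory.
Local Open Scope ring_scope.

(** * Homogeneous cochains *)

(** Integral affine maps put the cochains of all levels on one set: a cochain and its inflation
    become the same function on X, so the direct limit is a union and no transition map is carried
    along. Invariance under a few generators suffices because products of their powers fill each
    finite group, and a cochain of finite level sees nothing more. What makes each connecting map
    explicit is a function xi with t xi - xi = 1: for an invariant cocycle z, xi z is a preimage of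
    z under t - 1, and d(xi z) = (d xi) z. For t = -1, raising the level does not lengthen the
    orbits, so sums along them need not vanish. But t^2 = 1 in characteristic 2 makes t - 1 land in
    the invariants, and multiplication by xi shows that it reaches all of them; having B itself as
    the quotient makes the computation recursive in the degree, hence the polynomial class w. The
    relations come from functions that look one binary digit further: c(c - 1)/2 for x^2 = 0, the
    second digit of the shift for u^2 = u w. Linear independence in the presented algebras is
    inherited from the bases of cocycles. *)

Section Cochains.
Variables (F : fieldType) (X : Type).

(* Homogeneous cochains. An n-cochain is a function of the first n + 1 terms of a
   sequence, so that cochains of all degrees have the same type. *)
Definition scochain := (nat -> X) -> F^o.
Implicit Types (f g h w : scochain) (s : nat -> X).

Lemma scochainD f g s : (f + g) s = f s + g s. Proof. by []. Qed.
Lemma scochainN f s : (- f) s = - f s. Proof. by []. Qed.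
Lemma scochainZ (a : F) f s : (a *: f) s = a * f s. Proof. by []. Qed.

Definition sdiff n f : scochain :=
  fun s => \sum_(i < n.+2) (-1) ^+ i * f (s \o bump i).
Definition scup m f g : scochain := fun s => f s * g (s \o addn m).
Definition twist (t : X -> X) f : scochain := fun s => f (t \o s).

Lemma sdiff_lin n : linear (sdiff n).
Proof.
move=> a f g; apply/funext=> s; rewrite scochainD scochainZ /sdiff mulr_sumr -big_split /=.
by apply: eq_bigr => i _; rewrite mulrDr [a * (_ * _)]mulrCA.
Qed.
HB.instance Definition _ n :=
  GRing.isLinear.Build F scochain scochain _ (sdiff n) (sdiff_lin n).

Lemma sdiffB n f g : sdiff n (f - g) = sdiff n f - sdiff n g.
Proof. exact: linearB. Qed.
Lemma sdiffZ n a f : sdiff n (a *: f) = a *: sdiff n f.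
Proof. exact: linearZ. Qed.

Lemma twist_lin t : linear (twist t).
Proof. by move=> a f g. Qed.
HB.instance Definition _ t :=
  GRing.isLinear.Build F scochain scochain _ (twist t) (twist_lin t).

Lemma scup_linr m f : linear (scup m f).
Proof.
move=> a g h; apply/funext => s; rewrite /scup.
by rewrite !scochainD !scochainZ mulrDr [a * (_ * _)]mulrCA.
Qed.
HB.instance Definition _ m f :=
  GRing.isLinear.Build F scochain scochain _ (scup m f) (scup_linr m f).

Lemma scupBl m f g h : scup m (f - g) h = scup m f h - scup m g h.
Proof. by apply/funext => s; rewrite /scup !scochainD !scochainN mulrBl. Qed.
Lemma scupDl m f g h : scup m (f + g) h = scup m f h + scup m g h.
Proof. by apply/funext => s; rewrite /scup mulrDl. Qed.
Lemma scupZl m a f h : scup m (a *: f) h = a *: scup m f h.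
Proof. by apply/funext => s; rewrite /scup !scochainZ mulrA. Qed.
Lemma scup0l m h : scup m 0 h = 0.
Proof. by apply/funext => s; rewrite /scup mul0r. Qed.
Lemma scupA m n f g h : scup m f (scup n g h) = scup (m + n) (scup m f g) h.
Proof.
apply/funext => s; rewrite /scup mulrA; congr (_ * h _).
by apply/funext => i /=; rewrite addnA.
Qed.
Lemma scup1l f : scup 0 1 f = f.
Proof. by apply/funext => s; rewrite /scup mul1r; congr f; apply/funext. Qed.
Lemma scup1r m f : scup m f 1 = f.
Proof. by apply/funext => s; rewrite /scup mulr1. Qed.

Lemma twist_sdiff t n f : twist t (sdiff n f) = sdiff n (twist t f).
Proof. by []. Qed.
Lemma twist_scup t m f g : twist t (scup m f g) = scup m (twist t f) (twist t g).
Proof. by []. Qed.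

Lemma bump_bump (s : nat -> X) i j : (j <= i)%N ->
  (s \o bump i.+1) \o bump j = (s \o bump j) \o bump i.
Proof. by move=> le_ji; apply/funext=> l /=; congr s; rewrite /bump; lia. Qed.

Lemma sdiff_sdiff n f : sdiff n.+1 (sdiff n f) = 0.
Proof.
apply/funext=> s; rewrite /sdiff /=.
pose a i j : F := (-1) ^+ (i + j) * f ((s \o bump i) \o bump j).
transitivity (\sum_(i < n.+3) \sum_(j < n.+2) a i j).
  apply: eq_bigr => i _; rewrite mulr_sumr; apply: eq_bigr => j _.
  by rewrite mulrA -exprD.
have aS i j : (j <= i)%N -> a i.+1 j = - a j i.
  by move=> le_ji; rewrite /a bump_bump // addSn exprS mulN1r mulNr addnC.
transitivity (\sum_(i < n.+3) \sum_(j < n.+2 | (j < i)%N) a i j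
   + \sum_(i < n.+3) \sum_(j < n.+2 | (i <= j)%N) a i j).
  rewrite -big_split; apply: eq_bigr => i _ /=.
  rewrite (bigID (fun j : 'I_n.+2 => (j < i)%N)) /=; congr (_ + _).
  by apply: eq_bigl => j; rewrite -leqNgt.
rewrite big_ord_recl big_pred0 ?add0r => [|j]; last by rewrite ltn0.
rewrite [X in _ + X]big_ord_recr /= [X in _ + (_ + X)]big_pred0; last first.
  by move=> j; rewrite leqNgt ltn_ord.
rewrite addr0 (eq_bigr (fun i : 'I_n.+2 =>
    - \sum_(j < n.+2 | (j <= i)%N) a j i)); last first.
  by move=> i _; rewrite -sumrN; apply: eq_bigr => j le_ji; rewrite -aS.
rewrite sumrN [X in - X](exchange_big_dep xpredT) //= addrC.
exact: subrr.
Qed.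

Definition sdeg n f := forall s s', (forall i, (i <= n)%N -> s i = s' i) -> f s = f s'.

Lemma sdiff_scup m n f g : sdeg m f ->
  sdiff (m + n) (scup m f g) =
    scup m.+1 (sdiff m f) g + (-1) ^+ m *: scup m f (sdiff n g).
Proof.
move=> hf; apply/funext=> s.
pose a i : F := (-1) ^+ i * scup m f g (s \o bump i).
pose G := g (s \o addn m.+1).
have El i : (i <= m)%N -> a i = (-1) ^+ i * f (s \o bump i) * G.
  move=> le_im; rewrite /a /scup mulrA; congr (_ * g _); apply/funext => j /=.
  by congr s; rewrite /bump; lia.
have Er i : a (m.+1 + i)%N =
    - ((-1) ^+ m * (f s * ((-1) ^+ i.+1 * g ((s \o addn m) \o bump i.+1))) * -1).
  rewrite /a /scup; have -> : f (s \o bump (m.+1 + i)) = f s.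
    by apply: hf => j le_jm /=; congr s; rewrite /bump; lia.
  have -> : ((s \o bump (m.+1 + i)) \o addn m) = ((s \o addn m) \o bump i.+1).
    by apply/funext => j /=; congr s; rewrite /bump; lia.
  rewrite addSn 2!exprS exprD; ring.
rewrite scochainD scochainZ /sdiff /=.
transitivity (\sum_(i < m.+1 + n.+1) a i); first by rewrite addSn addnS.
rewrite big_split_ord /=.
rewrite (eq_bigr (fun i : 'I_m.+1 => (-1) ^+ i * f (s \o bump i) * G)); last first.
  by move=> i _; rewrite El // -ltnS.
rewrite (eq_bigr _ (fun (i : 'I_n.+1) _ => Er i)).
(* The last face in d f and the zeroth face in d g both give f s * G, with opposite signs; neither
   term occurs on the left. *)
rewrite -mulr_suml {1}/scup [in RHS]big_ord_recr /=.
have -> : f (s \o bump m.+1) = f s.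
  by apply: hf => j le_jm /=; congr s; rewrite /bump; lia.
rewrite /scup [X in _ = _ + _ * (_ * X)]big_ord_recl /=.
have -> : ((s \o addn m) \o bump 0) = s \o addn m.+1.
  by apply/funext => j /=; congr s; rewrite /bump; lia.
rewrite -/G sumrN -mulr_suml -!mulr_sumr /bump /=.
under [X in _ = _ + _ * (_ * (_ + X))]eq_bigr => i _ do rewrite add1n.
rewrite exprS; ring.
Qed.

End Cochains.

(** * Bases of the cohomology of invariant cochains *)

Section LinearCombinations.
Variables (F : fieldType) (V : lmodType F).

Definition lcomb (e : seq V) (c : nat -> F) : V := \sum_(i < size e) c i *: e`_i.

Lemma lcombP a e c c' :
  lcomb e (fun i => a * c i + c' i) = a *: lcomb e c + lcomb e c'.
Proof.
rewrite scaler_sumr -big_split /=; apply: eq_bigr => i _.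
by rewrite scalerA -scalerDl.
Qed.
Lemma lcomb0 e : lcomb e (fun=> 0) = 0.
Proof. by rewrite /lcomb big1 // => i _; rewrite scale0r. Qed.
Lemma eq_lcomb e c c' : (forall i, (i < size e)%N -> c i = c' i) -> lcomb e c = lcomb e c'.
Proof. by move=> h; apply: eq_bigr => i _; rewrite h. Qed.
Lemma lcomb_nil c : lcomb [::] c = 0.
Proof. exact: big_ord0. Qed.
Lemma lcomb_seq1 v c : lcomb [:: v] c = c 0%N *: v.
Proof. exact: big_ord1. Qed.
Lemma lcomb_cat e e' c :
  lcomb (e ++ e') c = lcomb e c + lcomb e' (fun i => c (size e + i)%N).
Proof.
rewrite /lcomb size_cat big_split_ord /=; congr (_ + _); apply: eq_bigr => i _.
  by rewrite nth_cat ltn_ord.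
by rewrite nth_cat ltnNge leq_addr /= addKn.
Qed.

Definition catc (e : seq V) (c c' : nat -> F) i :=
  if (i < size e)%N then c i else c' (i - size e)%N.
Lemma lcomb_catc e e' c c' : lcomb (e ++ e') (catc e c c') = lcomb e c + lcomb e' c'.
Proof.
rewrite lcomb_cat; congr (_ + _); apply: eq_lcomb => i hi; first by rewrite /catc hi.
by rewrite /catc ltnNge leq_addr /= addKn.
Qed.
End LinearCombinations.

Lemma lcomb_map (F : fieldType) (V W : lmodType F) (L : {linear V -> W}) e c :
  lcomb (map L e) c = L (lcomb e c).
Proof.
rewrite /lcomb size_map linear_sum; apply: eq_bigr => i _.
by rewrite linearZ_LR (nth_map 0).
Qed.

(** * Invariant cochains of finite level and their cohomology *)

Section InvariantCochains.
Variables (F : fieldType) (X : Type) (lev : nat -> X -> X -> Prop).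
Hypothesis lev_refl : forall k x, lev k x x.
Hypothesis lev_le : forall j k x y, (j <= k)%N -> lev k x y -> lev j x y.
Local Notation cochain := (scochain F X).
Implicit Types (f g h w : cochain) (s : nat -> X) (K D : (X -> X) -> Prop) (e z : seq cochain).

Definition slev n k f := forall s s', (forall i, (i <= n)%N -> lev k (s i) (s' i)) ->
  f s = f s'.

Definition icochain K n f := (exists k, slev n k f) /\ forall t, K t -> twist t f = f.

Lemma slev_le n j k f : (j <= k)%N -> slev n j f -> slev n k f.
Proof. by move=> le_jk hf s s' hs; apply: hf => i /hs; apply: lev_le. Qed.

Lemma slev_sdeg n k f : slev n k f -> sdeg n f.
Proof. by move=> hf s s' hs; apply: hf => i /hs ->. Qed.

Lemma icochain_sdeg K n f : icochain K n f -> sdeg n f.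
Proof. by case=> [[k /slev_sdeg]]. Qed.

Lemma icochain0 K n : icochain K n 0.
Proof. by split=> //; exists 0%N. Qed.
Lemma icochainP K n a f g : icochain K n f -> icochain K n g -> icochain K n (a *: f + g).
Proof.
move=> [[k hf] tf] [[l hg] tg]; split=> [|t Kt]; last by rewrite linearP /= tf // tg.
exists (maxn k l) => s s' hs; rewrite !scochainD !scochainZ.
by rewrite (slev_le (leq_maxl k l) hf hs) (slev_le (leq_maxr k l) hg hs).
Qed.
Lemma icochainZ K n a f : icochain K n f -> icochain K n (a *: f).
Proof. by move=> hf; rewrite -[_ *: _]addr0; apply: icochainP => //; apply: icochain0. Qed.
Lemma icochainD K n f g : icochain K n f -> icochain K n g -> icochain K n (f + g).
Proof. by move=> hf; rewrite -[f]scale1r; apply: icochainP. Qed.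
Lemma icochainB K n f g : icochain K n f -> icochain K n g -> icochain K n (f - g).
Proof. by move=> hf hg; apply: icochainD => //; rewrite -scaleN1r; apply: icochainZ. Qed.
Lemma icochain1 K : icochain K 0 1.
Proof. by split=> //; exists 0%N. Qed.

Lemma icochain_sdiff K n f : icochain K n f -> icochain K n.+1 (sdiff n f).
Proof.
move=> [[k hf] tf]; split=> [|t Kt]; last by rewrite twist_sdiff tf.
exists k => s s' hs; apply: eq_bigr => i _; congr (_ * _).
by apply: hf => j le_jn; apply: hs; rewrite /bump; lia.
Qed.

Lemma icochain_scup K m n f g :
  icochain K m f -> icochain K n g -> icochain K (m + n) (scup m f g).
Proof.
move=> [[k hf] tf] [[l hg] tg]; split=> [|t Kt]; last by rewrite twist_scup tf // tg.
exists (maxn k l) => s s' hs; congr (_ * _).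
  by apply: (slev_le (leq_maxl k l) hf) => i hi; apply: hs; rewrite (leq_trans hi) ?leq_addr.
by apply: (slev_le (leq_maxr k l) hg) => i hi; apply: hs; rewrite leq_add2l.
Qed.

Lemma icochain_sub K K' n f : (forall t, K' t -> K t) -> icochain K n f -> icochain K' n f.
Proof. by move=> sub [cf tf]; split=> // t /sub /tf. Qed.

Definition scobound K n f :=
  if n is m.+1 then exists2 g, icochain K m g & f = sdiff m g else f = 0.

Definition scocycle K n f := icochain K n f /\ sdiff n f = 0.

Definition coh_basis K n e :=
  [/\ forall i, (i < size e)%N -> scocycle K n e`_i,
      forall f, scocycle K n f -> exists c, scobound K n (f - lcomb e c)
    & forall c, scobound K n (lcomb e c) -> forall i, (i < size e)%N -> c i = 0].

Lemma scobound0 K n : scobound K n 0.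
Proof. by case: n => //= n; exists 0; rewrite ?linear0 //; apply: icochain0. Qed.
Lemma scoboundP K n a f g : scobound K n f -> scobound K n g -> scobound K n (a *: f + g).
Proof.
case: n => [-> ->|n [f' hf ->] [g' hg ->]] /=; first by rewrite scaler0 addr0.
by exists (a *: f' + g'); rewrite ?linearP //; apply: icochainP.
Qed.
Lemma scoboundZ K n a f : scobound K n f -> scobound K n (a *: f).
Proof. by move=> hf; rewrite -[_ *: _]addr0; apply: scoboundP => //; apply: scobound0. Qed.
Lemma scoboundD K n f g : scobound K n f -> scobound K n g -> scobound K n (f + g).
Proof. by move=> hf; rewrite -[f]scale1r; apply: scoboundP. Qed.
Lemma scoboundN K n f : scobound K n f -> scobound K n (- f).
Proof. by move=> hf; rewrite -scaleN1r; apply: scoboundZ. Qed.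
Lemma scoboundB K n f g : scobound K n f -> scobound K n g -> scobound K n (f - g).
Proof. by move=> hf hg; apply: scoboundD => //; apply: scoboundN. Qed.
Lemma scobound_sum K n I (r : seq I) (P : pred I) (f : I -> cochain) :
  (forall i, P i -> scobound K n (f i)) -> scobound K n (\sum_(i <- r | P i) f i).
Proof. by move=> h; elim/big_ind: _ => //; [apply: scobound0|apply: scoboundD]. Qed.

Lemma scocycle0 K n : scocycle K n 0.
Proof. by split; rewrite ?linear0 //; apply: icochain0. Qed.
Lemma scocycleP K n a f g : scocycle K n f -> scocycle K n g -> scocycle K n (a *: f + g).
Proof.
move=> [hf df] [hg dg]; split; first exact: icochainP.
by rewrite linearP /= df dg scaler0 addr0.
Qed.
Lemma scocycleZ K n a f : scocycle K n f -> scocycle K n (a *: f).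
Proof. by move=> hf; rewrite -[_ *: _]addr0; apply: scocycleP => //; apply: scocycle0. Qed.
Lemma scocycleD K n f g : scocycle K n f -> scocycle K n g -> scocycle K n (f + g).
Proof. by move=> hf; rewrite -[f]scale1r; apply: scocycleP. Qed.
Lemma scocycleB K n f g : scocycle K n f -> scocycle K n g -> scocycle K n (f - g).
Proof. by move=> hf hg; apply: scocycleD => //; rewrite -scaleN1r; apply: scocycleZ. Qed.
Lemma scocycle_sum K n I (r : seq I) (P : pred I) (f : I -> cochain) :
  (forall i, P i -> scocycle K n (f i)) -> scocycle K n (\sum_(i <- r | P i) f i).
Proof. by move=> h; elim/big_ind: _ => //; [apply: scocycle0|apply: scocycleD]. Qed.
Lemma scocycle_lcomb K n e c :
  (forall i, (i < size e)%N -> scocycle K n e`_i) -> scocycle K n (lcomb e c).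
Proof. by move=> h; apply: scocycle_sum => i _; apply/scocycleZ/h. Qed.
Lemma scocycle1 K : scocycle K 0 1.
Proof.
split; first exact: icochain1.
apply/funext => s; rewrite /sdiff big_ord_recl big_ord1 /=.
by rewrite expr0 expr1 mul1r mulN1r addrN.
Qed.
Lemma scocycle_scup K m n f g :
  scocycle K m f -> scocycle K n g -> scocycle K (m + n) (scup m f g).
Proof.
move=> [hf df] [hg dg]; split; first exact: icochain_scup.
by rewrite sdiff_scup ?df ?dg ?scup0l ?linear0 ?addr0 //; exact: icochain_sdeg hf.
Qed.

Lemma scobound_scupr K m n f g :
  scobound K m f -> scocycle K n g -> scobound K (m + n) (scup m f g).
Proof.
case: m => [-> _|m [f' hf ->] [hg dg]]; first by rewrite scup0l; apply: scobound0.
exists (scup m f' g); first exact: icochain_scup.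
by rewrite sdiff_scup ?dg ?linear0 ?addr0 //; exact: icochain_sdeg hf.
Qed.

Lemma scobound_scupl K m n f g :
  scocycle K m f -> scobound K n g -> scobound K (m + n) (scup m f g).
Proof.
case: n => [_ ->|n [hf df] [g' hg ->]]; first by rewrite linear0; apply: scobound0.
rewrite addnS; exists ((-1) ^+ m *: scup m f g'); first by apply/icochainZ/icochain_scup.
rewrite linearZ /= sdiff_scup ?df ?scup0l ?add0r; last exact: icochain_sdeg hf.
by rewrite scalerA -exprD addnn -signr_odd odd_double scale1r.
Qed.

(* The two summands of d(f g), for the pointwise product f g of two 1-cocycles,
   that do not cancel are the two cup products. *)
Lemma scup11_comm K f g : scocycle K 1 f -> scocycle K 1 g ->
  scobound K 2 (scup 1 f g + scup 1 g f).
Proof.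
move=> hf hg; exists (- (f * g)).
  case: (hf) (hg) => [[[k lf] tf] _] [[[l lg] tg] _]; split.
    exists (maxn k l) => s s' hs; congr (- (_ * _)).
      exact: (slev_le (leq_maxl k l) lf).
    exact: (slev_le (leq_maxr k l) lg).
  by move=> t Kt; rewrite -{2}(tf _ Kt) -{2}(tg _ Kt).
have d1 a s : sdiff 1 a s = a (s \o addn 1) - a (s \o bump 1) + a (s \o bump 2).
  rewrite /sdiff !big_ord_recl big_ord0 /= /bump /=.
  have -> : s \o addn 1 = s \o bump 0 by apply/funext.
  rewrite /bump /=; ring.
have E2 a s : scocycle K 1 a -> a (s \o bump 2) = a s.
  by case=> ha _; apply: (icochain_sdeg ha) => -[|[]].
have E1 a s : scocycle K 1 a -> a (s \o bump 1) = a s + a (s \o addn 1).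
  move=> ha; have [_ da] := ha; have : sdiff 1 a s = 0 :> F by rewrite da.
  rewrite d1 E2 // => e0; apply/eqP; rewrite -subr_eq0; apply/eqP.
  by rewrite -[RHS]oppr0 -[in RHS]e0; ring.
apply/funext => s; rewrite d1 scochainD /scup !scochainN.
have M (s0 : nat -> X) : (f * g) s0 = f s0 * g s0 by [].
by rewrite !M !E2 // !E1 //; ring.
Qed.

(** * Adjoining one generator to the invariance condition *)

Section Step.
Variables (K D : (X -> X) -> Prop) (t : X -> X).
Let B t' := K t' \/ t' = t.
Hypothesis difD : forall n f, icochain K n f -> icochain D n (twist t f - f).
Hypothesis dif_surj : forall n h, icochain D n h ->
  exists2 h', icochain K n h' & twist t h' - h' = h.

Lemma icochain_add n f : icochain K n f -> twist t f = f -> icochain B n f.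
Proof. by move=> [cf tf] htf; split=> // t' [/tf //|->]. Qed.

Let BK n f : icochain B n f -> icochain K n f.
Proof. by apply: icochain_sub => t'; left. Qed.
Let Bt n f : icochain B n f -> twist t f = f.
Proof. by case=> _; apply; right. Qed.

Lemma coh_basis_step0 e : coh_basis K 0 e ->
  (forall i, (i < size e)%N -> twist t e`_i = e`_i) -> coh_basis B 0 e.
Proof.
move=> [he span_e free_e] te; split=> //.
- by move=> i hi; have [hi1 hi2] := he i hi; split=> //; apply: icochain_add (te _ hi).
- by move=> f [hf df]; apply: span_e; split=> //; apply: BK.
Qed.

Variable xi : cochain.
Hypothesis xiK : icochain K 0 xi.
Hypothesis xit : twist t xi - xi = 1.

Lemma twist_sdiff_xi : twist t (sdiff 0 xi) = sdiff 0 xi.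
Proof.
apply/eqP; rewrite -subr_eq0 twist_sdiff -linearB xit /=.
by have [_ ->] := scocycle1 K.
Qed.

Lemma scocycle_sdiff_xi : scocycle B 1 (sdiff 0 xi).
Proof.
split; last exact: sdiff_sdiff.
by apply: icochain_add; [apply: icochain_sdiff|apply: twist_sdiff_xi].
Qed.

(* The connecting map of 0 -> B -> K -> D -> 0, where the second map is
   f |-> t f - f, is the cup product with the class of d xi. *)
Lemma coh_basis_step n e e' z :
  coh_basis K n.+1 e -> (forall i, (i < size e)%N -> twist t e`_i = e`_i) ->
  coh_basis K n e' -> (forall i, (i < size e')%N -> twist t e'`_i = e'`_i) ->
  coh_basis D n z -> (forall i, (i < size z)%N -> scocycle B n z`_i) ->
  coh_basis B n.+1 (e ++ map (scup 1 (sdiff 0 xi)) z).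
Proof.
move=> [he span_e free_e] te [he' span_e' _] te' [hz span_z free_z] Bz.
(* The representatives in [e] and [e'] are t-invariant, so t - 1 induces zero on cohomology in
   degrees n + 1 and n, and the long exact sequence breaks into short ones. *)
have te_l c : twist t (lcomb e c) = lcomb e c.
  by rewrite /lcomb linear_sum; apply: eq_bigr => i _; rewrite linearZ /= te.
have te'_l c : twist t (lcomb e' c) = lcomb e' c.
  by rewrite /lcomb linear_sum; apply: eq_bigr => i _; rewrite linearZ /= te'.
have Bzl c : scocycle B n (lcomb z c) by apply: scocycle_lcomb.
have dxi c : sdiff n (scup 0 xi (lcomb z c)) = scup 1 (sdiff 0 xi) (lcomb z c).
  have [_ dz] := Bzl c.
  by rewrite (@sdiff_scup _ _ 0) ?dz ?linear0 ?addr0 //; exact: icochain_sdeg xiK.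
have Kxi c : icochain K n (scup 0 xi (lcomb z c)).
  by apply: (@icochain_scup _ 0) => //; apply: BK; case: (Bzl c).
have Sxi c : twist t (scup 0 xi (lcomb z c)) - scup 0 xi (lcomb z c) = lcomb z c.
  have [/Bt tz _] := Bzl c.
  by rewrite twist_scup tz -scupBl xit scup1l.
split.
- move=> i; rewrite size_cat size_map => hi; rewrite nth_cat; case: ltnP => [lt_ie|le_ei].
    by have [hi1 hi2] := he _ lt_ie; split=> //; apply: icochain_add (te _ lt_ie).
  have lt_iz : (i - size e < size z)%N by rewrite ltn_subLR.
  rewrite (nth_map 0) //; apply: (@scocycle_scup _ 1); first exact: scocycle_sdiff_xi.
  exact: Bz.
- move=> f [hf df]; have [c [g hg fE]] := span_e f (conj (BK hf) df).
  have tdg : sdiff n (twist t g - g) = 0.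
    by rewrite linearB /= -twist_sdiff -fE linearB /= te_l (Bt hf) subrr.
  have [c' hc'] := span_z _ (conj (difD hg) tdg).
  (* t g - g is a combination of [z] only up to a coboundary d h. Lifting h through t - 1 and
     subtracting its differential from g makes the equality strict and leaves d g unchanged; in
     degree 0 it is already strict. *)
  have [g' hg' [dg' Sg']] : exists2 g', icochain K n g' &
      sdiff n g' = sdiff n g /\ twist t g' - g' = lcomb z c'.
    case: n hg {df fE tdg} hc' {he span_e free_e he' span_e' hz span_z free_z Bz Bzl dxi Kxi hf}
      => [|n] hg.
      by move=> /eqP; rewrite subr_eq0 => /eqP E; exists g.
    move=> [h /dif_surj[h' hh' <-]] E; exists (g - sdiff n h').
      by apply: icochainB => //; apply: icochain_sdiff.
    split; first by rewrite linearB /= sdiff_sdiff subr0.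
    apply: (addIr (- lcomb z c'));
      rewrite subrr -[RHS](subrr (twist t g - g - lcomb z c')) {2}E.
    by rewrite !linearB /= twist_sdiff; apply/funext => s; rewrite !(scochainD, scochainN);
      ring.
  exists (catc e c c').
  have Bb : icochain B n (g' - scup 0 xi (lcomb z c')).
    apply: icochain_add; first exact: icochainB.
    apply/eqP; rewrite -subr_eq0 linearB /=; set X' := scup _ _ _.
    have -> : twist t g' - twist t X' - (g' - X') = (twist t g' - g') - (twist t X' - X').
      by apply/funext => s; rewrite !(scochainD, scochainN); ring.
    by rewrite Sg' /X' Sxi subrr.
  exists (g' - scup 0 xi (lcomb z c')) => //.
  by rewrite lcomb_catc lcomb_map opprD addrA fE linearB /= dg' dxi.
- move=> c; rewrite lcomb_cat lcomb_map; set c' := fun i => c _.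
  move=> [b hb E].
  have ce i : (i < size e)%N -> c i = 0.
    apply: free_e; exists (b - scup 0 xi (lcomb z c')).
      by apply: icochainB => //; apply: BK.
    by rewrite linearB /= dxi -E addrK.
  have hw : sdiff n (scup 0 xi (lcomb z c') - b) = 0.
    rewrite linearB /= dxi -E (@eq_lcomb _ _ e _ (fun=> 0)) // lcomb0 add0r subrr //.
  (* xi z - b is a cocycle for K, hence t-invariant up to a coboundary; applying t - 1 to it shows
     that the combination of [z] is a coboundary for D. *)
  have cz i : (i < size z)%N -> c' i = 0.
    have [|c'' hc''] := span_e' (scup 0 xi (lcomb z c') - b).
      by split=> //; apply: icochainB => //; apply: BK.
    apply: free_z.
    have -> : lcomb z c' = twist t (scup 0 xi (lcomb z c') - b - lcomb e' c'') -
       (scup 0 xi (lcomb z c') - b - lcomb e' c'').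
      rewrite !linearB /= te'_l (Bt hb) -[LHS]Sxi.
      by apply/funext => s; rewrite !(scochainD, scochainN); ring.
    case: n hc'' {E dxi hb hw he span_e free_e he' span_e' te' te'_l hz span_z Bz Bzl Kxi Sxi}
       => [->|n [h hh ->]]; first by rewrite linear0 subr0; apply: scobound0.
    by rewrite twist_sdiff -linearB; exists (twist t h - h) => //; apply: difD.
  move=> i; rewrite size_cat size_map => hi; case: (ltnP i (size e)) => [/ce //|le_ei].
  by rewrite -(subnKC le_ei); apply: cz; rewrite ltn_subLR.
Qed.

End Step.

End InvariantCochains.
Arguments scobound : simpl never.

(** * Acyclicity of the complex of all cochains *)

Section TrivialGroup.
Variables (F : fieldType) (X : Type) (lev : nat -> X -> X -> Prop).
Hypothesis lev_refl : forall k x, lev k x x.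
Variable x0 : X.
Local Notation cochain := (scochain F X).
Local Notation none := (fun _ : X -> X => False).

Lemma coh_basis_trivial0 : coh_basis lev none 0 [:: 1 : cochain].
Proof.
split.
- by case=> //= _; apply: scocycle1.
- move=> f [hf df]; exists (fun=> f (fun=> x0)); rewrite lcomb_seq1 /=.
  apply/eqP; rewrite subr_eq0; apply/eqP/funext => s.
  rewrite scochainZ mulr1; pose r i := if i is 0 then x0 else s 0%N.
  have : sdiff 0 f r = 0 :> F by rewrite df.
  rewrite /sdiff !big_ord_recl big_ord0 /= mul1r addr0 expr1 mulN1r => /eqP.
  rewrite subr_eq0 => /eqP E.
  have h := icochain_sdeg lev_refl hf.
  rewrite [RHS](h _ (r \o bump (bump 0 (@ord0 0)))); last by case.
  by rewrite -E; apply: h; case.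
- move=> c /= E [|//] _; have : lcomb [:: 1 : cochain] c (fun=> x0) = 0 :> F by rewrite E.
  by rewrite lcomb_seq1 scochainZ mulr1.
Qed.

Definition scons (x : X) (s : nat -> X) i := if i is j.+1 then s j else x.

(** Prepending the base point [x0] is a contracting homotopy. It preserves the level because [x0] is
    equivalent to itself at every level, and no invariance is required that it could break. *)
Lemma coh_basis_trivialS n : coh_basis (F := F) lev none n.+1 [::].
Proof.
split=> // f [[[k hf] _] df]; exists (fun=> 0); rewrite lcomb_nil subr0.
exists (fun s => f (scons x0 s)).
  by split=> //; exists k => s s' hs; apply: hf => -[|i] //= hi; apply: hs.
apply/funext => s; have : sdiff n.+1 f (scons x0 s) = 0 :> F by rewrite df.
rewrite /sdiff [in X in X -> _]big_ord_recl /= mul1r.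
have -> : scons x0 s \o bump 0 = s by apply/funext.
move/eqP; rewrite addr_eq0 => /eqP ->; rewrite -sumrN; apply: eq_bigr => i _.
rewrite exprS mulN1r mulNr opprK; congr (_ * f _).
by apply/funext => -[|j] /=; rewrite /bump ?add1n ?ltnS ?addnS.
Qed.
End TrivialGroup.

(** * Solving t g - g = f by sums along orbits *)

Section Wang.
Variables (F : fieldType) (X : Type) (lev : nat -> X -> X -> Prop).
Hypothesis lev_le : forall j k x y, (j <= k)%N -> lev k x y -> lev j x y.
Local Notation cochain := (scochain F X).
Implicit Types (f g h : cochain) (K : (X -> X) -> Prop).
Variables (K : (X -> X) -> Prop) (t : X -> X).
Hypothesis lev_t : forall k x y, lev k x y -> lev k (t x) (t y).
Hypothesis twist_t : forall n f, icochain lev K n f -> icochain lev K n (twist t f).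

(** The range consists of q m full periods with equal sums, and q vanishes in F. *)
Lemma iter_twist_sum q m Q f : q%:R = 0 :> F -> iter Q (twist t) f = f ->
  forall s, \sum_(i < q * m * Q) iter i (twist t) f s = 0.
Proof.
move=> q0 fQ s.
suff E l : \sum_(i < l * Q) iter i (twist t) f s = l%:R * \sum_(i < Q) iter i (twist t) f s.
  by rewrite E natrM q0 !mul0r.
elim: l => [|l IHl]; first by rewrite mul0r big_ord0.
rewrite mulSn addnC big_split_ord /= IHl -natr1 mulrDl mul1r; congr (_ + _).
apply: eq_bigr => i _; rewrite addnC iterD; congr (iter i _ _ _).
by elim: l {IHl} => //= l IHl; rewrite mulSn iterD IHl.
Qed.

(* j counts the steps from x to a chosen point of its t-orbit, so that f is the
   difference of the partial sums of f along the orbits. *)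
Lemma dif_surj_orbit :
  (forall k, exists l P, exists j : X -> nat, [/\ forall x y, lev l x y -> j x = j y,
     forall r x, K r -> j (r x) = j x,
     forall x, j x = 0%N -> j (t x) = P.-1,
     forall x, (0 < j x)%N -> j (t x) = (j x).-1 &
     (0 < P)%N /\ forall n f s, icochain lev K n f -> slev lev n k f ->
       \sum_(i < P) iter i (twist t) f s = 0]) ->
  forall n f, icochain lev K n f -> exists2 g, icochain lev K n g & twist t g - g = f.
Proof.
move=> hj n f hf; have [[k fk] fK] := hf.
have [l [P [j [jl jK jt0 jtS [P_gt0 sumP]]]]] := hj k.
exists (fun s => - \sum_(i < j (s 0%N)) iter i (twist t) f s).
  split.
    exists (maxn k l) => s s' hs; congr (- _).
    rewrite (jl _ (s' 0%N)); last by apply: (lev_le (leq_maxr k l)); apply: hs.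
    apply: eq_bigr => i _.
    have : slev lev n k (iter i (twist t) f).
      elim: (i : nat) => //= i' IH s1 s2 hs12; apply: IH => i'' /hs12; exact: lev_t.
    by apply=> i'' /hs; apply: (lev_le (leq_maxl k l)).
  move=> r Kr; apply/funext => s; rewrite /twist /= jK //; congr (- _).
  apply: eq_bigr => i _.
  have [_ /(_ r Kr)] : icochain lev K n (iter i (twist t) f).
    by elim: (i : nat) => //= i' IH; apply: twist_t.
  by move/(congr1 (fun f => f s)).
apply/funext => s; rewrite scochainD scochainN opprK /twist /= -/(twist t).
have E i : iter i (twist t) f (t \o s) = iter i.+1 (twist t) f s by [].
under eq_bigr => i _ do rewrite E.
(* At the chosen point the orbit closes up: since the sum over all P terms is 0, the P - 1 terms met
   after one step add up to - f. *)
case: (posnP (j (s 0%N))) => [j0|j_gt0].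
  rewrite jt0 // j0 big_ord0 addr0.
  have := sumP n f s hf fk; rewrite -(prednK P_gt0) big_ord_recl /=.
  by move/eqP; rewrite addr_eq0 => /eqP ->.
rewrite jtS //; case: (j (s 0%N)) j_gt0 => // m _.
by rewrite big_ord_recl /= addrC addrK.
Qed.
End Wang.

(** * Affine maps *)

Section Affine.
Variables (p : nat) (p_pr : prime p).

(* (a, b) stands for the affine map z |-> a z + b *)
Definition aff : Type := {x : int * int | ~~ (p %| x.1)%Z}.
Definition slope (x : aff) := (val x).1.
Definition shift (x : aff) := (val x).2.

Lemma aff_eq (x y : aff) : slope x = slope y -> shift x = shift y -> x = y.
Proof. by case: x y => [[a b] ?] [[c d] ?] h1 h2; apply: val_inj; congr (_, _). Qed.

(** The exponent is k + 1, as in the numbering of the tower: this is equality of the images in the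
    group of level k, see [hol_of_aff_lev]. *)
Definition lev k (x y : aff) : Prop :=
  ((p ^ k.+1)%N %| slope x - slope y)%Z && ((p ^ k.+1)%N %| shift x - shift y)%Z.

Lemma lev_refl k x : lev k x x.
Proof. by rewrite /lev !subrr !dvdz0. Qed.
Lemma lev_le j k x y : (j <= k)%N -> lev k x y -> lev j x y.
Proof.
move=> le_jk /andP[h1 h2]; apply/andP.
have d : ((p ^ j.+1)%N %| (p ^ k.+1)%N%:Z)%Z by rewrite dvdzE dvdn_exp2l.
by split; apply: dvdz_trans d _.
Qed.

Lemma dvdzM_prime (a b : int) : (p %| a * b)%Z = (p %| a)%Z || (p %| b)%Z.
Proof. by rewrite !dvdzE abszM Euclid_dvdM. Qed.

Fact aff_mul_subproof (c x : aff) :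
  ~~ (p %| (slope c * slope x, shift c + slope c * shift x).1)%Z.
Proof. by rewrite dvdzM_prime negb_or (valP c) (valP x). Qed.
Definition aff_mul (c x : aff) : aff := Sub (_, _) (aff_mul_subproof c x).

Lemma slopeM c x : slope (aff_mul c x) = slope c * slope x.
Proof. by []. Qed.
Lemma shiftM c x : shift (aff_mul c x) = shift c + slope c * shift x.
Proof. by []. Qed.

Lemma aff_mulA c d x : aff_mul c (aff_mul d x) = aff_mul (aff_mul c d) x.
Proof. by apply: aff_eq; rewrite !(slopeM, shiftM); ring. Qed.

Lemma lev_mul k c d x y : lev k c d -> lev k x y -> lev k (aff_mul c x) (aff_mul d y).
Proof.
move=> /andP[h1 h2] /andP[h3 h4]; apply/andP; rewrite !(slopeM, shiftM).
have -> : slope c * slope x - slope d * slope y =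
  (slope c - slope d) * slope x + slope d * (slope x - slope y) by ring.
have -> : shift c + slope c * shift x - (shift d + slope d * shift y) =
  (shift c - shift d) + ((slope c - slope d) * shift x + slope d * (shift x - shift y)) by ring.
by split; do ?[exact: h2 | exact: dvdz_mulr | exact: dvdz_mull | apply: rpredD].
Qed.

Fact trans_subproof (m : int) : ~~ (p %| (1, m).1)%Z.
Proof. by rewrite dvdzE dvdn1; case: p p_pr => [|[]]. Qed.
Definition transl m : aff := Sub (1, m) (trans_subproof m).
Lemma slope_transl m : slope (transl m) = 1. Proof. by []. Qed.
Lemma shift_transl m : shift (transl m) = m. Proof. by []. Qed.
Notation T m := (aff_mul (transl m)).

(* the identity when p divides r *)
Definition dil (r : int) : aff := insubd (transl 0) (r, 0).
Lemma slope_dil r : ~~ (p %| r)%Z -> slope (dil r) = r.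
Proof. by move=> h; rewrite /slope insubdK. Qed.
Lemma shift_dil r : shift (dil r) = 0.
Proof. by rewrite /shift /dil val_insubd; case: ifP. Qed.

Lemma translD m m' x : T m (T m' x) = T (m + m') x.
Proof. by apply: aff_eq; rewrite !(slopeM, shiftM) !(slope_transl, shift_transl); ring. Qed.
Lemma transl0 x : T 0 x = x.
Proof. by apply: aff_eq; rewrite !(slopeM, shiftM) !(slope_transl, shift_transl); ring. Qed.

Lemma dil_transl r m x : aff_mul (dil r) (T m x) = T (slope (dil r) * m) (aff_mul (dil r) x).
Proof.
apply: aff_eq; rewrite !(slopeM, shiftM) ?shift_dil !slope_transl ?shift_transl; ring.
Qed.

Local Notation F := 'F_p.
Local Notation cochain := (scochain F aff).
Implicit Types (f g h : cochain).
Local Notation none := (fun _ : aff -> aff => False).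
Local Notation icochain := (icochain lev).
Local Notation coh_basis := (coh_basis lev).

(** The disjunct [False] gives this the shape produced by adjoining a generator, here to the empty
    set of generators. *)
Definition Ktrans (t : aff -> aff) : Prop := False \/ t = T 1.

(** Needed for all integers m, negative ones included, because a dilation by r conjugates the
    translation by 1 into the translation by r, also for r = -1. *)
Lemma twist_transl f : twist (T 1) f = f -> forall m, twist (T m) f = f.
Proof.
move=> f1; have fn (n : nat) : twist (T n) f = f.
  elim: n => [|n IH].
    by apply/funext => s; congr f; apply/funext => i; rewrite /= transl0.
  rewrite -[in RHS]IH -[in RHS]f1; apply/funext => s; congr f; apply/funext => i.
  by rewrite /= translD -intS.
move=> [] n; first exact: fn.
rewrite NegzE -{1}(fn n.+1); apply/funext => s; congr f; apply/funext => i.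
by rewrite /= translD addrN transl0.
Qed.

Lemma lev_aff_mul c k x y : lev k x y -> lev k (aff_mul c x) (aff_mul c y).
Proof. by apply: lev_mul; apply: lev_refl. Qed.

Lemma slev_twist c n k f : slev lev n k f -> slev lev n k (twist (aff_mul c) f).
Proof. by move=> hf s s' hs; apply: hf => i /hs; apply: lev_aff_mul. Qed.

Lemma twist_icochain K c n f :
  (forall t, K t -> twist t (twist (aff_mul c) f) = twist (aff_mul c) f) ->
  icochain K n f -> icochain K n (twist (aff_mul c) f).
Proof. by move=> h [[k hf] _]; split=> //; exists k; apply: slev_twist. Qed.

Lemma twist_dil_icochain r n f :
  icochain Ktrans n f -> icochain Ktrans n (twist (aff_mul (dil r)) f).
Proof.
move=> hf; apply: twist_icochain => // t [//|->].
have fT : twist (T 1) f = f by have [_] := hf; apply; right.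
rewrite -[in RHS](twist_transl fT (slope (dil r) * 1)).
by apply/funext => s; congr f; apply/funext => i /=; rewrite dil_transl.
Qed.

Lemma Fp_eq0 (m : int) : (p %| m)%Z -> m%:~R = 0 :> F.
Proof.
move=> /dvdzP[q ->]; rewrite intrM -[p%:~R]/(p%:R).
by rewrite (pcharf0 (pchar_Fp p_pr)) mulr0.
Qed.

Lemma Fp_eq0P (m : int) : m%:~R = 0 :> F -> (p %| m)%Z.
Proof.
case: m => m; rewrite ?NegzE ?intrN => /eqP; rewrite ?oppr_eq0 -pmulrn.
  by rewrite -(dvdn_pcharf (pchar_Fp p_pr)) dvdzE.
by rewrite -(dvdn_pcharf (pchar_Fp p_pr)) dvdzE.
Qed.

Lemma dif_surj_transl n h : icochain none n h ->
  exists2 h', icochain none n h' & twist (T 1) h' - h' = h.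
Proof.
apply: (dif_surj_orbit lev_le (@lev_aff_mul _)) => [m f|k]; first exact: twist_icochain.
(* A cochain of level k has period p^(k+1) under the unit translation. Orbits are counted one level
   higher, so that the sum runs over p periods and vanishes. *)
pose P := (p ^ k.+2)%N; have P_gt0 : (0 < P)%N by rewrite expn_gt0 prime_gt0.
have P0 : P%:Z != 0 by rewrite eqz_nat -lt0n.
pose j (x : aff) := `|(- shift x %% P)%Z|%N.
have jE x : (j x)%:Z = (- shift x %% P)%Z by rewrite gez0_abs ?modz_ge0.
have jlt x : (j x < P)%N.
  by rewrite -ltz_nat jE -[X in _ < X]gez0_abs // ltz_mod.
have jU x (m : nat) : (m < P)%N -> (P %| m%:Z + shift x)%Z -> j x = m.
  move=> ltm d; apply/eqP; rewrite -eqz_nat jE -(modz_small (m := m) (d := P)) //.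
  by rewrite eqz_mod_dvd -opprD rpredN addrC.
have jD x : (P %| (j x)%:Z + shift x)%Z.
  by rewrite -[shift x]opprK -eqz_mod_dvd jE modz_mod.
exists k.+1, P, j; split=> //.
- move=> x y /andP[_ h2]; apply: jU => //.
  have -> : (j y)%:Z + shift x = ((j y)%:Z + shift y) + (shift x - shift y) by ring.
  exact: rpredD.
- move=> x jx; apply: jU; first by rewrite prednK.
  rewrite shiftM shift_transl slope_transl.
  have := jD x; rewrite jx add0r => d.
  have -> : P.-1%:Z + (1 + 1 * shift x) = P%:Z + shift x.
    by rewrite -[in RHS](prednK P_gt0) intS; ring.
  by rewrite rpredD ?dvdzz.
- move=> x jx; apply: jU; first by rewrite (leq_ltn_trans (leq_pred _)).
  rewrite shiftM shift_transl slope_transl.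
  have -> : (j x).-1%:Z + (1 + 1 * shift x) = (j x)%:Z + shift x; last exact: jD.
  by rewrite -[in RHS](prednK jx) intS; ring.
split=> // m f s _ fk; rewrite /P expnS -[(p * _)%N]muln1 mulnAC.
apply: iter_twist_sum; first exact: pcharf0 (pchar_Fp p_pr).
have E i : iter i (twist (T 1)) f = twist (T i) f.
  elim: i => [|i IH] /=; first by apply/funext => s0; congr f; apply/funext => i;
    rewrite /= transl0.
  by rewrite IH; apply/funext => s0; congr f; apply/funext => i' /=;
    rewrite translD addrC -intS.
rewrite E; apply/funext => s0; apply: fk => i _ /=.
by rewrite /lev slopeM shiftM slope_transl shift_transl !mul1r subrr dvdz0 addrK dvdzz.
Qed.

Definition xi_shift : cochain := fun s => (shift (s 0%N))%:~R.
Definition coc_u : cochain := sdiff 0 xi_shift.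

Lemma intr_Fp_eq (a b : int) : (p %| a - b)%Z -> a%:~R = b%:~R :> F.
Proof. by move=> /Fp_eq0; rewrite intrB => /eqP; rewrite subr_eq0 => /eqP. Qed.

Lemma lev_p k x y : lev k x y -> (p %| slope x - slope y)%Z && (p %| shift x - shift y)%Z.
Proof. by move=> /(lev_le (leq0n k)); rewrite /lev expn1. Qed.

Lemma icochain_xi_shift : icochain none 0 xi_shift.
Proof.
split=> //; exists 0%N => s s' /(_ 0%N isT) /lev_p/andP[_].
exact: intr_Fp_eq.
Qed.

Lemma xi_shift_dif : twist (T 1) xi_shift - xi_shift = 1.
Proof.
apply/funext => s; rewrite scochainD scochainN /twist /xi_shift /= shiftM.
by rewrite slope_transl shift_transl mul1r intrD addrK.
Qed.

Lemma scocycle_u : scocycle lev Ktrans 1 coc_u.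
Proof.
exact: (@scocycle_sdiff_xi _ _ _ none _ _ icochain_xi_shift xi_shift_dif).
Qed.

Lemma difD_none n f : icochain none n f -> icochain none n (twist (T 1) f - f).
Proof. by move=> hf; apply: (icochainB lev_le) => //; apply: twist_icochain. Qed.

Lemma coh_basis_trans0 : coh_basis Ktrans 0 [:: 1 : cochain].
Proof.
by apply: (coh_basis_step0 (coh_basis_trivial0 _ lev_refl (transl 0))); case.
Qed.

(** The translations alone have the cohomology of the p-adic integers: the complex of all cochains
    has only the constant 1, which yields u through the connecting map and leaves nothing in higher
    degrees. *)
Lemma coh_basis_trans1 : coh_basis Ktrans 1 [:: coc_u].
Proof.
have b0 := coh_basis_trivial0 'F_p lev_refl (transl 0).
have t0 i : (i < size ([::] : seq cochain))%N -> twist (T 1) ([::] :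
  seq cochain)`_i = [::]`_i by [].
pose e1 := [:: 1 : cochain].
have t1 i : (i < size e1)%N -> twist (T 1) e1`_i = e1`_i by case: i.
have z1 i : (i < size e1)%N -> scocycle lev Ktrans 0 e1`_i.
  by case: i => // _; apply: scocycle1.
rewrite -[coc_u](scup1r 1); exact: (coh_basis_step lev_refl lev_le difD_none
  dif_surj_transl icochain_xi_shift xi_shift_dif
  (coh_basis_trivialS _ lev_refl (transl 0) 0) t0 b0 t1 b0 z1).
Qed.

Lemma coh_basis_transSS n : coh_basis Ktrans n.+2 ([::] : seq cochain).
Proof.
have t0 i : (i < size ([::] : seq cochain))%N -> twist (T 1) ([::] :
  seq cochain)`_i = [::]`_i by [].
have z0 i : (i < size ([::] : seq cochain))%N -> scocycle lev Ktrans n.+1 ([::] :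
  seq cochain)`_i by [].
have b := coh_basis_trivialS 'F_p lev_refl (transl 0).
exact: (coh_basis_step lev_refl lev_le difD_none dif_surj_transl icochain_xi_shift
  xi_shift_dif (b n.+1) t0 (b n) t0 (b n) z0).
Qed.

End Affine.

(** * Units modulo powers of p *)

Section Units.
Variables (p : nat) (p_pr : prime p).

Lemma pow_gt1 k : (1 < p ^ k.+1)%N.
Proof. by rewrite -{1}(exp1n k.+1) ltn_exp2r // prime_gt1. Qed.

Lemma Zp_intr_eq k (a b : int) :
  (a%:~R == b%:~R :> 'Z_(p ^ k.+1)) = ((p ^ k.+1)%N %| a - b)%Z.
Proof.
rewrite -subr_eq0 -intrB; move: (a - b) => m.
have E n : (n%:R == 0 :> 'Z_(p ^ k.+1)) = (p ^ k.+1 %| n)%N.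
  by rewrite -(inj_eq val_inj) /= val_Zp_nat ?pow_gt1.
by case: m => n; rewrite ?NegzE ?intrN ?oppr_eq0 -pmulrn E dvdzE.
Qed.

Lemma Zp_intr_unit k (a : int) : ~~ (p %| a)%Z -> (a%:~R : 'Z_(p ^ k.+1)) \is a GRing.unit.
Proof.
case: a => n; rewrite ?NegzE ?intrN ?unitrN -pmulrn dvdzE /= => h;
  by rewrite unitZpE ?pow_gt1 // coprimeXl // prime_coprime.
Qed.

(** The class of a among the units; it takes the default value 1 when p divides a. *)
Definition uz k (a : int) : {unit 'Z_(p ^ k.+1)} := insubd (1%g :
  {unit 'Z_(p ^ k.+1)}) (a%:~R : 'Z_(p ^ k.+1)).

Lemma val_uz k a : ~~ (p %| a)%Z -> val (uz k a) = a%:~R.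
Proof. by move=> ha; rewrite /uz insubdK //; apply: Zp_intr_unit. Qed.

Lemma uzM k a b : ~~ (p %| a)%Z -> ~~ (p %| b)%Z -> uz k (a * b) = (uz k a * uz k b)%g.
Proof.
move=> ha hb; apply: val_inj; rewrite /= !val_uz ?intrM //.
by rewrite dvdzM_prime // negb_or ha.
Qed.

Lemma uz_eq k a b : ~~ (p %| a)%Z -> ~~ (p %| b)%Z ->
  (uz k a == uz k b) = ((p ^ k.+1)%N %| a - b)%Z.
Proof. by move=> ha hb; rewrite -(inj_eq val_inj) !val_uz ?Zp_intr_eq. Qed.

(** The cofactor of a - 1 is a sum of p powers of a, each congruent to 1 modulo p, hence divisible
    by p. *)
Lemma dvdz_exp_sub1 j (a : int) : ((p ^ j.+1)%N %| a - 1)%Z -> ((p ^ j.+2)%N %| a ^+ p - 1)%Z.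
Proof.
move=> d; rewrite subrX1 expnSr PoszM; apply: dvdz_mul => //.
have dp : (p %| a - 1)%Z.
  by apply: dvdz_trans d; rewrite dvdzE dvdn_exp.
have -> : \sum_(i < p) a ^+ i = \sum_(i < p) (a ^+ i - 1) + p%:Z.
  by rewrite sumrB big_const_ord iter_addr_0 natz subrK.
rewrite rpredD ?dvdzz // rpred_sum // => i _.
by rewrite subrX1 dvdz_mulr.
Qed.
End Units.

(** * The difference operator of the multiplication by r *)

Section Dilation.
Variables (p : nat) (p_pr : prime p) (r : nat).
Hypotheses (r_gt1 : (1 < r)%N) (pr : ~~ (p %| r%:Z)%Z).
Local Notation ord k := #[uz p k r]%g.

Lemma dvd_exp n : ~~ (p %| (r%:Z ^+ n))%Z.
Proof. by elim: n => [|n IH];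
  rewrite ?expr0 ?exprS ?dvdzM_prime // ?negb_or ?pr // dvdzE dvdn1 gtn_eqF ?prime_gt1. Qed.

Lemma uzX k n : (uz p k r ^+ n)%g = uz p k (r%:Z ^+ n).
Proof.
elim: n => [|n IH]; last by rewrite expgS IH -uzM // ?dvd_exp // exprS.
apply: val_inj; rewrite val_uz //; last exact: (dvd_exp 0).
Qed.

Lemma order_dvd k n : (ord k %| n)%N = ((p ^ k.+1)%N %| r%:Z ^+ n - 1)%Z.
Proof.
have u1 : uz p k (r%:Z ^+ 0) = 1%g by rewrite -uzX expg0.
by rewrite order_dvdn uzX -u1 uz_eq // dvd_exp.
Qed.

(** Each further level multiplies the order at most by p, so the quotient of the orders at levels l
    and k is a power of p. It is not 1 for l = k + r^o, where o is the order at level k: otherwise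
    p^(l+1) would divide r^o - 1, which is positive as r > 1 and smaller than p^(l+1). *)
Lemma order_growth k : exists l m, ord l = (p * m * ord k)%N.
Proof.
set o := ord k; pose i := (r ^ o)%N; pose l := (k + i)%N.
have dl : (ord l %| o * p ^ i)%N.
  rewrite order_dvd /l; elim: (i) => [|i' IH].
    by rewrite addn0 expn0 muln1 -order_dvd.
  by rewrite addnS expnSr mulnA exprM; apply: dvdz_exp_sub1.
have dk : (o %| ord l)%N.
  rewrite order_dvd; apply: (@dvdz_trans (p ^ l.+1)%N%:Z); last by rewrite -order_dvd.
  by rewrite dvdzE dvdn_exp2l // ltnS leq_addr.
have o_gt0 : (0 < o)%N := order_gt0 _.
have [m El] := dvdnP dk; exists l.
move: dl; rewrite El mulnC dvdn_pmul2l // => /(dvdn_pfactor _ _ p_pr)[[|e] _ Em]; last first.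
  by exists (p ^ e)%N; rewrite Em expnS mulnC.
have := dvdnn (ord l); rewrite {2}El Em mul1n order_dvd.
have -> : r%:Z ^+ o - 1 = (r ^ o).-1%:Z.
  by rewrite -[r%:Z]natz -natrX natz -{1}[(r ^ o)%N]prednK ?expn_gt0 ?(ltnW r_gt1) // intS addrC addKr.
rewrite dvdzE /= => /dvdn_leq.
have h1 : (0 < (r ^ o).-1)%N.
  by rewrite -subn1 subn_gt0 -{1}(exp1n o) ltn_exp2r.
move/(_ h1); rewrite leqNgt; case/negP.
have : (l.+1 < p ^ l.+1)%N by apply: ltn_expl; apply: prime_gt1.
rewrite /l /i; lia.
Qed.

Local Notation cochain := (scochain 'F_p (aff p)).
Local Notation D := (aff_mul p_pr (dil p_pr r)).

Lemma iter_twist_dil n k (f : cochain) : slev (@lev p) n k f ->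
  iter (ord k) (twist D) f = f.
Proof.
move=> fk; have E i s : iter i (twist D) f s = f (aff_mul p_pr (dil p_pr (r%:Z ^+ i)) \o s).
  elim: i s => [|i IH] s /=.
    congr f; apply/funext => i /=; apply: aff_eq.
      by rewrite slopeM slope_dil ?mul1r // (dvd_exp 0).
    by rewrite shiftM slope_dil ?shift_dil ?add0r ?mul1r // (dvd_exp 0).
  rewrite /twist IH; congr f; apply/funext => j /=; rewrite aff_mulA; congr (aff_mul _ _ _).
  apply: aff_eq; first by rewrite slopeM !slope_dil ?dvd_exp // exprSr.
  by rewrite shiftM !shift_dil mulr0 addr0.
apply/funext => s; rewrite E; apply: fk => i _ /=.
have d : ((p ^ k.+1)%N %| r%:Z ^+ ord k - 1)%Z by rewrite -order_dvd.
rewrite /lev slopeM shiftM shift_dil slope_dil ?dvd_exp // add0r.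
by rewrite -{2}[slope _]mul1r -{2}[shift _]mul1r -!mulrBl !dvdz_mulr.
Qed.

(** On slopes, the orbits are the cosets of the subgroup generated by r in the units of level l, and
    [j] is a discrete logarithm relative to a chosen point of each coset. Translations fix the slope
    and so preserve [j]. *)
Lemma dif_surj_dil n h : icochain (@lev p) (Ktrans p_pr) n h ->
  exists2 h' : cochain, icochain (@lev p) (Ktrans p_pr) n h' & twist D h' - h' = h.
Proof.
apply: (dif_surj_orbit (@lev_le p) (@lev_aff_mul _ p_pr _)) => [m f|k].
  exact: twist_dil_icochain.
(* The orbits are taken at a level where their length is a multiple of p times the period of the
   cochains of level k. *)
have [l [m El]] := order_growth k.
pose H := <[uz p l r]>%g; pose rho v := repr (H :* v)%g.
pose u (x : aff p) := uz p l (slope x).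
have ulev x y : lev l x y -> u x = u y.
  by move=> /andP[h1 _]; apply/eqP; rewrite uz_eq // (valP x, valP y).
have uD x : u (D x) = (uz p l r * u x)%g.
  by rewrite /u slopeM slope_dil // uzM // (valP x).
have uT x : u (aff_mul p_pr (transl p_pr 1) x) = u x.
  by rewrite /u slopeM slope_transl mul1r.
have rhoD v : rho (uz p l r * v)%g = rho v.
  congr repr; apply/rcoset_eqP/rcosetP; exists (uz p l r) => //; exact: cycle_id.
have step v : exists i : 'I_(ord l), (uz p l r ^+ i * v == rho v)%g.
  have /rcosetP[h' /cyclePmin[i lt_i ->] E] : rho v \in (H :* v)%g by apply: mem_repr_rcoset.
  by exists (Ordinal lt_i); rewrite E.
pose j x : nat := xchoose (step (u x)).
have jP x : (uz p l r ^+ j x * u x)%g = rho (u x) by apply/eqP; exact: (xchooseP (step (u x))).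
have jlt x : (j x < ord l)%N by apply: ltn_ord.
have jU x i : (i < ord l)%N -> (uz p l r ^+ i * u x)%g = rho (u x) -> j x = i.
  move=> lt_i; rewrite -jP => /mulIg/eqP; rewrite eq_expg_mod_order !modn_small //.
  by move/eqP.
exists l, (ord l), j; split=> //.
- by move=> x y lxy; apply: jU; rewrite // (ulev _ _ lxy) jP.
- by move=> t x [//|->]; apply: jU; rewrite // uT jP.
- move=> x jx; apply: jU; first by rewrite prednK.
  rewrite uD rhoD mulgA -expgSr prednK // expg_order mul1g.
  by rewrite -jP jx expg0 mul1g.
- move=> x jx; apply: jU; first by rewrite (leq_ltn_trans (leq_pred _)).
  by rewrite uD rhoD mulgA -expgSr prednK // jP.
split=> // m' f s _ fk; rewrite El.
by apply: iter_twist_sum; [apply: pcharf0 (pchar_Fp p_pr)|apply: iter_twist_dil fk].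
Qed.

End Dilation.

(** * The cohomology for p odd *)

Section AdjoinDilation.
Variables (p : nat) (p_pr : prime p) (r : nat).
Local Notation cochain := (scochain 'F_p (aff p)).
Local Notation lev := (@lev p).
Local Notation K1 := (Ktrans p_pr).
Local Notation D := (aff_mul p_pr (dil p_pr r)).

Definition Kdil (t : aff p -> aff p) : Prop := K1 t \/ t = D.

Lemma difD_dil n (f : cochain) : icochain lev K1 n f -> icochain lev K1 n (twist D f - f).
Proof. by move=> hf; apply: (icochainB (@lev_le p)) => //; apply: twist_dil_icochain. Qed.

Lemma coh_basis_dil0 : coh_basis lev Kdil 0 [:: 1 : cochain].
Proof. by apply: (coh_basis_step0 (coh_basis_trans0 p_pr)); case. Qed.

Hypotheses (r_gt1 : (1 < r)%N) (pr : ~~ (p %| r%:Z)%Z).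

Lemma twist_dil_u : twist D (@coc_u p) = r%:R *: @coc_u p.
Proof.
rewrite /coc_u twist_sdiff -linearZ /=; congr (sdiff 0 _); apply/funext => s.
by rewrite scochainZ /twist /xi_shift /= shiftM shift_dil slope_dil // add0r intrM.
Qed.

Hypothesis r1 : ~~ (p %| r%:Z - 1)%Z.

(** [coh_basis_step] does not apply, since D moves u. Instead t - 1 multiplies the class of u by r -
    1, a unit of F_p, so degree 1 of the translations contributes neither kernel nor cokernel. What
    remains in positive degree is the cokernel on constants, giving the class of d xi. *)
Lemma coh_basis_dil_odd : exists x : cochain,
  coh_basis lev Kdil 1 [:: x] /\ forall n, coh_basis lev Kdil n.+2 ([::] : seq cochain).
Proof.
have [xi hxi Sxi] := dif_surj_dil r_gt1 pr (icochain1 _ lev K1).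
have BK n (f : cochain) : icochain lev Kdil n f -> icochain lev K1 n f.
  by apply: icochain_sub => t; left.
have Bt n (f : cochain) : icochain lev Kdil n f -> twist D f = f.
  by case=> _; apply; right.
have u0 : r%:R - 1 != 0 :> 'F_p.
  by apply/negP => /eqP e; case/negP: r1; apply: Fp_eq0P; rewrite // intrB.
have Su : twist D (@coc_u p) - @coc_u p = (r%:R - 1) *: @coc_u p.
  by rewrite twist_dil_u scalerBl scale1r.
have [_ span0 _] := coh_basis_trans0 p_pr.
have [_ span1 free1] := coh_basis_trans1 p_pr.
have [hu du] := scocycle_u p_pr.
exists (sdiff 0 xi); split.
  split.
  - by case=> //= _; apply: (scocycle_sdiff_xi hxi Sxi).
  - move=> f [hf df]; have [c [g hg fE]] := span1 f (conj (BK _ _ hf) df).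
    move: fE; rewrite lcomb_seq1 /= => fE.
    (* f is fixed by D and cohomologous to c u, so (r - 1) c u is a coboundary. *)
    have c0 : c 0%N = 0.
      have : (r%:R - 1) * c 0%N = 0.
        apply: (free1 (fun i => (r%:R - 1) * c i) _ 0%N) => //.
        rewrite lcomb_seq1 /=; exists (- (twist D g - g)).
          by rewrite -scaleN1r; apply/icochainZ/difD_dil => //; apply: lev_le.
        rewrite linearN linearB /= -twist_sdiff -fE.
        have -> : twist D (f - c 0%N *: @coc_u p) = f - c 0%N *: (r%:R *: @coc_u p).
          transitivity (twist D f - c 0%N *: twist D (@coc_u p)); first by [].
          by rewrite (Bt _ _ hf) twist_dil_u.
        by apply/funext => s; rewrite !(scochainZ, scochainD, scochainN); ring.
      by move=> /eqP; rewrite mulf_eq0 (negPf u0) => /eqP.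
    move: fE; rewrite c0 scale0r subr0 => fE.
    have [|c' /=] := span0 (twist D g - g).
      split; first exact: difD_dil.
      by rewrite linearB /= -twist_sdiff -fE (Bt _ _ hf) subrr.
    rewrite lcomb_seq1 /= => /eqP; rewrite subr_eq0 => /eqP Sg.
    exists c'; rewrite lcomb_seq1 /=; exists (g - c' 0%N *: xi).
      apply: icochain_add.
        by apply: (icochainB (@lev_le p)) => //; apply: icochainZ => //; apply: lev_le.
      apply/eqP; rewrite -subr_eq0; apply/eqP.
      transitivity ((twist D g - g) - c' 0%N *: (twist D xi - xi)).
        by apply/funext => s; rewrite /twist !(scochainZ, scochainD, scochainN); ring.
      by rewrite Sg Sxi subrr.
    by rewrite sdiffB sdiffZ fE.
  - move=> c; rewrite lcomb_seq1 /= => -[b hb E] [|//] _.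
    have [|c' /=] := span0 (c 0%N *: xi - b).
      split; last by rewrite sdiffB sdiffZ E subrr.
      apply: (icochainB (@lev_le p)); last exact: BK.
      by apply: icochainZ => //; apply: lev_le.
    rewrite lcomb_seq1 /= => /eqP; rewrite subr_eq0 => /eqP E2.
    have : c 0%N *: (1 : cochain) = 0.
      rewrite -Sxi; transitivity (twist D (c 0%N *: xi - b) - (c 0%N *: xi - b)).
        apply/funext => s; have : twist D b s = b s by rewrite (Bt _ _ hb).
        by rewrite /twist !(scochainZ, scochainD, scochainN) => ->; ring.
      by rewrite E2 subrr.
    by move/(congr1 (fun f => f (fun=> transl p_pr 0))); rewrite scochainZ mulr1.
move=> n; split=> // f [hf df].
have [_ /(_ f (conj (BK _ _ hf) df))] := coh_basis_transSS p_pr n.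
case=> c; rewrite lcomb_nil subr0 => -[g hg fE] _.
have zS : scocycle lev K1 n.+1 (twist D g - g).
  split; first exact: difD_dil.
  by rewrite linearB /= -twist_sdiff -fE (Bt _ _ hf) subrr.
(* The cocycle t g - g must be hit by t - 1 up to a coboundary. In degree 1 it is c' u up to a
   coboundary, and w is obtained by dividing by r - 1; in higher degrees it already is a
   coboundary. *)
have [w [hw dw] [h hh Sg]] : exists2 w, scocycle lev K1 n.+1 w &
    exists2 h, icochain lev K1 n h & twist D g - g = twist D w - w + sdiff n h.
  case: n {f hf df hg fE} zS => [|n] zS.
    have [c' [h hh]] := span1 _ zS.
    rewrite lcomb_seq1 /= => /eqP; rewrite subr_eq => /eqP Sg.
    exists ((c' 0%N / (r%:R - 1)) *: @coc_u p).
      by apply: (scocycleZ (@lev_le p)); split.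
    exists h => //; rewrite Sg addrC linearZ /= -scalerBr Su scalerA.
    by rewrite divfK.
  have [_ /(_ _ zS)] := coh_basis_transSS p_pr n.
  case=> c'; rewrite lcomb_nil subr0 => -[h hh Sg] _.
  exists 0; first by apply: scocycle0.
  by exists h => //; rewrite linear0 subr0 add0r.
have [h' hh' Sh'] := dif_surj_dil r_gt1 pr hh.
exists (fun=> 0); rewrite lcomb_nil subr0; exists (g - w - sdiff n h').
  apply: icochain_add.
    apply: (icochainB (@lev_le p)); last exact: icochain_sdiff.
    exact: (icochainB (@lev_le p)).
  apply/eqP; rewrite -subr_eq0 !linearB /= twist_sdiff; apply/eqP.
  transitivity ((twist D g - g) - (twist D w - w) - (sdiff n (twist D h') - sdiff n h')).
    by apply/funext => s; rewrite !(scochainD, scochainN); ring.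
  by rewrite -linearB /= Sh' Sg addrC addrA [_ + (_ + _)]addrC addrK addrN.
by rewrite !linearB /= dw sdiff_sdiff !subr0.
Qed.

End AdjoinDilation.

(** * The cohomology for p = 2 *)

Section Two.
Variable (p_pr : prime 2).
Local Notation cochain := (scochain 'F_2 (aff 2)).
Local Notation lev := (@lev 2).
Local Notation K1 := (Ktrans p_pr).
Local Notation K2 := (Kdil p_pr 5).
Local Notation T := (aff_mul p_pr (transl p_pr 1)).
Local Notation D r := (aff_mul p_pr (dil p_pr r)).
Local Notation u := (@coc_u 2).

Definition Kall2 (t : aff 2 -> aff 2) : Prop := K2 t \/ t = D (-1).

Definition residue (n : nat) (a : int) : nat := `|(a %% n%:Z)%Z|%N.

Lemma residue_eq n a b : (0 < n)%N -> (n %| a - b)%Z -> residue n a = residue n b.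
Proof. by move=> n_gt0; rewrite -eqz_mod_dvd /residue => /eqP ->. Qed.

Lemma residue_nat n m : residue n m%:Z = (m %% n)%N.
Proof. by rewrite /residue modz_nat. Qed.

Lemma residueE n a : (0 < n)%N -> (n %| a - (residue n a)%:Z)%Z.
Proof.
move=> n_gt0; rewrite /residue gez0_abs ?modz_ge0 ?eqz_nat -?lt0n //.
by rewrite -eqz_mod_dvd modz_mod.
Qed.

Lemma residue_lt n a : (0 < n)%N -> (residue n a < n)%N.
Proof. by move=> n_gt0; rewrite -ltz_nat gez0_abs ?ltz_pmod ?modz_ge0 // eqz_nat -lt0n. Qed.

Lemma residueM n (c : nat) a : (0 < n)%N -> residue n (c%:Z * a) = (c * residue n a %% n)%N.
Proof.
move=> n_gt0; rewrite -residue_nat; apply: residue_eq => //.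
by rewrite PoszM -mulrBr dvdz_mull // residueE.
Qed.

Lemma residueN n a : (0 < n)%N -> residue n (- a) = ((n - residue n a) %% n)%N.
Proof.
move=> n_gt0; rewrite -residue_nat; apply: residue_eq => //.
rewrite -(subzn (ltnW (residue_lt a n_gt0))).
have -> : - a - (n%:Z - (residue n a)%:Z) = - (a - (residue n a)%:Z) - n%:Z by ring.
by rewrite rpredB ?dvdzz // rpredN residueE.
Qed.

Lemma residueS n a : (0 < n)%N -> residue n (1 + a) = ((residue n a).+1 %% n)%N.
Proof.
move=> n_gt0; rewrite -residue_nat; apply: residue_eq => //.
have -> : 1 + a - (residue n a).+1%:Z = a - (residue n a)%:Z by rewrite intS; ring.
exact: residueE.
Qed.

(** A residue modulo 32 determines a^2 modulo 64, hence (a^2 - 1) / 8 modulo 8, enough for the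
    functions of c below. Their transformation rules then become computations over the odd
    residues. *)
Definition slope_pred (g : pred nat) : cochain :=
  fun s => (g (residue 32 (slope (s 0%N))))%:R.

Definition on_residues (P : pred nat) := all (fun i => odd i ==> P i) (iota 0 32).

Lemma slope_odd_ind (P : pred nat) : on_residues P ->
  forall x : aff 2, P (residue 32 (slope x)).
Proof.
move=> /allP h x; have := h (residue 32 (slope x)).
rewrite mem_iota residue_lt // => /(_ isT) /implyP; apply.
rewrite -[odd _]negbK -dvdn2; apply/negP => d; case/negP: (valP x).
rewrite -[X in (_ %| X)%Z](subrK (residue 32 (slope x))%:Z) rpredD //.
by apply: dvdz_trans (residueE (slope x) (n := 32) isT).
Qed.

Lemma icochain_slope_pred g : icochain lev K1 0 (slope_pred g).
Proof.
split; first by exists 4%N => s s' /(_ 0%N isT) /andP[h _]; congr (nat_of_bool (g _))%:R;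
  apply: residue_eq.
by move=> t [//|->]; apply/funext => s;
  rewrite /twist /slope_pred /= slopeM slope_transl mul1r.
Qed.

Lemma F2_addb (a b : bool) : (a (+) b)%:R = a%:R + b%:R :> 'F_2.
Proof. by apply: val_inj; case: a; case: b. Qed.
Lemma F2_opp (x : 'F_2) : - x = x.
Proof. exact: oppr_pchar2 (pchar_Fp p_pr) x. Qed.
Lemma F2_addxx (x : 'F_2) : x + x = 0.
Proof. by rewrite -{2}[x]F2_opp subrr. Qed.
Lemma cochain2_opp (f : cochain) : - f = f.
Proof. by apply/funext => s; rewrite scochainN F2_opp. Qed.
Lemma cochain2_addxx (f : cochain) : f + f = 0.
Proof. by rewrite -{2}[f]cochain2_opp subrr. Qed.

Lemma slope_pred_dil5 g g' :
  on_residues (fun i => g (5 * i %% 32) == g i (+) g' i)%N ->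
  twist (D 5) (slope_pred g) = slope_pred g + slope_pred g'.
Proof.
move=> h; apply/funext => s; rewrite scochainD -F2_addb /twist /slope_pred /=.
rewrite slopeM slope_dil // residueM //.
by have /eqP -> := slope_odd_ind h (s 0%N).
Qed.

Lemma slope_pred_dilN g g' :
  on_residues (fun i => g ((32 - i) %% 32) == g i (+) g' i)%N ->
  twist (D (-1)) (slope_pred g) = slope_pred g + slope_pred g'.
Proof.
move=> h; apply/funext => s; rewrite scochainD -F2_addb /twist /slope_pred /=.
rewrite slopeM slope_dil // mulN1r residueN //.
by have /eqP -> := slope_odd_ind h (s 0%N).
Qed.

Lemma slope_pred1 : slope_pred predT = 1. Proof. by []. Qed.
Lemma slope_pred0 : slope_pred pred0 = 0. Proof. by []. Qed.

(* If a = 5^c or a = - 5^c then (a^2 - 1) / 8 = 3 c mod 8. Hence res_x and res_x2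
   are the parities of c and of c (c - 1) / 2; res_y tells the sign. *)
Definition res_x (i : nat) : bool := odd ((i * i).-1 %/ 8).
Definition res_x2 (i : nat) : bool :=
  let l := ((i * i).-1 %/ 8)%N in odd ((l * l.+1)./2).
Definition res_y (i : nat) : bool := (i %% 4 == 3)%N.

Definition xi_x := slope_pred res_x.
Definition xi_x2 := slope_pred res_x2.
Definition eta := slope_pred res_y.
Definition coc_x : cochain := sdiff 0 xi_x.
Definition coc_y : cochain := sdiff 0 eta.

Lemma xi_x_dil5 : twist (D 5) xi_x = xi_x + 1.
Proof. by rewrite -slope_pred1; apply: slope_pred_dil5; vm_compute. Qed.
Lemma xi_x_dilN : twist (D (-1)) xi_x = xi_x.
Proof. by rewrite -[RHS]addr0 -slope_pred0; apply: slope_pred_dilN; vm_compute. Qed.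
(** Multiplying by 5 replaces c by c + 1, and c(c - 1)/2 grows by c. *)
Lemma xi_x2_dil5 : twist (D 5) xi_x2 = xi_x2 + xi_x.
Proof. by apply: slope_pred_dil5; vm_compute. Qed.
Lemma xi_x2_dilN : twist (D (-1)) xi_x2 = xi_x2.
Proof. by rewrite -[RHS]addr0 -slope_pred0; apply: slope_pred_dilN; vm_compute. Qed.
Lemma eta_dil5 : twist (D 5) eta = eta.
Proof. by rewrite -[RHS]addr0 -slope_pred0; apply: slope_pred_dil5; vm_compute. Qed.
Lemma eta_dilN : twist (D (-1)) eta = eta + 1.
Proof. by rewrite -slope_pred1; apply: slope_pred_dilN; vm_compute. Qed.

Lemma u_dil5 : twist (D 5) u = u.
Proof.
have E : 5%:R = 1 :> 'F_2 by apply: val_inj.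
by rewrite twist_dil_u // E scale1r.
Qed.

Lemma xi_shift_dilN : twist (D (-1)) (@xi_shift 2) = @xi_shift 2.
Proof.
apply/funext => s; rewrite /twist /xi_shift /= shiftM shift_dil slope_dil //.
by rewrite add0r mulN1r intrN F2_opp.
Qed.
Lemma u_dilN : twist (D (-1)) u = u.
Proof. by rewrite /coc_u twist_sdiff xi_shift_dilN. Qed.

Lemma xi_x_dif : twist (D 5) xi_x - xi_x = 1.
Proof. by rewrite xi_x_dil5 addrC addKr. Qed.
Lemma eta_dif : twist (D (-1)) eta - eta = 1.
Proof. by rewrite eta_dilN addrC addKr. Qed.

Let dif_surj5 n h := @dif_surj_dil 2 p_pr 5 isT isT n h.

(** As 5 is 1 modulo 2, D 5 fixes u and [coh_basis_step] applies: translations and powers of 5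
    together have the additive basis 1, u, x, x u. *)
Lemma coh_basis_dil5_1 : coh_basis lev K2 1 [:: u; coc_x].
Proof.
have b0 := coh_basis_trans0 p_pr; have b1 := coh_basis_trans1 p_pr.
pose e1 := [:: 1 : cochain]; pose eu := [:: u].
have t1 i : (i < size e1)%N -> twist (D 5) e1`_i = e1`_i by case: i.
have tu i : (i < size eu)%N -> twist (D 5) eu`_i = eu`_i.
  by case: i => //= _; apply: u_dil5.
have z1 i : (i < size e1)%N -> scocycle lev K2 0 e1`_i.
  by case: i => // _; apply: scocycle1.
rewrite -[coc_x](scup1r 1); exact: (coh_basis_step (@lev_refl 2) (@lev_le 2)
  (@difD_dil _ _ _) dif_surj5 (icochain_slope_pred _) xi_x_dif b1 tu b0 t1 b0 z1).
Qed.

Lemma scocycle_dil5_u : scocycle lev K2 1 u.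
Proof.
have [hu du] := scocycle_u p_pr; split=> //; apply: icochain_add => //; exact: u_dil5.
Qed.

Lemma coh_basis_dil5_2 : coh_basis lev K2 2 [:: scup 1 coc_x u].
Proof.
have b1 := coh_basis_trans1 p_pr; have b2 := coh_basis_transSS p_pr 0.
pose e0 := [::] : seq cochain; pose eu := [:: u].
have t0 i : (i < size e0)%N -> twist (D 5) e0`_i = e0`_i by [].
have tu i : (i < size eu)%N -> twist (D 5) eu`_i = eu`_i.
  by case: i => //= _; apply: u_dil5.
have zu i : (i < size eu)%N -> scocycle lev K2 1 eu`_i.
  by case: i => //= _; apply: scocycle_dil5_u.
exact: (coh_basis_step (@lev_refl 2) (@lev_le 2)
  (@difD_dil _ _ _) dif_surj5 (icochain_slope_pred _) xi_x_dif b2 t0 b1 tu b1 zu).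
Qed.

Lemma coh_basis_dil5_3 n : coh_basis lev K2 n.+3 ([::] : seq cochain).
Proof.
have b := coh_basis_transSS p_pr.
pose e0 := [::] : seq cochain.
have t0 i : (i < size e0)%N -> twist (D 5) e0`_i = e0`_i by [].
have z0 i : (i < size e0)%N -> scocycle lev K2 n.+2 e0`_i by [].
exact: (coh_basis_step (@lev_refl 2) (@lev_le 2)
  (@difD_dil _ _ _) dif_surj5 (icochain_slope_pred _) xi_x_dif (b n.+1) t0 (b n) t0 (b n) z0).
Qed.

Lemma twist_twist t t' (f : cochain) : twist t (twist t' f) = twist (t' \o t) f.
Proof. by []. Qed.

Lemma dil_comm (a b : int) : ~~ (2 %| a)%Z -> ~~ (2 %| b)%Z ->
  D a \o D b = D (a * b) :> (aff 2 -> aff 2).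
Proof.
move=> ha hb; apply/funext => x /=; have hab :
  ~~ (2 %| a * b)%Z by rewrite dvdzM_prime // negb_or ha.
by apply: aff_eq; rewrite !(slopeM, shiftM) !slope_dil // ?shift_dil; ring.
Qed.

Lemma dilN_dilN : D (-1) \o D (-1) = id :> (aff 2 -> aff 2).
Proof.
rewrite dil_comm // mulN1r opprK; apply/funext => x.
by apply: aff_eq; rewrite !(slopeM, shiftM) !slope_dil // ?shift_dil; ring.
Qed.

(** Multiplication by -1 normalizes the translations and commutes with multiplication by 5. *)
Lemma twist_dilN_icochain n (f : cochain) : icochain lev K2 n f ->
  icochain lev K2 n (twist (D (-1)) f).
Proof.
move=> hf; apply: twist_icochain => // t [Kt|->].
  have hf1 : icochain lev K1 n f by apply: icochain_sub hf => t'; left.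
  by have [_] := twist_dil_icochain (-1) hf1; apply.
rewrite !twist_twist dil_comm // mulrC -dil_comm // -twist_twist.
by have [_ ->] := hf; last by right.
Qed.

(** Since t^2 = 1, applying t to t f - f changes its sign, which is invisible in characteristic 2.
    So t - 1 takes values in the invariants. *)
Lemma Kall2_dif n (f : cochain) : icochain lev K2 n f ->
  icochain lev Kall2 n (twist (D (-1)) f - f).
Proof.
move=> hf; apply: icochain_add.
  by apply: (icochainB (@lev_le 2)) => //; apply: twist_dilN_icochain.
rewrite linearB /= twist_twist dilN_dilN.
by rewrite -[RHS]cochain2_opp opprB.
Qed.

Lemma icochain_eta : icochain lev K2 0 eta.
Proof. by apply: icochain_add eta_dil5; apply: icochain_slope_pred. Qed.

(** For invariant h, the product of [eta] and h is a preimage, because t - 1 sends [eta] to 1. *)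
Lemma Kall2_surj n (h : cochain) : icochain lev Kall2 n h ->
  exists2 h', icochain lev K2 n h' & twist (D (-1)) h' - h' = h.
Proof.
move=> hh; exists (scup 0 eta h).
  apply: (@icochain_scup _ _ _ (@lev_le 2) _ 0) => //; first exact: icochain_eta.
  by apply: icochain_sub hh => t; left.
have [_ ht] := hh; rewrite twist_scup ht; last by right.
by rewrite -scupBl eta_dif scup1l.
Qed.

Definition basis_ext (n : nat) : seq cochain :=
  match n with 1 => [:: u; coc_x] | 2 => [:: scup 1 coc_x u] | _ => [::] end%N.
Fixpoint basis2 (n : nat) : seq cochain :=
  if n is m.+1 then basis_ext m.+1 ++ map (scup 1 coc_y) (basis2 m) else [:: 1].

(** The quotient complex is here the invariant complex itself, so the basis found in degree n serves
    as [z] in degree n + 1. Each step multiplies it by [coc_y], the class w, and adds the classes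
    coming from translations and 5. *)
Lemma coh_basis2 n : coh_basis lev Kall2 n (basis2 n).
Proof.
have te m i : (i < size (basis_ext m.+1))%N ->
  twist (D (-1)) (basis_ext m.+1)`_i = (basis_ext m.+1)`_i.
  have tx : twist (D (-1)) coc_x = coc_x by rewrite /coc_x twist_sdiff xi_x_dilN.
  case: m => [|[|m]] //=; case: i => [|[|i]] //= _; first exact: u_dilN.
  by rewrite twist_scup tx u_dilN.
pose e1 := [:: 1 : cochain].
have t1 i : (i < size e1)%N -> twist (D (-1)) e1`_i = e1`_i by case: i.
have b0 := coh_basis_dil0 p_pr 5.
have be m : coh_basis lev K2 m.+1 (basis_ext m.+1).
  case: m => [|[|m]];
    [exact: coh_basis_dil5_1|exact: coh_basis_dil5_2|exact: coh_basis_dil5_3].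
elim: n => [|n IH]; first exact: coh_basis_step0 b0 t1.
have zn i : (i < size (basis2 n))%N ->
  scocycle lev Kall2 n (basis2 n)`_i by case: IH => h _ _; apply: h.
pose step := coh_basis_step (@lev_refl 2) (@lev_le 2) Kall2_dif Kall2_surj icochain_eta eta_dif.
case: n IH zn => [|n] IH zn; first exact: (step _ _ _ _ (be 0%N) (te 0%N) b0 t1 IH zn).
exact: (step _ _ _ _ (be n.+1) (te n.+1) (be n) (te n) IH zn).
Qed.

Lemma scocycle2_y : scocycle lev Kall2 1 coc_y.
Proof. exact: (scocycle_sdiff_xi icochain_eta eta_dif). Qed.

Lemma scocycle2_u : scocycle lev Kall2 1 u.
Proof. by have [h _ _] := coh_basis2 1; apply: (h 0%N). Qed.

Lemma scocycle2_x : scocycle lev Kall2 1 coc_x.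
Proof. by have [h _ _] := coh_basis2 1; apply: (h 1%N). Qed.

Lemma icochain_all2 n (f : cochain) : icochain lev K1 n f ->
  twist (D 5) f = f -> twist (D (-1)) f = f -> icochain lev Kall2 n f.
Proof. by move=> h h5 hN; apply: icochain_add hN; apply: icochain_add h5. Qed.

(** The cochain xi_x x has differential x^2, but D 5 adds x = d xi_x to it. Subtracting d xi_x2,
    which changes by the same amount, restores invariance without affecting the differential. *)
Lemma scobound_xx : scobound lev Kall2 2 (scup 1 coc_x coc_x).
Proof.
have h0 : icochain lev K1 0 xi_x by apply: icochain_slope_pred.
have [[hx _] dx] := (scocycle2_x, sdiff_sdiff 0 xi_x).
exists (scup 0 xi_x coc_x - sdiff 0 xi_x2); last first.
  rewrite sdiffB sdiff_sdiff subr0 (@sdiff_scup _ _ 0) ?dx ?linear0 ?addr0 //.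
  by apply: icochain_sdeg (@lev_refl 2) _ _ _ h0.
have [_ tx] := hx.
apply: icochain_all2.
- apply: (icochainB (@lev_le 2)); last by apply: icochain_sdiff; apply: icochain_slope_pred.
  apply: (@icochain_scup _ _ _ (@lev_le 2) _ 0) => //.
  by apply: icochain_sub hx => t; left; left.
- rewrite linearB /= twist_scup tx ?twist_sdiff ?xi_x_dil5 ?xi_x2_dil5; last by left; right.
  rewrite scupDl scup1l linearD /= -/coc_x.
  by apply/funext => s; rewrite !(scochainD, scochainN); ring.
- by rewrite linearB /= twist_scup tx ?twist_sdiff ?xi_x_dilN ?xi_x2_dilN //; right.
Qed.

(** The second binary digit of the shift. The first digit is the carry into it when 1 is added. *)
Definition xi_shift2 : cochain := fun s => (1 < residue 4 (shift (s 0%N)))%N%:R.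

Lemma residue4_ind (P : pred nat) : all P (iota 0 4) -> forall a, P (residue 4 a).
Proof. by move=> /allP h a; apply: h; rewrite mem_iota residue_lt. Qed.

Lemma xi_shiftE (s : nat -> aff 2) : xi_shift s = (odd (residue 4 (shift (s 0%N))))%:R.
Proof.
have d : (2 %| shift (s 0%N) - (residue 4 (shift (s 0%N)))%:Z)%Z.
  by apply: dvdz_trans (residueE (shift (s 0%N)) (n := 4) isT).
rewrite /xi_shift (intr_Fp_eq p_pr d) -pmulrn; apply: val_inj.
by rewrite /= val_Fp_nat // modn2 val_Fp_nat // modn_small // ltnS leq_b1.
Qed.

Lemma xi_shift2_T : twist T xi_shift2 = xi_shift2 + @xi_shift 2.
Proof.
apply/funext => s; rewrite scochainD xi_shiftE -F2_addb /twist /xi_shift2 /=.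
rewrite shiftM shift_transl slope_transl mul1r residueS //.
congr (nat_of_bool _)%:R; apply/(@eqP bool).
exact: (@residue4_ind (fun i => (1 < i.+1 %% 4)%N == (1 < i)%N (+) odd i) isT).
Qed.
Lemma xi_shift2_dil5 : twist (D 5) xi_shift2 = xi_shift2.
Proof.
apply/funext => s; rewrite /twist /xi_shift2 /=.
rewrite shiftM shift_dil slope_dil // add0r residueM //.
congr (nat_of_bool _)%:R; apply/(@eqP bool).
exact: (@residue4_ind (fun i => (1 < 5 * i %% 4)%N == (1 < i)%N) isT).
Qed.
Lemma xi_shift2_dilN : twist (D (-1)) xi_shift2 = xi_shift2 + @xi_shift 2.
Proof.
apply/funext => s; rewrite scochainD xi_shiftE -F2_addb /twist /xi_shift2 /=.
rewrite shiftM shift_dil slope_dil // add0r mulN1r residueN //.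
congr (nat_of_bool _)%:R; apply/(@eqP bool).
exact: (@residue4_ind (fun i => (1 < (4 - i) %% 4)%N == (1 < i)%N (+) odd i) isT).
Qed.

Lemma xi_shift_dil5 : twist (D 5) (@xi_shift 2) = @xi_shift 2.
Proof.
apply/funext => s; rewrite /twist /xi_shift /= shiftM shift_dil slope_dil //.
have E : 5%:R = 1 :> 'F_2 by apply: val_inj.
by rewrite add0r intrM -pmulrn E mul1r.
Qed.
Lemma xi_shift_T : twist T (@xi_shift 2) = @xi_shift 2 + 1.
Proof. by apply/eqP; rewrite -subr_eq0 opprD addrA xi_shift_dif subrr. Qed.

(** xi_shift u has differential u^2 and gains u under the unit translation; subtracting d xi_shift2
    repairs this. But negation flips the second digit of odd numbers, so d xi_shift2 gains u under
    -1. Adding eta u, which also gains u there, compensates and costs the term w u. *)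
Lemma scobound_uu : scobound lev Kall2 2 (scup 1 u u + scup 1 coc_y u).
Proof.
have [hu du] := scocycle2_u; have [_ tu] := hu.
have [ctsu _] := icochain_xi_shift p_pr.
have cts2 : exists k, slev lev 0 k xi_shift2.
  by exists 1%N => s s' /(_ 0%N isT) /andP[_ h]; congr (nat_of_bool (1 < _)%N)%:R;
    apply: residue_eq.
have hs : icochain lev (fun=> False) 0 (@xi_shift 2) by [].
have he := icochain_slope_pred res_y; rewrite -/eta in he.
have hu0 : icochain lev (fun=> False) 1 u by apply: icochain_sub hu.
exists (scup 0 (@xi_shift 2) u - sdiff 0 xi_shift2 + scup 0 eta u); last first.
  rewrite linearD /= sdiffB sdiff_sdiff subr0.
  rewrite !(@sdiff_scup _ _ 0) ?du ?linear0 ?addr0 //.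
    exact: (icochain_sdeg (@lev_refl 2) he).
  exact: (icochain_sdeg (@lev_refl 2) hs).
apply: icochain_all2.
- split.
    (* Only finiteness of the level is wanted here. It is derived with no invariance imposed, as the
       separate summands are not all invariant under the translation. *)
    suff [] : icochain lev (fun=> False) 1 (scup 0 (@xi_shift 2) u - sdiff 0 xi_shift2 + scup 0 eta u) by [].
    apply: (icochainD (@lev_le 2)); first apply: (icochainB (@lev_le 2)).
    + exact: (@icochain_scup _ _ _ (@lev_le 2) _ 0).
    + exact: icochain_sdiff.
    + apply: (@icochain_scup _ _ _ (@lev_le 2) _ 0) => //; exact: icochain_sub he.
  move=> t [//|->].
  rewrite linearD linearB /= !twist_scup.
  rewrite (_ : twist T u = u); last by apply: tu; left; left; right.
  rewrite (_ : twist T eta = eta); last by have [_ h] := he; apply: h; right.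
  rewrite twist_sdiff xi_shift_T xi_shift2_T.
  rewrite scupDl scup1l linearD /= -/u.
  by apply/funext => s; rewrite !(scochainD, scochainN); ring.
- by rewrite linearD linearB /= !twist_scup u_dil5 twist_sdiff xi_shift_dil5 xi_shift2_dil5 eta_dil5.
- rewrite linearD linearB /= !twist_scup u_dilN twist_sdiff xi_shift_dilN xi_shift2_dilN eta_dilN.
  rewrite scupDl scup1l linearD /= -/u.
  by apply/funext => s; rewrite !(scochainD, scochainN); ring.
Qed.

End Two.

(** * Comparison with the cohomology of the tower *)

Section Homogeneous.
Variables (F : fieldType) (X : Type) (G : finGroupType) (pi : X -> G).

Definition quots n (s : nat -> X) : n.-tuple G :=
  [tuple ((pi (s i))^-1 * pi (s i.+1))%g | i < n].

Lemma nth_quots n s i : (i < n)%N ->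
  nth 1%g (quots n s) i = ((pi (s i))^-1 * pi (s i.+1))%g.
Proof. by move=> lt_in; rewrite -[i]/(val (Ordinal lt_in)) nth_mktuple. Qed.

Definition hom n (f : cochain F G n) : scochain F X := fun s => f (quots n s).

Lemma homP n a (f g : cochain F G n) : hom (a *: f + g) = a *: hom f + hom g.
Proof. by apply/funext => s; rewrite /hom !ffunE. Qed.
Lemma hom0 n : hom (0 : cochain F G n) = 0.
Proof. by apply/funext => s; rewrite /hom ffunE. Qed.
Lemma hom_one : hom (cup_one F G) = 1.
Proof. by apply/funext => s; rewrite /hom ffunE. Qed.

Lemma hom_cobound n (f : cochain F G n) : hom (cobound f) = sdiff n (hom f).
Proof.
apply/funext => s; rewrite /hom /sdiff ffunE; apply: eq_bigr => i _.
congr (_ * f _); apply: eq_tuple1 => j lt_jn; rewrite nth_face // [in RHS]nth_quots //.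
rewrite /comp /bump; case: (ltngtP j.+1 i) => [lt_ji|lt_ij|e].
- by rewrite nth_quots ?(leqW lt_jn) // (_ : (i <= j)%N = false) //; lia.
- by rewrite nth_quots // (_ : (i <= j)%N = true) //; lia.
- rewrite !nth_quots ?(leqW lt_jn) // (_ : (i <= j)%N = false); last by lia.
  rewrite add0n add1n -mulgA.
  by rewrite [(pi (s j.+1) * _)%g]mulKVg.
Qed.

Lemma hom_cup m n (f : cochain F G m) (g : cochain F G n) :
  hom (cup f g) = scup m (hom f) (hom g).
Proof.
apply/funext => s; rewrite /hom /scup ffunE; congr (f _ * g _);
  apply: eq_tuple1 => i hi; rewrite nth_slice // !nth_quots ?ltn_add2l //=.
  by rewrite ltn_addr.
by rewrite addnS.
Qed.

Hypothesis pi_surj : forall g, exists x, pi x = g.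

Definition pi_sec (g : G) : X := projT1 (cid (pi_surj g)).
Lemma pi_secK g : pi (pi_sec g) = g.
Proof. exact: (projT2 (cid (pi_surj g))). Qed.

Definition partial_prods (t : seq G) (i : nat) : X := pi_sec (\prod_(j < i) nth 1%g t j).

Lemma quots_partial_prods n (t : n.-tuple G) : quots n (partial_prods t) = t.
Proof.
apply: eq_tuple1 => i hi; rewrite nth_quots // !pi_secK.
by rewrite big_ord_recr /= mulKg.
Qed.

Lemma hom_inj n : injective (@hom n).
Proof.
move=> f g e; apply/ffunP => t; rewrite -(quots_partial_prods t).
by have := congr1 (fun h => h (partial_prods t)) e.
Qed.

(** Partial products of an n-tuple, lifted to X, form a sequence with the given quotients. Any s
    differs at level of G from the one built from its own quotients by the left factor pi (s
    0)^-1. *)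
Lemma hom_surj n (f : scochain F X) :
  (forall (c : G) s s', (forall i, (i <= n)%N -> pi (s' i) = (c * pi (s i))%g) ->
    f s = f s') ->
  exists h : cochain F G n, f = hom h.
Proof.
move=> hf; exists [ffun t : n.-tuple G => f (partial_prods t)].
apply/funext => s; rewrite /hom ffunE; apply: (hf (pi (s 0%N))^-1%g) => i le_in.
rewrite pi_secK; elim: i le_in => [|i IH] lt_in; first by rewrite big_ord0 mulVg.
by rewrite big_ord_recr /= IH ?(ltnW lt_in) // nth_quots // mulgA mulgK.
Qed.

End Homogeneous.

(** * The cohomology of a tower through cochains on one set *)

Section Tower.
Variables (F : fieldType) (G : tower) (X : Type) (lev : nat -> X -> X -> Prop).
Variables (pi : forall k, X -> G k) (K : (X -> X) -> Prop).
Hypothesis lev_refl : forall k x, lev k x x.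
Hypothesis lev_le : forall j k x y, (j <= k)%N -> lev k x y -> lev j x y.
Hypothesis pi_surj : forall k g, exists x, pi k x = g.
Hypothesis pi_lev : forall k x y, lev k x y -> pi k x = pi k y.
Hypothesis pi_tmap : forall k x, tmap (pi k.+1 x) = pi k x.
Hypothesis pi_K : forall t, K t -> forall k, exists c, forall x, pi k (t x) = (c * pi k x)%g.
Hypothesis K_transitive : forall n k (f : scochain F X), icochain lev K n f ->
  slev lev n k f ->
  forall c s s', (forall i, (i <= n)%N -> pi k (s' i) = (c * pi k (s i))%g) -> f s = f s'.
Local Notation homk k f := (hom (pi k) f).
Local Notation H := (contCohomology F G).
Implicit Types (f g h : scochain F X).

Lemma icochain_hom k n (f : cochain F (G k) n) : icochain lev K n (homk k f).
Proof.
split=> [|t Kt]; first exists k => s s' hs.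
  by congr (f _); apply: eq_tuple1 => i hi; rewrite !nth_quots // !(pi_lev (hs _ _)) // ltnW.
have [c hc] := pi_K Kt k; apply/funext => s; congr (f _); apply: eq_tuple1 => i hi.
by rewrite !nth_quots //= !hc invMg -mulgA mulKg.
Qed.

Lemma icochain_homP n f : icochain lev K n f -> exists k (h : cochain F (G k) n), f = homk k h.
Proof.
move=> hf; have [[k fk] _] := hf; exists k.
by apply: hom_surj => // c s s'; apply: (K_transitive hf fk).
Qed.

(** Compatibility of the maps to the levels makes inflation invisible on X. *)
Lemma hom_pullback k n (f : cochain F (G k) n) : homk k.+1 (pullback (@tmap G k) f) = homk k f.
Proof.
apply/funext => s; rewrite /hom ffunE; congr (f _); apply: eq_tuple1 => i hi.
have r1 := morph1g (@tmapM G k).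
rewrite (nth_map 1%g) ?size_tuple // !nth_quots // tmapM !pi_tmap; congr (_ * _)%g.
by apply: (mulIg (pi k (s i))); rewrite mulVg -(@pi_tmap k) -tmapM mulVg.
Qed.

Lemma hom_raise k l n (f : cochain F (G k) n) : (k <= l)%N ->
  exists f' : cochain F (G l) n, homk l f' = homk k f /\ (cobound f = 0 ->
    [/\ cobound f' = 0, tail_seq (cohcls f) l = cohcls f'
      & colim_incl (cohcls f') = colim_incl (cohcls f)]).
Proof.
elim: l => [|l IH].
  rewrite leqn0 => /eqP e; subst k; exists f; split=> // df; split=> //; exact: tail_seq_id.
rewrite leq_eqVlt => /predU1P[e|lt_kl].
  by subst k; exists f; split=> // df; split=> //; exact: tail_seq_id.
have [f' [hf' Hf']] := IH lt_kl; exists (pullback (@tmap G l) f').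
split; first by rewrite hom_pullback.
move=> df; have [df' tf' cf'] := Hf' df; split.
- exact: (pullback_cocycle (@tmapM G l)).
- by rewrite tail_seqS // tf' (inflation_cls (@tmapM G l)).
- by rewrite -(inflation_cls (@tmapM G l)) // colim_incl_inflation.
Qed.

(** Raised to a common level, the two cocycles are equal, by injectivity of [hom]. This makes
    [kappa] independent of the chosen level and cocycle. *)
Lemma colim_incl_hom k l n (f : cochain F (G k) n) (g : cochain F (G l) n) :
  cobound f = 0 -> cobound g = 0 -> homk k f = homk l g ->
  colim_incl (cohcls f) = colim_incl (cohcls g).
Proof.
move=> df dg e; have [f' [ef Hf]] := hom_raise f (leq_maxl k l).
have [g' [eg Hg]] := hom_raise g (leq_maxr k l).
have [_ _ <-] := Hf df; have [_ _ <-] := Hg dg; congr (colim_incl (cohcls _)).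
by apply: (hom_inj (pi_surj (k := _))); rewrite ef eg.
Qed.

Definition is_hom_cocycle n f :=
  exists k, exists h : cochain F (G k) n, cobound h = 0 /\ f = homk k h.

(* 0 if f is not a cocycle *)
Definition kappa n f : H n :=
  match pselect (is_hom_cocycle n f) with
  | left e => colim_incl (cohcls (projT1 (cid (projT2 (cid e)))))
  | right _ => 0
  end.

Lemma kappa_hom k n (f : cochain F (G k) n) : cobound f = 0 ->
  kappa n (homk k f) = colim_incl (cohcls f).
Proof.
move=> df; rewrite /kappa; case: pselect => [e|]; last by case; exists k, f.
case: (cid _) => l el /=; case: (cid _) => h [dh eh] /=.
exact/esym/colim_incl_hom.
Qed.

Lemma scocycle_homP n f : scocycle lev K n f -> is_hom_cocycle n f.
Proof.
move=> [/icochain_homP[k [h ->]]]; rewrite -hom_cobound -(hom0 F (pi k) n.+1).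
by move=> /(hom_inj (pi_surj (k := _))) dh; exists k, h.
Qed.

Lemma scocycle_hom k n (f : cochain F (G k) n) : cobound f = 0 -> scocycle lev K n (homk k f).
Proof. by move=> df; split; [exact: icochain_hom|rewrite -hom_cobound df hom0]. Qed.

Lemma scocycle_hom2 m n f g : scocycle lev K m f -> scocycle lev K n g ->
  exists k, exists2 a : cochain F (G k) m, cobound a = 0 /\ f = homk k a
    & exists b : cochain F (G k) n, cobound b = 0 /\ g = homk k b.
Proof.
move=> /scocycle_homP[k [a [da ->]]] /scocycle_homP[l [b [db ->]]].
have [a' [ea Ha]] := hom_raise a (leq_maxl k l).
have [b' [eb Hb]] := hom_raise b (leq_maxr k l).
have [[da' _ _] [db' _ _]] := (Ha da, Hb db).
by exists (maxn k l), a' => //; exists b'.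
Qed.

Lemma kappaP n a f g : scocycle lev K n f -> scocycle lev K n g ->
  kappa n (a *: f + g) = a *: kappa n f + kappa n g.
Proof.
move=> hf hg; have [k [b [db ->]] [c [dc ->]]] := scocycle_hom2 hf hg.
rewrite -homP !kappa_hom //; last exact: cocyclesP.
by rewrite cohclsP // colim_inclP.
Qed.

Lemma kappaM m n f g : scocycle lev K m f -> scocycle lev K n g ->
  kappa (m + n) (scup m f g) = gmul (kappa m f) (kappa n g).
Proof.
move=> hf hg; have [k [b [db ->]] [c [dc ->]]] := scocycle_hom2 hf hg.
rewrite -hom_cup !kappa_hom //; last exact: cocyclesM.
by rewrite -cohclsM // colim_inclM.
Qed.

Lemma colim_incl0 k n : colim_incl (0 : cohomology F (G k) n) = 0.
Proof.
have := colim_inclP 1 (0 : cohomology F (G k) n) 0.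
rewrite !scale1r addr0 => e; apply: (addrI (colim_incl (0 : cohomology F (G k) n))).
by rewrite -e addr0.
Qed.

Lemma cohcls0 k n : cohcls (0 : cochain F (G k) n) = 0.
Proof.
have := cohclsP 1 (cobound0 F (G k) n) (cobound0 F (G k) n).
rewrite !scale1r addr0 => e; apply: (addrI (cohcls (0 : cochain F (G k) n))).
by rewrite -e addr0.
Qed.

Lemma scobound_hom k n (a : cochain F (G k) n) : is_cobound a -> scobound lev K n (homk k a).
Proof.
case: n a => [|n] a => [->|[b ->]]; first exact: hom0.
by exists (homk k b); [exact: icochain_hom|exact: hom_cobound].
Qed.

(** A class vanishing in the limit is a coboundary at some finite level. Conversely a cochain on X
    bounding f comes from some level, and the two are compared at the larger one. *)
Lemma kappa_eq0 n f : scocycle lev K n f -> (kappa n f = 0 <-> scobound lev K n f).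
Proof.
move=> hf; have [k [a [da fE]]] := scocycle_homP hf; rewrite fE kappa_hom //; split.
  move/colim_incl_eq0 => [j le_kj]; have [a' [ea Ha]] := hom_raise a le_kj.
  have [da' -> _] := Ha da; rewrite -cohcls0.
  move/(cohcls_eq da' (cobound0 _ _ _)); rewrite subr0 -ea.
  exact: scobound_hom.
case: n f a hf da fE => [|n] f a hf da fE.
  move=> /= e; suff -> : a = 0 by rewrite cohcls0 colim_incl0.
  by apply: (hom_inj (pi_surj (k := _))); rewrite e hom0.
move=> [g /icochain_homP[l [b ->]] e].
have [a' [ea Ha]] := hom_raise a (leq_maxl k l).
have [b' [eb _]] := hom_raise b (leq_maxr k l).
have [da' _ <-] := Ha da; rewrite -(colim_incl0 (maxn k l)) -cohcls0; congr colim_incl.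
apply/cohcls_eq => //; first exact: cobound0.
rewrite subr0; exists b'; apply: (hom_inj (pi_surj (k := _))).
by rewrite hom_cobound ea eb.
Qed.

Lemma kappa_surj n (c : H n) : exists2 f, scocycle lev K n f & kappa n f = c.
Proof.
have [k [a ->]] := colim_incl_surj c; exists (homk k (cohrep a)).
  by apply: scocycle_hom; apply: cohrepP.
by rewrite kappa_hom ?cohrepK //; apply: cohrepP.
Qed.

Lemma kappa1 : kappa 0 1 = gone H.
Proof.
rewrite -(hom_one F (pi 0)) kappa_hom; last exact: cocycles1.
rewrite cohcls1; congr (sqcls _ _ _).
apply: functional_extensionality_dep => j.
elim: j => [|j IH]; first exact: tail_seq_id.
by rewrite tail_seqS // IH; apply: inflation1 (@tmapM G j).
Qed.

End Tower.

(** * From affine maps to the holomorphs *)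

Section AffineToHolomorph.
Variables (p : nat) (p_pr : prime p).
Local Notation Z k := 'Z_(p ^ k.+1).

Lemma aut_ext k (f g : [subg Aut [set: Zpow p k]]) :
  (forall z : Zpow p k, aut_app f z = aut_app g z) -> f = g.
Proof. by move=> h; apply/val_inj/permP => z; apply: h. Qed.

Lemma mul_aut_exists k (x : aff p) : exists f : [subg Aut [set: Zpow p k]],
  forall z : Z k, aut_app f z = z * (slope x)%:~R.
Proof.
pose a := `|(slope x %% (p ^ k.+1)%N)%Z|%N.
have q0 : (p ^ k.+1)%:Z != 0 by rewrite eqz_nat expn_eq0 negb_and -lt0n prime_gt0.
have aE : (a%:R : Z k) = (slope x)%:~R.
  apply/eqP; rewrite -[a%:R]/((a%:Z)%:~R) Zp_intr_eq // /a gez0_abs ?modz_ge0 //.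
  by rewrite -eqz_mod_dvd modz_mod.
have ca : coprime p a.
  rewrite prime_coprime //; apply/negP => d; case/negP: (valP x).
  have : (p %| slope x - a%:Z)%Z.
    apply: (@dvdz_trans (p ^ k.+1)%N%:Z); first by rewrite dvdzE dvdn_exp.
    by rewrite -Zp_intr_eq // -aE.
  move=> d'; rewrite -[X in (_ %| X)%Z](subrK a%:Z) rpredD //.
have [f fE] := Zpow_mul_aut p_pr k ca; exists f => z.
by rewrite -{1}[z]natr_Zp fE natrM natr_Zp aE.
Qed.

Definition mul_aut k (x : aff p) := projT1 (cid (mul_aut_exists k x)).
Lemma mul_autE k x (z : Z k) : aut_app (mul_aut k x) z = z * (slope x)%:~R.
Proof. exact: (projT2 (cid (mul_aut_exists k x))). Qed.

Lemma slope_unit k (x : aff p) : ((slope x)%:~R : Z k) \is a GRing.unit.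
Proof. by apply: Zp_intr_unit; rewrite // (valP x). Qed.

Lemma mul_autVE k x (z : Z k) : aut_app (mul_aut k x)^-1%g z = z / (slope x)%:~R.
Proof.
apply: (mulIr (slope_unit k x)); rewrite divrK ?slope_unit // -mul_autE -aut_mul.
by rewrite mulVg aut_one.
Qed.

(* The affine map with slope a and shift b corresponds to the pair (f, x) with f
   the multiplication by a and x = f^-1(b). *)
Definition hol_of_aff k (x : aff p) : hol (Zpow p k) :=
  Hol (mul_aut k x) ((shift x)%:~R / (slope x)%:~R : Z k)%R.

(** The second coordinate b/a fits the product of the holomorph: (b + a b')/(a a') = a'^-1 (b/a) +
    b'/a'. *)
Lemma hol_of_affM k c x :
  hol_of_aff k (aff_mul p_pr c x) = (hol_of_aff k c * hol_of_aff k x)%g.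
Proof.
congr Hol.
  apply: aut_ext => z; rewrite aut_mul !mul_autE slopeM intrM.
  by rewrite -mulrA [_%:~R * _ in RHS]mulrC.
rewrite [in RHS]mul_autVE; have [uc ux] := (slope_unit k c, slope_unit k x).
rewrite -[RHS]/((shift c)%:~R / (slope c)%:~R / (slope x)%:~R + (shift x)%:~R / (slope x)%:~R).
rewrite shiftM slopeM intrD !intrM invrM // [_^-1 * _]mulrC mulrDl !mulrA; congr (_ + _).
by congr (_ * _); rewrite [_ * (shift x)%:~R]mulrC mulrK.
Qed.

Lemma hol_of_aff_lev k x y : lev k x y <-> hol_of_aff k x = hol_of_aff k y.
Proof.
split=> [/andP[]|e].
  rewrite -!Zp_intr_eq // => /eqP es /eqP et; rewrite /hol_of_aff es et; congr Hol.
  by apply: aut_ext => z; rewrite !mul_autE es.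
have ea : mul_aut k x = mul_aut k y := congr1 (@hol_aut _) e.
have eb : (shift x)%:~R / (slope x)%:~R = (shift y)%:~R / (slope y)%:~R :> Z k.
  exact: (congr1 (@hol_elt _) e).
have es : (slope x)%:~R = (slope y)%:~R :> Z k.
  by rewrite -[LHS]mul1r -[RHS]mul1r -!mul_autE ea.
apply/andP; rewrite -!Zp_intr_eq // es eqxx; split=> //.
by apply/eqP/(mulIr (x := (slope y)%:~R^-1)); rewrite ?unitrV ?slope_unit // -{1}es.
Qed.

Lemma hol_of_aff_surj k g : exists x, hol_of_aff k x = g.
Proof.
case: g => f e; have [a ca fE] := Zpow_aut_mul p_pr f.
have ha : ~~ (p %| (a%:Z, (nat_of_ord ((e : Z k) * a%:R))%:Z).1)%Z.
  by rewrite dvdzE /= -prime_coprime.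
pose x : aff p := Sub (_, _) ha.
have ua : (a%:R : Z k) \is a GRing.unit by apply: (slope_unit k x).
exists x; congr Hol.
  by apply: aut_ext => z; have [b ->] := Zpow_nat z; rewrite mul_autE fE natrM.
by rewrite -[LHS]/((nat_of_ord ((e : Z k) * a%:R))%:R / a%:R) natr_Zp mulrK.
Qed.

Lemma Zpow_redD k (x y : Z k.+1) :
  Zpow_red (x + y : Z k.+1)%R = (Zpow_red (x : Z k.+1) : Z k) + (Zpow_red (y : Z k.+1) : Z k).
Proof. exact: (Zpow_redM p_pr (x : Zpow p k.+1) y). Qed.

Lemma Zpow_red_mul k (x y : Z k.+1) :
  Zpow_red (x * y : Z k.+1)%R = (Zpow_red (x : Z k.+1) : Z k) * (Zpow_red (y : Z k.+1) : Z k).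
Proof.
have [a ->] := Zpow_nat (x : Zpow p k.+1); have [b ->] := Zpow_nat (y : Zpow p k.+1).
transitivity (Zpow_red ((a * b)%:R : Z k.+1)%R);
  first exact: (congr1 (@Zpow_red p k) (esym (natrM (Z k.+1) a b))).
rewrite !(Zpow_red_nat p_pr); exact: (natrM (Z k) a b).
Qed.

Lemma Zpow_red_int k (a : int) : Zpow_red (a%:~R : Z k.+1) = a%:~R :> Z k.
Proof.
case: a => n; first exact: Zpow_red_nat.
apply: (addIr (n.+1%:R : Z k)); rewrite NegzE intrN addNr -(Zpow_red_nat p_pr k n.+1).
by rewrite -Zpow_redD ?intrN addNr; apply: (Zpow_red_nat p_pr k 0).
Qed.

Lemma hol_of_aff_tmap k x : @tmap (hol_tower p_pr) k (hol_of_aff k.+1 x) = hol_of_aff k x.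
Proof.
congr Hol => /=.
  apply: induced_aut_uniq; [exact: Zpow_red_surj|exact: Zpow_desc|].
  move=> z; rewrite !mul_autE.
  by rewrite -Zpow_red_int -Zpow_red_mul.
apply: (mulIr (slope_unit k x)); rewrite divrK ?slope_unit //.
rewrite -[in LHS](Zpow_red_int k (slope x)) -Zpow_red_mul divrK ?Zpow_red_int //.
exact: slope_unit.
Qed.

End AffineToHolomorph.

(** * Generators of the units modulo prime powers *)

Section PowersModPrimePowers.
Variables (p : nat) (p_pr : prime p).

(** The p-adic valuation of x is exactly j. *)
Definition exact_pow j (x : int) := exists2 d, x = (p ^ j)%N%:Z * d & ~~ (p %| d)%Z.

Let S (a : int) n : int := \sum_(i < n) a ^+ i.

Lemma geom_sum_sub (a : int) n : (p %| a - 1)%Z -> (p %| S a n - n%:Z)%Z.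
Proof.
move=> d; have -> : S a n - n%:Z = \sum_(i < n) (a ^+ i - 1).
  by rewrite sumrB big_const_ord iter_addr_0 natz.
by apply: rpred_sum => i _; rewrite subrX1 dvdz_mulr.
Qed.

(** The cofactor of a - 1 in a^p - 1 is p modulo p^2, hence has valuation 1. For p odd it differs
    from p by a - 1 times a number congruent to p(p - 1)/2, both divisible by p; for p = 2 it
    differs by a - 1 alone, which must therefore be divisible by 4. *)
Lemma exact_pow_lift j (a : int) : (0 < j)%N -> (p == 2 -> 1 < j)%N ->
  exact_pow j (a - 1) -> exact_pow j.+1 (a ^+ p - 1).
Proof.
move=> j_gt0 j2 [d ad pd].
have d1 : (p %| a - 1)%Z by rewrite ad dvdz_mulr // dvdzE dvdn_exp.
have d2 : ((p ^ 2)%N %| S a p - p%:Z)%Z.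
  have [p2|p_odd] := eqVneq p 2%N.
    have -> : S a p - p%:Z = a - 1 by rewrite p2 /S !big_ord_recl big_ord0 /= /bump /=; ring.
    by rewrite ad dvdz_mulr // dvdzE dvdn_exp2l // j2 ?p2.
  have -> : S a p - p%:Z = (a - 1) * \sum_(i < p) S a i.
    transitivity (\sum_(i < p) (a ^+ i - 1)).
      by rewrite sumrB big_const_ord iter_addr_0 natz.
    by rewrite mulr_sumr; apply: eq_bigr => i _; rewrite subrX1.
  rewrite -mulnn PoszM dvdz_mul //.
  have -> : \sum_(i < p) S a i = \sum_(i < p) (S a i - i%:Z) + ('C(p, 2))%:Z.
    rewrite sumrB -[X in X%:Z]bin2_sum big_mkord -(big_morph Posz PoszD (erefl _)).
    by rewrite subrK.
  rewrite rpredD ?rpred_sum // => [i _|]; first exact: geom_sum_sub.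
  rewrite dvdzE /=; apply: prime_dvd_bin => //.
  by have := prime_gt1 p_pr; rewrite leq_eqVlt eq_sym (negPf p_odd).
have [w Ew] := dvdzP d2.
exists (d * (1 + w * p%:Z)).
  rewrite subrX1 -/(S a p) -[S a p](subrK p%:Z) Ew ad !expnS expn0 muln1 !PoszM; ring.
rewrite dvdzM_prime // negb_or pd /=; apply: contra (isT : ~~ false) => h.
have : (p %| 1 + w * p%:Z - w * p%:Z)%Z by rewrite rpredB // dvdz_mull.
by rewrite addrK dvdzE dvdn1 gtn_eqF // prime_gt1.
Qed.

(** Successive approximation: r^(Q p^k) is 1 plus p^(j0+k) times a number prime to p, so its powers
    correct the next p-adic digit of the error at will. *)
Lemma powers_generate (r : int) Q j0 (a : int) : (0 < j0)%N -> (p == 2 -> 1 < j0)%N ->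
  ~~ (p %| r)%Z -> exact_pow j0 (r ^+ Q - 1) ->
  (exists i, ((p ^ j0)%N %| a - r ^+ i)%Z) ->
  forall k, exists i, ((p ^ (j0 + k))%N %| a - r ^+ i)%Z.
Proof.
move=> j0_gt0 j02 pr exQ a0.
have exk k : exact_pow (j0 + k) (r ^+ (Q * p ^ k) - 1).
  elim: k => [|k IH]; first by rewrite addn0 muln1.
  rewrite addnS expnSr mulnA exprM; apply: exact_pow_lift => //; first by rewrite ltn_addr.
  by move=> /j02 h; rewrite ltn_addr.
elim=> [|k [i /dvdzP[e Ei]]]; first by rewrite addn0.
have [d Ed pd] := exk k; set q := (p ^ (j0 + k))%N in Ei Ed.
have pi : ~~ (p %| r ^+ i * d)%Z.
  rewrite dvdzM_prime // negb_or pd andbT.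
  by elim: i {Ei} => [|i IH];
    rewrite ?expr0 ?exprS ?dvdzM_prime // ?negb_or ?pr // dvdzE dvdn1 gtn_eqF ?prime_gt1.
have u0 : (r ^+ i * d)%:~R != 0 :> 'F_p by apply: contra pi => /eqP /(Fp_eq0P p_pr).
(* The exponent j solves e = j r^i d modulo p, which cancels the leading digit of a - r^i. *)
pose j : nat := (e%:~R / (r ^+ i * d)%:~R : 'F_p).
have dj : (p %| e - j%:Z * (r ^+ i * d))%Z.
  apply: (Fp_eq0P p_pr); rewrite intrB intrM -[j%:~R]/(j%:R) /j natr_Zp divfK ?subrr //.
exists (i + Q * p ^ k * j)%N.
rewrite exprD [r ^+ (_ * j)]exprM; set x := r ^+ (Q * p ^ k) in Ed *.
have -> : a - r ^+ i * x ^+ j = (a - r ^+ i) - r ^+ i * (x ^+ j - 1).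
  by rewrite mulrBr mulr1 opprB addrA subrK.
rewrite subrX1 -/(S x j) Ei Ed.
have -> : e * q%:Z - r ^+ i * (q%:Z * d * S x j) =
  q%:Z * ((e - j%:Z * (r ^+ i * d)) - r ^+ i * d * (S x j - j%:Z)) by ring.
rewrite addnS expnSr PoszM -/q dvdz_mul // rpredB // dvdz_mull //.
apply: geom_sum_sub; rewrite Ed dvdz_mulr // dvdzE /q /=.
by rewrite -{1}(expn1 p) dvdn_exp2l // ltn_addr.
Qed.

End PowersModPrimePowers.

(** One of a and -a is 1 = 5^0 modulo 4, and 5 - 1 has valuation exactly 2, the starting level
    required for p = 2. *)
Lemma powers_of_5 (a : int) k : ~~ (2 %| a)%Z ->
  exists (b : bool) i, ((2 ^ k.+1)%N %| a - (-1) ^+ b * 5 ^+ i)%Z.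
Proof.
move=> a2; have ex5 : exact_pow 2 2 (5 ^+ 1 - 1) by exists 1.
have [b hb] : exists b : bool, ((2 ^ 2)%N %| (-1) ^+ b * a - 5 ^+ 0)%Z.
  have : ((2 ^ 2)%N %| a - 1)%Z || ((2 ^ 2)%N %| - a - 1)%Z by lia.
  by case/orP=> h; [exists false|exists true]; rewrite ?expr0 ?mul1r ?expr1 ?mulN1r.
have [i hi] := @powers_generate 2 isT 5 1 2 _ isT (fun _ => isT) isT ex5
  (ex_intro _ 0%N hb) k.
exists b, i; apply: (@dvdz_trans (2 ^ (2 + k))%N%:Z); first by rewrite dvdzE dvdn_exp2l.
have -> : a - (-1) ^+ b * 5 ^+ i = (-1) ^+ b * ((-1) ^+ b * a - 5 ^+ i).
  by rewrite mulrBr mulrA -expr2 sqrr_sign mul1r.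
exact: dvdz_mull.
Qed.

(** A generator of the units modulo p generates at all levels once r^(p-1) - 1 has valuation exactly
    1. If a first choice r0 fails this, r0 + p does not. Since p > 2, r has order p - 1 > 1 modulo
    p, so r - 1 is prime to p. *)
Lemma exists_generator (p : nat) (p_pr : prime p) : p != 2%N ->
  exists r : nat, [/\ (1 < r)%N, ~~ (p %| r%:Z)%Z, ~~ (p %| r%:Z - 1)%Z &
    forall a : int, ~~ (p %| a)%Z -> forall k, exists i, ((p ^ k.+1)%N %| a - r%:Z ^+ i)%Z].
Proof.
move=> p2; have /cyclicP[g gE] : cyclic [set: {unit 'F_p}] by apply: field_unit_group_cyclic.
have og : #[g]%g = p.-1 by rewrite orderE -gE card_finField_unit card_Fp.
have p_gt2 : (2 < p)%N by rewrite ltn_neqAle eq_sym p2 prime_gt1.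
pose r0 : nat := (val g : 'F_p).
have r0E : r0%:R = val g :> 'F_p by rewrite /r0 natr_Zp.
have gU : val g != 0 by rewrite -unitfE; apply: (valP g).
have gX n : (val g) ^+ n = val (g ^+ n)%g.
  by elim: n => // n IH; rewrite exprS expgS IH.
have step (r : nat) : r%:R = val g :> 'F_p -> exact_pow p 1 (r%:Z ^+ p.-1 - 1) ->
  [/\ (1 < r)%N, ~~ (p %| r%:Z)%Z, ~~ (p %| r%:Z - 1)%Z &
    forall a : int, ~~ (p %| a)%Z -> forall k, exists i, ((p ^ k.+1)%N %| a - r%:Z ^+ i)%Z].
  move=> rE ex; have pr : ~~ (p %| r%:Z)%Z.
    by apply: contra gU => /(Fp_eq0 p_pr); rewrite -pmulrn rE => ->.
  have pr1 : ~~ (p %| r%:Z - 1)%Z.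
    apply/negP => /(Fp_eq0 p_pr); rewrite intrB -pmulrn rE => /eqP; rewrite subr_eq0 => /eqP e.
    have : g = 1%g by apply: val_inj.
    by move/eqP; rewrite -order_eq1 og; lia.
  split=> //.
    by case: r pr pr1 {rE ex} => [|[|r]] //; rewrite ?dvdz0 // subrr dvdz0.
  move=> a pa k; apply: (powers_generate p_pr (j0 := 1) _ _ pr ex) => //.
    by rewrite (negPf p2).
  have a0 : a%:~R != 0 :> 'F_p by apply: contra pa => /eqP /(Fp_eq0P p_pr).
  have ua : (a%:~R : 'F_p) \is a GRing.unit by rewrite unitfE.
  have : FinRing.unit 'F_p ua \in <[g]>%g by rewrite -gE inE.
  case/cycleP=> i /(congr1 val) /= e; exists i; rewrite expn1; apply: (Fp_eq0P p_pr).
  by rewrite intrB rmorphXn /= -pmulrn rE gX; apply/eqP; rewrite subr_eq0 e.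
have Fr : (p %| r0%:Z ^+ p.-1 - 1)%Z.
  apply: (Fp_eq0P p_pr); rewrite intrB rmorphXn /= -pmulrn r0E gX -og expg_order.
  exact: subrr.
have [|h] := boolP ((p ^ 2)%N %| r0%:Z ^+ p.-1 - 1)%Z; last first.
  exists r0; apply: step => //; have [d Ed] := dvdzP Fr; exists d;
    first by rewrite Ed expn1 mulrC.
  by apply: contra h; rewrite Ed -mulnn PoszM => h; apply: dvdz_mul.
move=> h; exists (r0 + p)%N; apply: step;
  first by rewrite natrD (pcharf0 (pchar_Fp p_pr)) addr0.
have [w Ew] := dvdzP h.
(* p S is the change of the (p-1)st power when r0 becomes r0 + p. Modulo p, S has p - 1 terms equal
   to r0^(p-2), so it is prime to p. *)
pose S := \sum_(i < p.-1) (r0 + p)%:Z ^+ (p.-1.-1 - i) * r0%:Z ^+ i.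
have ES : (r0 + p)%:Z ^+ p.-1 - r0%:Z ^+ p.-1 = p%:Z * S.
  by rewrite subrXX; congr (_ * _); rewrite PoszD addrAC subrr add0r.
exists (S + w * p%:Z).
  have -> : (r0 + p)%:Z ^+ p.-1 - 1 = p%:Z * S + (r0%:Z ^+ p.-1 - 1) by rewrite -ES; ring.
  by rewrite Ew expn1 -mulnn PoszM; ring.
have pS : ~~ (p %| S)%Z.
  apply/negP => /(Fp_eq0 p_pr); rewrite /S rmorph_sum /=.
  rewrite (eq_bigr (fun=> (val g) ^+ p.-1.-1)) => [|i _]; last first.
    rewrite rmorphM !rmorphXn /= -!pmulrn natrD (pcharf0 (pchar_Fp p_pr)) addr0 r0E -exprD subnK //.
    by have := ltn_ord i; lia.
  rewrite big_const_ord iter_addr_0 -mulr_natl => /eqP;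
    rewrite mulf_eq0 expf_eq0 (negPf gU) andbF orbF.
  by rewrite -(dvdn_pcharf (pchar_Fp p_pr)) gtnNdvd //; lia.
by apply: contra pS => hS; rewrite -(addrK (w * p%:Z) S) rpredB // dvdz_mull.
Qed.

(** * From invariance under generators to invariance under the finite groups *)

Section Transitivity.
Variables (p : nat) (p_pr : prime p) (K : (aff p -> aff p) -> Prop).
Local Notation cochain := (scochain 'F_p (aff p)).
Hypothesis K_trans : forall t, Ktrans p_pr t -> K t.
Hypothesis K_dil : forall k (a : int), ~~ (p %| a)%Z -> exists a' : int,
  [/\ ~~ (p %| a')%Z, ((p ^ k.+1)%N %| a - a')%Z &
   forall n (f : cochain), icochain (@lev p) K n f ->
     twist (aff_mul p_pr (dil p_pr a')) f = f].

(** Lift c to an affine map and replace its slope by a congruent one under which K-invariant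
    cochains are invariant; a cochain of level k does not notice the replacement. *)
Lemma icochain_transitive n k (f : cochain) : icochain (@lev p) K n f -> slev (@lev p) n k f ->
  forall c s s', (forall i, (i <= n)%N ->
    hol_of_aff p_pr k (s' i) = (c * hol_of_aff p_pr k (s i))%g) ->
  f s = f s'.
Proof.
move=> hf fk c s s' hs; have [x xc] := hol_of_aff_surj p_pr c.
have [a' [pa' da' ta']] := K_dil k (valP x).
have fT : twist (aff_mul p_pr (transl p_pr 1)) f = f.
  by have [_] := hf; apply; apply: K_trans; right.
have -> : f s = f (aff_mul p_pr (transl p_pr (shift x)) \o (aff_mul p_pr (dil p_pr a') \o s)).
  transitivity (twist (aff_mul p_pr (dil p_pr a')) f s); first by rewrite (ta' _ _ hf).
  exact: (congr1 (fun h => h _) (esym (twist_transl fT (shift x)))).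
apply: fk => i le_in /=; apply/(hol_of_aff_lev p_pr); rewrite hs // -xc -hol_of_affM.
apply/(hol_of_aff_lev p_pr); rewrite aff_mulA; apply: lev_mul (lev_refl _ _).
rewrite /lev !slopeM !shiftM slope_transl shift_transl slope_dil // shift_dil.
by rewrite mul1r mulr0 addr0 subrr dvdz0 andbT -opprB rpredN.
Qed.
End Transitivity.

(** * Presentations by generators and relations *)

Lemma gradedAlg_iso_sym (F : fieldType) (A B : gradedAlg F) :
  gradedAlg_iso A B -> gradedAlg_iso B A.
Proof.
move=> [phi [phi_bij phi1 phiM]].
have inv n : exists g, cancel (phi n) g /\ cancel g (phi n) by have [g] := phi_bij n; exists g.
pose g n := projT1 (cid (inv n)).
have gK n : cancel (phi n) (g n) by have [] := projT2 (cid (inv n)).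
have Kg n : cancel (g n) (phi n) by have [] := projT2 (cid (inv n)).
have g_lin n : linear (g n).
  by move=> a x y; apply: (can_inj (gK n)); rewrite linearP !Kg.
pose gl n : {linear B n -> A n} :=
  HB.pack (g n) (GRing.isLinear.Build F (B n) (A n) _ (g n) (g_lin n)).
exists gl; split=> [n||m n x y]; first by exists (phi n); [apply: Kg|apply: gK].
  by rewrite -phi1; apply: gK.
by apply: (can_inj (gK _)); rewrite phiM !Kg.
Qed.

(** * Evaluating polynomials at cocycles of degree 1 *)

Section Words.
Variables (F : fieldType) (X : Type) (lev : nat -> X -> X -> Prop) (K : (X -> X) -> Prop).
Hypothesis lev_refl : forall k x, lev k x x.
Hypothesis lev_le : forall j k x y, (j <= k)%N -> lev k x y -> lev j x y.
Variables (k : nat) (a : 'I_k -> scochain F X).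
Hypothesis aZ : forall i, scocycle lev K 1 (a i).
Hypothesis aC : forall i j, scobound lev K 2 (scup 1 (a i) (a j) - scup 1 (a j) (a i)).
Implicit Types (w : seq 'I_k).
Local Notation cochain := (scochain F X).
Local Notation scocycle := (scocycle lev K).
Local Notation scobound := (scobound lev K).

Definition wprod w : cochain := foldr (fun i f => scup 1 (a i) f) 1 w.

Lemma wprod_cat w w' : wprod (w ++ w') = scup (size w) (wprod w) (wprod w').
Proof.
elim: w => [|i w IH] /=; first by rewrite scup1l.
by rewrite IH scupA.
Qed.

Lemma scocycle_wprod w : scocycle (size w) (wprod w).
Proof.
elim: w => [|i w IH] /=; first exact: scocycle1.
exact: (scocycle_scup lev_refl lev_le (aZ i) IH).
Qed.

(** The letter i passes the letters of w one by one; each exchange costs a coboundary multiplied by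
    cocycles. *)
Lemma wprod_move i w w' :
  scobound (size (w ++ i :: w')) (wprod (w ++ i :: w') - wprod (i :: w ++ w')).
Proof.
elim: w => [|j w IH] /=; first by rewrite subrr; apply: scobound0.
rewrite (_ : _ - _ = scup 1 (a j) (wprod (w ++ i :: w') - wprod (i :: w ++ w')) +
  scup 2 (scup 1 (a j) (a i) - scup 1 (a i) (a j)) (wprod (w ++ w'))); last first.
  by rewrite scupBl linearB /= -!(@scupA _ _ 1 1) addrA subrK.
apply: (scoboundD lev_le); first exact: (scobound_scupl lev_refl lev_le (aZ j) IH).
rewrite size_cat /= addnS -[_.+2]/(2 + (size w + size w'))%N -size_cat.
exact: (scobound_scupr lev_refl lev_le (aC j i) (scocycle_wprod _)).
Qed.

Lemma wprod_perm w w' : perm_eq w w' -> scobound (size w) (wprod w - wprod w').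
Proof.
elim: w w' => [|i w IH] w' pw.
  have -> : w' = [::] by apply/nilP; rewrite /nilp -(perm_size pw).
  by rewrite subrr; apply: scobound0.
have iw' : i \in w' by rewrite -(perm_mem pw) inE eqxx.
case/splitPr: iw' pw => w1 w2 pw.
have pw' : perm_eq w (w1 ++ w2).
  by rewrite -(perm_cons i) (perm_trans pw) // perm_catC /= perm_cons perm_catC.
rewrite (_ : _ - _ = scup 1 (a i) (wprod w - wprod (w1 ++ w2)) -
  (wprod (w1 ++ i :: w2) - wprod (i :: w1 ++ w2))); last first.
  by rewrite linearB /= opprB addrA subrK.
apply: (scoboundB lev_le); first exact: (scobound_scupl lev_refl lev_le (aZ i) (IH _ pw')).
by rewrite (perm_size pw); apply: wprod_move.
Qed.

(** The monomial with its letters sorted: cochains do not commute, so an order must be fixed to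
    evaluate it. *)
Definition mword (m : 'X_{1..k}) : seq 'I_k := flatten [seq nseq (m i) i | i <- enum 'I_k].

Lemma size_mword m : size (mword m) = mdeg m.
Proof.
rewrite size_flatten /shape -map_comp sumnE big_map big_enum /= mdegE.
by apply: eq_bigr => i _; rewrite size_nseq.
Qed.

Lemma count_mword m i : count_mem i (mword m) = m i.
Proof.
rewrite count_flatten -map_comp sumnE big_map big_enum /= (bigD1 i) //= count_nseq /= eqxx mul1n.
rewrite big1 ?addn0 // => j ji; by rewrite count_nseq /= (negPf ji).
Qed.

Lemma mwordD m m' : perm_eq (mword (m + m')) (mword m ++ mword m').
Proof.
by rewrite /perm_eq; apply/allP => i _ /=; rewrite count_cat !count_mword mnmDE.
Qed.

(* The monomials of degree other than n are ignored. *)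
Definition meval n (q : {mpoly F[k]}) : cochain :=
  \sum_(m : 'X_{1..k < n.+1} | mdeg m == n) q@_m *: wprod (mword m).

Lemma meval_lin n : linear (meval n).
Proof.
move=> c q r; rewrite /meval scaler_sumr -big_split; apply: eq_bigr => m _ /=.
by rewrite mcoeffD mcoeffZ scalerA scalerDl.
Qed.
HB.instance Definition _ n :=
  GRing.isLinear.Build F {mpoly F[k]} cochain _ (meval n) (meval_lin n).

Lemma scocycle_meval n q : scocycle n (meval n q).
Proof.
apply: (scocycle_sum lev_le) => m /eqP dm; apply: (scocycleZ lev_le).
by rewrite -[in X in scocycle X]dm -size_mword; apply: scocycle_wprod.
Qed.

Lemma mevalX m : meval (mdeg m) 'X_[m] = wprod (mword m).
Proof.
rewrite /meval (bigD1 (BMultinom (ltnSn (mdeg m)))) //= mcoeffX eqxx scale1r.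
rewrite big1 ?addr0 // => m' /andP[_ nm]; rewrite mcoeffX.
case: eqP => [e|_]; last by rewrite scale0r.
by case/negP: nm; apply/eqP/val_inj.
Qed.

Lemma meval1 : meval 0 1 = 1.
Proof.
have := mevalX 0%MM; rewrite mdeg0 mpolyX0 => ->.
by have /eqP := size_mword 0%MM; rewrite mdeg0 => /nilP ->.
Qed.

Lemma meval_dhomog0 n d q : q \is d.-homog -> d != n -> meval n q = 0.
Proof.
move=> hq dn; rewrite /meval big1 // => m /eqP dm.
by rewrite (dhomog_nemf_coeff hq) ?scale0r //= dm eq_sym.
Qed.

Lemma mpoly_lin_ind (P : {mpoly F[k]} -> Prop) : P 0 ->
  (forall c q r, P q -> P r -> P (c *: q + r)) ->
  forall q, (forall m, m \in msupp q -> P 'X_[m]) -> P q.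
Proof.
move=> P0 Plin q hq; rewrite [q]mpolyE big_seq; elim/big_ind: _ => //.
  by move=> x y hx hy; rewrite -[x]scale1r; apply: Plin.
by move=> m /hq hm; rewrite -[_ *: _]addr0; apply: Plin.
Qed.

(** By bilinearity this reduces to monomials, where the concatenation of two sorted words is a
    permutation of the sorted word of the product. *)
Lemma mevalM m n q r : q \is m.-homog -> r \is n.-homog ->
  scobound (m + n) (meval (m + n) (q * r) - scup m (meval m q) (meval n r)).
Proof.
move=> /dhomogP hq /dhomogP hr; apply: (@mpoly_lin_ind (fun q =>
  scobound (m + n) (meval (m + n) (q * r) - scup m (meval m q) (meval n r))) _ _ q).
- by rewrite mul0r !linear0 scup0l subr0; apply: scobound0.
- move=> c {hq}q q' IH IH'.
  rewrite mulrDl -scalerAl (_ :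
    meval _ (_ + _) = c *: meval (m + n) (q * r) + meval (m + n) (q' * r));
      last exact: linearP.
  rewrite (_ : meval m _ = c *: meval m q + meval m q'); last exact: linearP.
  rewrite scupDl scupZl.
  rewrite (_ : _ - _ = c *: (meval (m + n) (q * r) - scup m (meval m q) (meval n r)) +
    (meval (m + n) (q' * r) - scup m (meval m q') (meval n r))).
    exact: (scoboundP lev_le).
  by rewrite scalerBr opprD addrACA.
move=> m1 /hq; rewrite -[LHS]/(mdeg m1) => dm1; apply: (@mpoly_lin_ind (fun r =>
  scobound (m + n) (meval (m + n) ('X_[m1] * r) - scup m (meval m 'X_[m1]) (meval n r))) _ _ r).
- by rewrite mulr0 !linear0 ?subr0 ?addr0; apply: scobound0.
- move=> c {r hr}q' r IH IH'.
  rewrite mulrDr -scalerAr (_ :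
    meval _ (_ + _) = c *: meval (m + n) ('X_[m1] * q') + meval (m + n) ('X_[m1] * r));
      last exact: linearP.
  rewrite (_ : meval n _ = c *: meval n q' + meval n r); last exact: linearP.
  rewrite (_ : scup m _ _ = c *: scup m (meval m 'X_[m1]) (meval n q') + scup m (meval m 'X_[m1]) (meval n r)); last exact: linearP.
  rewrite (_ : _ - _ = c *: (meval (m + n) ('X_[m1] * q') - scup m (meval m 'X_[m1]) (meval n q')) +
    (meval (m + n) ('X_[m1] * r) - scup m (meval m 'X_[m1]) (meval n r))).
    exact: (scoboundP lev_le).
  by rewrite scalerBr opprD addrACA.
move=> m2 /hr; rewrite -[LHS]/(mdeg m2) => dm2; subst m n.
rewrite -mpolyXD -mdegD !mevalX -(size_mword m1) -wprod_cat -size_mword.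
exact: (wprod_perm (mwordD m1 m2)).
Qed.

End Words.

(** * Presentations deduced from bases of cocycles *)

Section FromCocycles.
Variables (F : fieldType) (X : Type) (lev : nat -> X -> X -> Prop) (K : (X -> X) -> Prop).
Hypothesis lev_refl : forall k x, lev k x x.
Hypothesis lev_le : forall j k x y, (j <= k)%N -> lev k x y -> lev j x y.
Local Notation cochain := (scochain F X).
Local Notation scocycle := (scocycle lev K).
Local Notation scobound := (scobound lev K).

Variables (H : gradedAlg F) (cls : forall n, cochain -> H n).
Hypothesis clsP : forall n a f g, scocycle n f -> scocycle n g ->
  cls n (a *: f + g) = a *: cls n f + cls n g.
Hypothesis cls_eq0 : forall n f, scocycle n f -> cls n f = 0 <-> scobound n f.
Hypothesis cls_surj : forall n (c : H n), exists2 f, scocycle n f & cls n f = c.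

Lemma cls_congr n f g : scocycle n f -> scocycle n g -> scobound n (f - g) ->
  cls n f = cls n g.
Proof.
move=> hf hg hb; rewrite -[f](subrK g) -[f - g]scale1r clsP //.
  by have [_ ->] := cls_eq0 (scocycleB lev_le hf hg); rewrite // scaler0 add0r.
exact: (scocycleB lev_le).
Qed.

Lemma cls0 n : cls n 0 = 0.
Proof. by apply/cls_eq0; [exact: scocycle0|exact: scobound0]. Qed.

Lemma cls_lcomb n e c : (forall i, (i < size e)%N -> scocycle n e`_i) ->
  cls n (lcomb e c) = lcomb (map (cls n) e) c.
Proof.
elim: e c => [|f e IH] c he; first by rewrite !lcomb_nil cls0.
rewrite -cat1s map_cat !lcomb_cat !lcomb_seq1 clsP /=.
- by rewrite IH // => i hi; apply: (he i.+1).
- exact: (he 0%N).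
- by apply: (scocycle_lcomb lev_le) => i hi; apply: (he i.+1).
Qed.

Variable es : nat -> seq cochain.
Hypothesis es_basis : forall n, coh_basis lev K n (es n).

Lemma has_dim_cls n : has_dim (H n) (size (es n)).
Proof.
have [es_coc es_span es_free] := es_basis n.
have E (c : nat -> F) : \sum_(i < size (es n)) c i *: cls n (es n)`_i = cls n (lcomb (es n) c).
  rewrite cls_lcomb // /lcomb size_map; apply: eq_bigr => i _.
  by rewrite (nth_map 0).
(* Extension by 0 beyond the indices of the basis. *)
pose cf (c : {ffun 'I_(size (es n)) -> F}) (i : nat) : F := odflt 0 (omap c (insub i)).
have cfE c (i : 'I_(size (es n))) : cf c i = c i by rewrite /cf valK.
exists (fun i => cls n (es n)`_i) => v; have [f hf <-] := cls_surj v.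
have [c hc] := es_span f hf; exists [ffun i : 'I__ => c i]; split.
  under eq_bigr => i _ do rewrite ffunE.
  by rewrite E; apply: cls_congr => //; apply: scocycle_lcomb.
move=> d hd; apply/ffunP => i; rewrite ffunE.
apply/eqP; rewrite -subr_eq0; apply/eqP; rewrite -(cfE d i).
have -> : c i - cf d i = - 1 * cf d i + c i by ring.
apply: (es_free (fun i => - 1 * cf d i + c i) _ i) => //; rewrite lcombP.
have zd := scocycle_lcomb lev_le (cf d) es_coc; have zc := scocycle_lcomb lev_le c es_coc.
apply/cls_eq0; first exact: (scocycleP lev_le).
rewrite clsP // scaleN1r addrC; apply/eqP; rewrite subr_eq0; apply/eqP.
transitivity (cls n f); first by apply/esym/cls_congr.
by rewrite hd -E; apply: eq_bigr => j _; rewrite cfE.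
Qed.

Hypothesis clsM : forall m n f g, scocycle m f -> scocycle n g ->
  cls (m + n) (scup m f g) = gmul (cls m f) (cls n g).
Hypothesis cls1 : cls 0 1 = gone H.

Variables (k : nat) (rels : seq {mpoly F[k]}) (a : 'I_k -> cochain).
Hypothesis aZ : forall i, scocycle 1 (a i).
Hypothesis aC : forall i j, scobound 2 (scup 1 (a i) (a j) - scup 1 (a j) (a i)).
Hypothesis rels2 : forall i, (i < size rels)%N -> rels`_i \is 2.-homog.
Hypothesis rels0 : forall i, (i < size rels)%N -> scobound 2 (meval a 2 rels`_i).
Variable bs : nat -> seq {mpoly F[k]}.
Hypothesis size_bs : forall n, size (bs n) = size (es n).
Hypothesis bs_homog : forall n i, (i < size (bs n))%N -> (bs n)`_i \is n.-homog.
Hypothesis bs_es : forall n i, (i < size (bs n))%N ->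
  scobound n (meval a n (bs n)`_i - (es n)`_i).
Hypothesis bs_span : forall n q, q \is n.-homog ->
  exists c, in_ideal rels (q - lcomb (bs n) c).

Lemma meval_ideal n q : in_ideal rels q -> scobound n (meval a n q).
Proof.
move=> [c ->]; rewrite linear_sum; apply: (scobound_sum lev_le) => i _ /=.
have [ri zi] := (rels2 (ltn_ord i), rels0 (ltn_ord i)).
apply: (@mpoly_lin_ind F k (fun q => scobound n (meval a n (q * rels`_i)))).
- by rewrite mul0r linear0; apply: scobound0.
- move=> b q' r h h'; rewrite mulrDl -scalerAl linearP; exact: (scoboundP lev_le).
move=> m _; have hm : ('X_[m] : {mpoly F[k]}) \is (mdeg m).-homog by rewrite dhomogX.
have [e|ne] := eqVneq (mdeg m + 2)%N n; last first.
  by rewrite (meval_dhomog0 _ (dhomogM hm ri) ne); apply: scobound0.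
rewrite -e -[meval _ _ _](subrK (scup (mdeg m) (meval a (mdeg m) 'X_[m]) (meval a 2 rels`_i))).
apply: (scoboundD lev_le); first exact: (mevalM lev_refl lev_le aZ aC).
by apply: (scobound_scupl lev_refl lev_le) => //; apply: (scocycle_meval lev_refl lev_le).
Qed.

Local Notation P := (presentedAlg rels).
Local Notation pcls n := (@sqcls F _ (homog_sub F k n) (ideal_sub rels n)).
Let mZ n q : scocycle n (meval a n q) := scocycle_meval lev_refl lev_le aZ n q.

Definition psi n (c : P n) : H n := cls n (meval a n (sqrep c)).

Lemma psi_cls n q : q \is n.-homog -> psi (pcls n q : P n) = cls n (meval a n q).
Proof.
move=> hq; apply: cls_congr => //; rewrite -linearB /=; apply: meval_ideal.
exact: (sqrep_cls (Z := homog_sub F k n) (ideal_sub rels n) hq).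
Qed.

Lemma presented_cls n (c : P n) : exists2 q : {mpoly F[k]}, q \is n.-homog & c = pcls n q.
Proof. by exists (sqrep c); [exact: (sqrepP c)|rewrite [RHS]sqrepK]. Qed.

Lemma psi_lin n : linear (@psi n).
Proof.
move=> b c d; have [q hq ->] := presented_cls c; have [r hr ->] := presented_cls d.
rewrite -[X in psi X](sqclsP (Z := homog_sub F k n) (ideal_sub rels n) b hq hr).
rewrite !psi_cls //; last exact: Defs.homogP.
rewrite (_ : meval a n _ = b *: meval a n q + meval a n r); last exact: linearP.
exact: clsP.
Qed.

Lemma lcomb_homog n c : lcomb (bs n) c \is n.-homog.
Proof. by apply: rpred_sum => i _; rewrite rpredZ // bs_homog. Qed.

Lemma meval_lcomb n c : scobound n (meval a n (lcomb (bs n) c) - lcomb (es n) c).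
Proof.
rewrite /lcomb linear_sum size_bs -sumrB; apply: (scobound_sum lev_le) => i _.
rewrite linearZ /= -scalerBr; apply: (scoboundZ lev_le); apply: bs_es.
by rewrite size_bs.
Qed.

(** It is enough that the polynomials [bs] span modulo the relations and evaluate to the basis [es]:
    their independence in the presented algebra follows from that of their values. *)
Lemma psi_bij n : bijective (@psi n).
Proof.
have [es_coc es_span es_free] := es_basis n.
have zes c := scocycle_lcomb lev_le c es_coc.
have psi_inj : injective (@psi n).
  suff psi0 (c : P n) : psi c = 0 -> c = 0.
    move=> c d e; apply/eqP; rewrite -subr_eq0 -scaleN1r addrC; apply/eqP/psi0.
    by rewrite psi_lin e scaleN1r addNr.
  have [q hq ->] := presented_cls c; rewrite psi_cls //.
  have [b hb] := bs_span hq => /(cls_eq0 (mZ _ _)) q0.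
  have b0 i : (i < size (bs n))%N -> b i = 0.
    rewrite size_bs; apply: es_free.
    rewrite (_ : lcomb _ _ = meval a n q - meval a n (q - lcomb (bs n) b) -
      (meval a n (lcomb (bs n) b) - lcomb (es n) b)).
      apply: (scoboundB lev_le); last exact: meval_lcomb.
      by apply: (scoboundB lev_le) => //; apply: meval_ideal.
    rewrite (_ : meval a n (_ - _) = meval a n q - meval a n (lcomb (bs n) b));
      last exact: linearB.
    by apply/funext => s; rewrite !(scochainD, scochainN); ring.
  have z0 : homog_sub F k n (0 : {mpoly F[k]}) by apply: homog0.
  transitivity (pcls n (0 : {mpoly F[k]})).
    apply/(sqcls_eq (Z := homog_sub F k n) (ideal_sub rels n) hq z0).
    move: hb; rewrite (eq_lcomb (c' := fun=> 0)) // lcomb0 subr0 => h.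
    exact: h.
  have := sqclsP (Z := homog_sub F k n) (ideal_sub rels n) 1 z0 z0.
  rewrite !scale1r addr0 => e; apply: (addrI (pcls n (0 : {mpoly F[k]}))).
  by rewrite -[LHS]e addr0.
have psi_surj (v : H n) : exists c : P n, psi c = v.
  have [f hf <-] := cls_surj v; have [c hc] := es_span f hf.
  exists (pcls n (lcomb (bs n) c)); rewrite psi_cls ?lcomb_homog //.
  apply: cls_congr => //; rewrite -[_ - f](subrK (lcomb (es n) c)) -addrA.
  rewrite (_ : _ + _ = (meval a n (lcomb (bs n) c) - lcomb (es n) c) - (f - lcomb (es n) c)).
    by apply: (scoboundB lev_le) => //; apply: meval_lcomb.
  by rewrite opprB addrA; apply/funext => s; rewrite !(scochainD, scochainN); ring.
exists (fun v => projT1 (cid (psi_surj v))) => [c|v].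
  by apply: psi_inj; case: (cid _).
by case: (cid _).
Qed.

Lemma presented_iso : gradedAlg_iso H P.
Proof.
apply: gradedAlg_iso_sym.
pose psil n : {linear P n -> H n} :=
  HB.pack (@psi n) (GRing.isLinear.Build F (P n) (H n) _ (@psi n) (@psi_lin n)).
exists psil; split=> [n||m n c d]; first exact: psi_bij.
  rewrite -cls1 -[LHS]/(psi (pcls 0%N (1 : {mpoly F[k]}))) psi_cls; last exact: dhomog1.
  by rewrite meval1.
have [q hq ->] := presented_cls c; have [r hr ->] := presented_cls d.
have E := @sq_mul_cls F _ (presentation_pair rels) m n q r hq hr.
rewrite -[LHS]/(psi (@gmul F P m n (pcls m q) (pcls n r))) -[@gmul F P m n _ _]/(sq_mul _ _) E.
rewrite -![psil _ _]/(psi _) !psi_cls //; last exact: dhomogM.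
rewrite -clsM //; apply: cls_congr => //; last exact: (mevalM lev_refl lev_le aZ aC).
exact: (scocycle_scup lev_refl lev_le).
Qed.

End FromCocycles.

(** * Spanning sets modulo the relations *)

Section Span.
Variables (F : fieldType) (k : nat) (rels : seq {mpoly F[k]}) (bs : nat -> seq {mpoly F[k]}).
Local Notation I := (in_ideal rels).

Definition spanned n q := exists c, I (q - lcomb (bs n) c).

Lemma spannedP n b q r : spanned n q -> spanned n r -> spanned n (b *: q + r).
Proof.
move=> [c hc] [d hd]; exists (fun i => b * c i + d i); rewrite lcombP.
rewrite (_ : _ - _ = b *: (q - lcomb (bs n) c) + (r - lcomb (bs n) d)); first exact: in_idealP.
by rewrite scalerBr opprD addrACA.
Qed.

Lemma spanned_ideal n q : I q -> spanned n q.
Proof. by exists (fun=> 0); rewrite lcomb0 subr0. Qed.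

Lemma spannedD n q r : spanned n q -> spanned n r -> spanned n (q + r).
Proof. by move=> hq; rewrite -[q]scale1r; apply: spannedP. Qed.

Lemma spanned0 n : spanned n 0.
Proof. by apply/spanned_ideal/in_ideal0. Qed.

Lemma spanned_lcomb n c : spanned n (lcomb (bs n) c).
Proof. by exists c; rewrite subrr; apply: in_ideal0. Qed.

Lemma spanned_mem n i : (i < size (bs n))%N -> spanned n (bs n)`_i.
Proof.
move=> hi; suff -> : (bs n)`_i = lcomb (bs n) (fun j => (j == i)%:R) by apply: spanned_lcomb.
rewrite /lcomb (bigD1 (Ordinal hi)) //= eqxx scale1r big1 ?addr0 // => j.
by rewrite -val_eqE /= => /negPf ->; rewrite scale0r.
Qed.

Lemma in_ideal_mem i : (i < size rels)%N -> I rels`_i.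
Proof.
move=> hi; exists (fun j => (j == i)%:R).
rewrite (bigD1 (Ordinal hi)) //= eqxx mul1r big1 ?addr0 // => j.
by rewrite -val_eqE /= => /negPf ->; rewrite mul0r.
Qed.

Lemma spannedM n f q : (forall i, (i < size (bs n))%N -> spanned n.+1 (f * (bs n)`_i)) ->
  spanned n q -> spanned n.+1 (f * q).
Proof.
move=> hf [c hc]; rewrite -[q](subrK (lcomb (bs n) c)) mulrDr; apply: spannedD.
  by apply/spanned_ideal/in_idealM.
rewrite mulr_sumr; elim/big_ind: _ => //; first exact: spanned0.
  by move=> *; apply: spannedD.
by move=> i _; rewrite -scalerAr -[_ *: _]addr0; apply: spannedP (spanned0 _); apply: hf.
Qed.

Lemma homog_spanned : spanned 0 1 ->
  (forall n i j, (i < size (bs n))%N -> spanned n.+1 ('X_j * (bs n)`_i)) ->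
  forall n q, q \is n.-homog -> spanned n q.
Proof.
move=> s1 sX n q /dhomogP hq; apply: (@mpoly_lin_ind F k (spanned n)); first exact: spanned0.
  by move=> *; apply: spannedP.
move=> m /hq; rewrite -[LHS]/(mdeg m); elim: n m {q hq} => [|n IH] m dm.
  by move/eqP: dm; rewrite mdeg_eq0 => /eqP ->; rewrite mpolyX0.
have [j hj] : exists j, (0 < m j)%N.
  apply/existsP; rewrite -[X in is_true X]negbK negb_exists; apply/negP => /forallP h.
  move: dm; rewrite mdegE big1 // => i _; by apply/eqP; rewrite -leqn0 leqNgt h.
have le_jm : (U_(j) <= m)%MM.
  by apply/mnm_lepP => i; rewrite mnm1E; case: eqP => // <-.
rewrite -(submK le_jm) addmC mpolyXD; apply: spannedM => [i hi|]; first exact: sX.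
apply: IH; have := dm; rewrite -{1}(submK le_jm) mdegD mdeg1 addn1; by case.
Qed.
End Span.

Lemma meval_mpolyX (F : fieldType) (X : Type) (k : nat) (a : 'I_k -> scochain F X) i :
  meval a 1 'X_i = a i.
Proof.
have E : mword U_(i)%MM = [:: i].
  have := size_mword U_(i)%MM; have := count_mword U_(i)%MM i.
  rewrite mdeg1 mnm1E eqxx; case: (mword _) => [|j [|]] //=.
  by rewrite addn0; case: eqP => // ->.
by have := mevalX a U_(i)%MM; rewrite mdeg1 E /= scup1r.
Qed.

(** * Application to the tower of holomorphs *)

Section Colim.
Variables (p : nat) (p_pr : prime p) (K : (aff p -> aff p) -> Prop).
Local Notation lev := (@lev p).
Local Notation cochain := (scochain 'F_p (aff p)).
Local Notation D a := (aff_mul p_pr (dil p_pr a)).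
Hypothesis K_trans : forall t, Ktrans p_pr t -> K t.
Hypothesis K_mul : forall t, K t -> exists c, t = aff_mul p_pr c.
Hypothesis K_dil : forall k (a : int), ~~ (p %| a)%Z -> exists a' : int,
  [/\ ~~ (p %| a')%Z, ((p ^ k.+1)%N %| a - a')%Z &
   forall n (f : cochain), icochain lev K n f -> twist (D a') f = f].

Definition hol_cls n (f : cochain) : contCohomology 'F_p (hol_tower p_pr) n :=
  kappa (F := 'F_p) (G := hol_tower p_pr) (hol_of_aff p_pr) n f.

Let pi_surj := hol_of_aff_surj p_pr.
Let pi_lev k x y := proj1 (hol_of_aff_lev p_pr k x y).
Let pi_tmap := hol_of_aff_tmap p_pr.
Lemma hol_of_aff_K t : K t -> forall k, exists c : hol_tower p_pr k,
  forall x, hol_of_aff p_pr k (t x) = (c * hol_of_aff p_pr k x)%g.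
Proof. by move=> /K_mul[c ->] k; exists (hol_of_aff p_pr k c) => x; apply: hol_of_affM. Qed.
Let trans := icochain_transitive K_trans K_dil.

Lemma hol_cls_eq0 n f : scocycle lev K n f -> hol_cls n f = 0 <-> scobound lev K n f.
Proof. exact: (kappa_eq0 (G := hol_tower p_pr) (pi :=
  hol_of_aff p_pr) pi_surj pi_lev pi_tmap hol_of_aff_K trans). Qed.
Lemma hol_clsP n a f g : scocycle lev K n f -> scocycle lev K n g ->
  hol_cls n (a *: f + g) = a *: hol_cls n f + hol_cls n g.
Proof. exact: (kappaP (G := hol_tower p_pr) (pi := hol_of_aff p_pr) pi_surj pi_tmap trans).
  Qed.
Lemma hol_clsM m n f g : scocycle lev K m f -> scocycle lev K n g ->
  hol_cls (m + n) (scup m f g) = gmul (hol_cls m f) (hol_cls n g).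
Proof. exact: (kappaM (G := hol_tower p_pr) (pi := hol_of_aff p_pr) pi_surj pi_tmap trans).
  Qed.
Lemma hol_cls_surj n c : exists2 f, scocycle lev K n f & hol_cls n f = c.
Proof. exact: (kappa_surj (G := hol_tower p_pr) (pi :=
  hol_of_aff p_pr) pi_surj pi_lev pi_tmap hol_of_aff_K). Qed.
Lemma hol_cls1 : hol_cls 0 1 = gone (contCohomology 'F_p (hol_tower p_pr)).
Proof. exact: (kappa1 _ (G := hol_tower p_pr) (pi := hol_of_aff p_pr) pi_surj pi_tmap). Qed.

Definition contCohomology_has_dim es :=
  has_dim_cls (@lev_le p) hol_clsP hol_cls_eq0 hol_cls_surj (es := es).
Definition contCohomology_presented es es_basis k rels a :=
  @presented_iso _ _ _ _ (@lev_refl p) (@lev_le p) _ _ hol_clsP hol_cls_eq0 hol_cls_surj es es_basis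
    hol_clsM hol_cls1 k rels a.
End Colim.

Lemma twist_dilM p (p_pr : prime p) (a b : int) (f : scochain 'F_p (aff p)) :
  ~~ (p %| a)%Z -> ~~ (p %| b)%Z ->
  twist (aff_mul p_pr (dil p_pr a)) f = f -> twist (aff_mul p_pr (dil p_pr b)) f = f ->
  twist (aff_mul p_pr (dil p_pr (a * b))) f = f.
Proof.
move=> pa pb ta tb; have pab : ~~ (p %| a * b)%Z by rewrite dvdzM_prime // negb_or pa.
rewrite -[RHS]tb -[in RHS]ta; apply/funext => s; congr f; apply/funext => i /=.
by apply: aff_eq; rewrite !(slopeM, shiftM) !slope_dil // ?shift_dil; ring.
Qed.

Lemma twist_dilX p (p_pr : prime p) (a : int) i (f : scochain 'F_p (aff p)) :
  ~~ (p %| a)%Z -> twist (aff_mul p_pr (dil p_pr a)) f = f ->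
  ~~ (p %| a ^+ i)%Z /\ twist (aff_mul p_pr (dil p_pr (a ^+ i))) f = f.
Proof.
move=> pa ta; elim: i => [|i [pai tai]].
  have p1 : ~~ (p %| 1)%Z by rewrite dvdzE dvdn1 gtn_eqF // prime_gt1.
  split=> //; apply/funext => s; congr f; apply/funext => i /=.
  by apply: aff_eq; rewrite !(slopeM, shiftM) !slope_dil // ?shift_dil ?mul1r ?add0r.
by rewrite exprS dvdzM_prime // negb_or pa; split=> //; apply: twist_dilM.
Qed.

(** * The theorem *)

Section OddPrime.
Variables (p : nat) (p_pr : prime p).
Local Notation cochain := (scochain 'F_p (aff p)).
Local Notation lev := (@lev p).

Lemma contCohomology_odd : p != 2%N ->
  gradedAlg_iso (contCohomology 'F_p (hol_tower p_pr)) (exteriorAlg1 'F_p).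
Proof.
move=> p2; have [r [r_gt1 pr pr1 rgen]] := exists_generator p_pr p2.
pose K := Kdil p_pr r.
have K_trans t : Ktrans p_pr t -> K t by left.
have K_mul t : K t -> exists c, t = aff_mul p_pr c.
  by move=> [[//|->]|->]; [exists (transl p_pr 1)|exists (dil p_pr r)].
have K_dil k (a : int) : ~~ (p %| a)%Z -> exists a' : int,
    [/\ ~~ (p %| a')%Z, ((p ^ k.+1)%N %| a - a')%Z &
    forall n (f : cochain), icochain lev K n f -> twist (aff_mul p_pr (dil p_pr a')) f = f].
  move=> pa; have [i hi] := rgen a pa k; exists (r%:Z ^+ i).
  have X f := @twist_dilX p p_pr r i f pr; split=> //.
    (* The zero cochain is fixed by every twist, so it isolates the statement on divisibility. *)
    by have [] := X 0 (linear0 _).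
  by move=> n f [_ hf]; have [] := X f (hf _ (or_intror erefl)).
have [x [b1 b2]] := coh_basis_dil_odd p_pr r_gt1 pr pr1.
have b0 := coh_basis_dil0 p_pr r.
pose es n : seq cochain := match n with 0%N => [:: 1] | 1%N => [:: x] | _ => [::] end.
pose bs n : seq {mpoly 'F_p[1]} := match n with 0%N => [:: 1] | 1%N => [:: 'X_0] | _ =>
  [::] end.
have es_basis n : coh_basis lev K n (es n).
  by case: n => [|[|n]]; [exact: b0|exact: b1|exact: b2].
have xZ : scocycle lev K 1 x by have [h _ _] := b1; apply: (h 0%N).
pose rels : seq {mpoly 'F_p[1]} := [:: 'X_0 ^+ 2].
have hX : ('X_0 : {mpoly 'F_p[1]}) \is 1.-homog by rewrite dhomogX; apply/eqP/mdeg1.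
apply: (contCohomology_presented K_trans K_mul K_dil es_basis (rels := rels) (a := fun=> x)
  _ _ _ _ (bs := bs) _ _ _ _).
- by [].
- by move=> i j; rewrite subrr; apply: scobound0.
- by case=> //= _; rewrite expr2; apply: (dhomogM hX hX).
(* The relation x^2 = 0 holds because the cohomology vanishes in degree 2. *)
- case=> //= _; have [_ span _] := b2 0%N.
  have hz : scocycle lev K 2 (meval (fun=> x) 2 ('X_0 ^+ 2 : {mpoly 'F_p[1]})).
    by apply: (scocycle_meval (@lev_refl p) (@lev_le p)).
  by have [c] := span _ hz; rewrite lcomb_nil subr0.
- by case=> [|[|n]].
- by case=> [|[|n]] [|i] //= _; apply: dhomog1.
- case=> [|[|n]] [|i] //= _; first by rewrite meval1 subrr; apply: scobound0.
  by rewrite meval_mpolyX subrr; apply: scobound0.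
apply: homog_spanned; first exact: (@spanned_mem _ _ _ bs 0%N 0%N).
move=> [|[|n]] [|i] j //= _; rewrite (ord1 j).
  by rewrite mulr1; apply: (@spanned_mem _ _ _ bs 1%N 0%N).
by rewrite -expr2; apply/spanned_ideal/(@in_ideal_mem _ _ rels 0%N).
Qed.
End OddPrime.

(** * The case p = 2 *)

Section PrimeTwo.
Variables (p_pr : prime 2).
Local Notation F := 'F_2.
Local Notation cochain := (scochain F (aff 2)).
Local Notation lev := (@lev 2).
Local Notation K := (Kall2 p_pr).

Let K_trans t : Ktrans p_pr t -> K t. Proof. by left; left. Qed.
Let K_mul t : K t -> exists c, t = aff_mul p_pr c.
Proof.
by move=> [[[//|->]|->]|->];
  [exists (transl p_pr 1)|exists (dil p_pr 5)|exists (dil p_pr (-1))].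
Qed.
Let K_dil k (a : int) : ~~ (2 %| a)%Z -> exists a' : int,
  [/\ ~~ (2 %| a')%Z, ((2 ^ k.+1)%N %| a - a')%Z &
   forall n (f : cochain), icochain lev K n f -> twist (aff_mul p_pr (dil p_pr a')) f = f].
Proof.
move=> pa; have [b [i hi]] := powers_of_5 k pa; exists ((-1) ^+ b * 5 ^+ i).
have X5 f := @twist_dilX 2 p_pr 5 i f isT; have XN f := @twist_dilX 2 p_pr (-1) b f isT.
have [[p5 _] [pN _]] := (X5 0 (linear0 _), XN 0 (linear0 _)).
split=> //; first by rewrite dvdzM_prime // negb_or pN.
move=> n f [_ hf]; apply: twist_dilM => //.
  by have [] := XN f (hf _ (or_intror erefl)).
by have [] := X5 f (hf _ (or_introl (or_intror erefl))).
Qed.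

Lemma contCohomology2_has_dim n :
  has_dim (contCohomology F (hol_tower p_pr) n) (size (basis2 n)).
Proof. exact: (contCohomology_has_dim K_trans K_mul K_dil (coh_basis2 p_pr)). Qed.

Local Notation gx := ('X_0 : {mpoly F[3]}).
Local Notation gu := ('X_1 : {mpoly F[3]}).
Local Notation gy := ('X_2 : {mpoly F[3]}).

Definition rels2 : seq {mpoly F[3]} := [:: gx ^+ 2; gu ^+ 2 - (gu * gx + gu * gy)].

(* coc_y is the value of x + y: up to coboundaries, u^2 = u coc_y. *)
Definition gens2 (i : 'I_3) : cochain := [:: coc_x; @coc_u 2; coc_y + coc_x]`_i.

Definition polys_ext (n : nat) : seq {mpoly F[3]} :=
  match n with 1%N => [:: gu; gx] | 2%N => [:: gx * gu] | _ => [::] end.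
Fixpoint polys2 (n : nat) : seq {mpoly F[3]} :=
  if n is m.+1 then polys_ext m.+1 ++ map ( *%R (gx + gy)) (polys2 m) else [:: 1].

Lemma homogX (i : 'I_3) : ('X_i : {mpoly F[3]}) \is 1.-homog.
Proof. by rewrite dhomogX; apply/eqP/mdeg1. Qed.

Lemma gens2_cocycle i : scocycle lev K 1 (gens2 i).
Proof.
have hx := scocycle2_x p_pr; have hu := scocycle2_u p_pr; have hy := scocycle2_y p_pr.
case: i => [[|[|[|//]]] hi] //; exact: (scocycleD (@lev_le 2)).
Qed.

Lemma scup11_comm2 (f g : cochain) : scocycle lev K 1 f -> scocycle lev K 1 g ->
  scobound lev K 2 (scup 1 f g - scup 1 g f).
Proof. by move=> hf hg; rewrite (cochain2_opp p_pr);
  apply: (scup11_comm (@lev_refl 2) (@lev_le 2)). Qed.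

Lemma meval_mul2 (i j : 'I_3) :
  scobound lev K 2 (meval gens2 2 ('X_i * 'X_j) - scup 1 (gens2 i) (gens2 j)).
Proof.
have := mevalM (@lev_refl 2) (@lev_le 2) gens2_cocycle
  (fun i j => scup11_comm2 (gens2_cocycle i) (gens2_cocycle j)) (homogX i) (homogX j).
by rewrite !meval_mpolyX.
Qed.

Lemma rels2_cobound i : (i < size rels2)%N -> scobound lev K 2 (meval gens2 2 rels2`_i).
Proof.
have hx := scocycle2_x p_pr; have hu := scocycle2_u p_pr; have hy := scocycle2_y p_pr.
case: i => [|[|//]] _.
  rewrite (_ : rels2`_0 = gx * gx); last by rewrite /rels2 /= expr2.
  rewrite -[meval _ _ _](subrK (scup 1 coc_x coc_x)).
  by apply: (scoboundD (@lev_le 2)); [exact: meval_mul2|exact: scobound_xx].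
rewrite (_ : rels2`_1 = gu * gu - (gu * gx + gu * gy)); last by rewrite /rels2 /= expr2.
(* With y sent to w + x, the two terms u x cancel in characteristic 2. There remains u^2 - u w,
   obtained from u^2 + w u by exchanging u and w up to a coboundary. *)
rewrite (_ : meval _ _ _ = (meval gens2 2 (gu * gu) - scup 1 (@coc_u 2) (@coc_u 2))
  - ((meval gens2 2 (gu * gx) - scup 1 (@coc_u 2) coc_x)
     + (meval gens2 2 (gu * gy) - scup 1 (@coc_u 2) (coc_y + coc_x)))
  + ((scup 1 (@coc_u 2) (@coc_u 2) + scup 1 coc_y (@coc_u 2))
     - (scup 1 (@coc_u 2) coc_y + scup 1 coc_y (@coc_u 2)))).
  apply: (scoboundD (@lev_le 2)).
    apply: (scoboundB (@lev_le 2)); first exact: meval_mul2.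
    by apply: (scoboundD (@lev_le 2)); apply: meval_mul2.
  apply: (scoboundB (@lev_le 2)); first exact: scobound_uu.
  exact: (scup11_comm (@lev_refl 2) (@lev_le 2)).
have E1 : meval gens2 2 (gu * gu - (gu * gx + gu * gy)) =
  meval gens2 2 (gu * gu) - (meval gens2 2 (gu * gx) + meval gens2 2 (gu * gy)).
  by rewrite linearB linearD.
have E2 : scup 1 (@coc_u 2) (coc_y + coc_x) = scup 1 (@coc_u 2) coc_y + scup 1 (@coc_u 2) coc_x.
  exact: linearD.
rewrite E1 E2; apply/funext => s; rewrite !(scochainD, scochainN).
set e := scup 1 (@coc_u 2) coc_x s; have e2 : e + e = 0 := F2_addxx p_pr e.
by apply/eqP; rewrite -subr_eq0 -[X in _ == X]oppr0 -e2; apply/eqP; ring.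
Qed.

(** Multiplication by x + y preserves the span by construction, and y is (x + y) - x, so only x and
    u need to be checked. The factors x + y can be pulled out, which leaves products with 1, u, x
    and x u; there the relations read x^2 = 0 and u^2 = (x + y) u. *)
Lemma polys2_span n i j : (i < size (polys2 n))%N ->
  spanned rels2 polys2 n.+1 ('X_j * (polys2 n)`_i).
Proof.
have W m q : spanned rels2 polys2 m q -> spanned rels2 polys2 m.+1 ((gx + gy) * q).
  move=> [c hc]; exists (catc (polys_ext m.+1) (fun=> 0) c).
  rewrite /= lcomb_catc lcomb0 add0r.
  rewrite (_ : lcomb _ c = (gx + gy) * lcomb (polys2 m) c).
    by rewrite -mulrBr; apply: in_idealM.
  rewrite /lcomb size_map mulr_sumr; apply: eq_bigr => l _.
  by rewrite -scalerAr (nth_map 0).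
have rel0 : in_ideal rels2 (gx * gx) by rewrite -expr2; apply: (@in_ideal_mem _ _ rels2 0%N).
have rel1 : in_ideal rels2 (gu ^+ 2 - (gu * gx + gu * gy)) by apply: (@in_ideal_mem _ _ rels2 1%N).
have M m l : (l < size (polys2 m))%N ->
  spanned rels2 polys2 m (polys2 m)`_l by apply: spanned_mem.
have XU m l : (l < size (polys2 m))%N ->
    spanned rels2 polys2 m.+1 (gx * (polys2 m)`_l) /\ spanned rels2 polys2 m.+1 (gu * (polys2 m)`_l).
  elim: m l => [|m IH] l.
    by case: l => //= _; rewrite !mulr1; split; [apply: (M 1%N 1%N)|apply: (M 1%N 0%N)].
  rewrite [polys2 m.+1]/(polys_ext m.+1 ++ _) size_cat size_map nth_cat => hl.
  case: ltnP => [lt_l|le_l]; last first.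
    have lt_l : (l - size (polys_ext m.+1) < size (polys2 m))%N by rewrite ltn_subLR.
    have [hx hu] := IH _ lt_l.
    by rewrite (nth_map 0) // ![_ * ((gx + gy) * _)]mulrCA; split; apply: W.
  have UU : spanned rels2 polys2 2 (gu * gu).
    rewrite (_ : gu * gu = (gu ^+ 2 - (gu * gx + gu * gy)) + (gx + gy) * gu); last by ring.
    by apply: spannedD; [exact: spanned_ideal|apply: W; apply: (M 1%N 0%N)].
  have XU2 : spanned rels2 polys2 2 (gx * gu) by apply: (M 2%N 0%N).
  case: m {IH hl} lt_l => [|[|m]] lt_l; last by [].
    case: l lt_l => [|[|l]] lt_l; last by [].
      by rewrite -[X in gx * X]/gu -[X in gu * X]/gu.
    rewrite -[X in gx * X]/gx -[X in gu * X]/gx (mulrC gu); split=> //.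
    exact: spanned_ideal.
  case: l lt_l => [|l] lt_l; last by [].
  rewrite -[X in gx * X]/(gx * gu) -[X in gu * X]/(gx * gu); split.
    rewrite mulrA mulrC; exact/spanned_ideal/in_idealM.
  rewrite (_ : gu * (gx * gu) = gx * (gu ^+ 2 - (gu * gx + gu * gy)) + (gx + gy) * (gx * gu)); last by ring.
  by apply: spannedD; [apply/spanned_ideal/in_idealM|apply: W].
move=> hi; have [hx hu] := XU n i hi.
case: j => [[|[|[|//]]] hj].
- by rewrite (_ : Ordinal hj = 0) //; apply: val_inj.
- by rewrite (_ : Ordinal hj = 1) //; apply: val_inj.
rewrite (_ : Ordinal hj = 2); last exact: val_inj.
rewrite (_ : gy * _ = -1 *: (gx * (polys2 n)`_i) + (gx + gy) * (polys2 n)`_i).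
  by apply: spannedP => //; apply: W; apply: M.
by rewrite scaleN1r mulrDl addKr.
Qed.

Lemma size_ext n : size (polys_ext n) = size (basis_ext n).
Proof. by case: n => [|[|[|n]]]. Qed.

Lemma size_polys2 n : size (polys2 n) = size (basis2 n).
Proof.
elim: n => [|n IH]; first by [].
rewrite [polys2 n.+1]/(polys_ext n.+1 ++ _) [basis2 n.+1]/(basis_ext n.+1 ++ _).
by rewrite !size_cat !size_map IH size_ext.
Qed.

Lemma polys2_homog n i : (i < size (polys2 n))%N -> (polys2 n)`_i \is n.-homog.
Proof.
elim: n i => [|n IH] i; first by case: i => // _; apply: dhomog1.
rewrite [polys2 n.+1]/(polys_ext n.+1 ++ _) size_cat size_map nth_cat => hi.
case: ltnP => [lt_i|le_i].
  case: n {IH hi} lt_i => [|[|n]] lt_i; last by [].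
    by case: i lt_i => [|[|i]] lt_i; [exact: homogX|exact: homogX|].
  by case: i lt_i => [|i] lt_i //; exact: (dhomogM (homogX 0) (homogX 1)).
have lt_i : (i - size (polys_ext n.+1) < size (polys2 n))%N by rewrite ltn_subLR.
rewrite (nth_map 0) //; apply: (@dhomogM _ _ _ 1%N); last exact: IH.
by apply: dhomogD; apply: homogX.
Qed.

Lemma meval_polys2 n i : (i < size (polys2 n))%N ->
  scobound lev K n (meval gens2 n (polys2 n)`_i - (basis2 n)`_i).
Proof.
elim: n i => [|n IH] i.
  case: i => // _; rewrite (_ : (polys2 0)`_0 = 1); last by [].
  by rewrite (_ : (basis2 0)`_0 = 1) // meval1 subrr; apply: scobound0.
move=> hi; have := polys2_homog hi; move: hi.
rewrite [polys2 n.+1]/(polys_ext n.+1 ++ _) [basis2 n.+1]/(basis_ext n.+1 ++ _).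
rewrite size_cat size_map !nth_cat -size_ext => hi.
case: ltnP => [lt_i|le_i] _.
  case: n {IH hi} lt_i => [|[|n]] lt_i; last by [].
    case: i lt_i => [|[|i]] lt_i; last by [].
      rewrite -[(polys_ext 1)`_0]/gu -[(basis_ext 1)`_0]/(gens2 1) meval_mpolyX subrr.
      exact: scobound0.
    rewrite -[(polys_ext 1)`_1]/gx -[(basis_ext 1)`_1]/(gens2 0) meval_mpolyX subrr.
    exact: scobound0.
  by case: i lt_i => [|i] lt_i; [exact: meval_mul2|].
have lt_i : (i - size (polys_ext n.+1) < size (polys2 n))%N by rewrite ltn_subLR.
rewrite (nth_map 0) // (nth_map 0) -?size_polys2 //.
set b := (polys2 n)`__; set e := (basis2 n)`__.
have mW : meval gens2 1 (gx + gy) = coc_y.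
  rewrite (_ : meval _ _ _ = meval gens2 1 gx + meval gens2 1 gy); last exact: linearD.
  rewrite !meval_mpolyX -[gens2 0]/coc_x -[gens2 2]/(coc_y + coc_x).
  by rewrite addrCA (cochain2_addxx p_pr) addr0.
have hW : gx + gy \is 1.-homog by apply: dhomogD; apply: homogX.
have := mevalM (@lev_refl 2) (@lev_le 2) gens2_cocycle
  (fun i j => scup11_comm2 (gens2_cocycle i) (gens2_cocycle j)) hW (polys2_homog lt_i).
rewrite mW -/b => hM.
rewrite (_ : _ - _ = (meval gens2 (1 + n) ((gx + gy) * b) - scup 1 coc_y (meval gens2 n b)) +
  scup 1 coc_y (meval gens2 n b - e)).
  apply: (scoboundD (@lev_le 2)) hM _.
  exact: (scobound_scupl (@lev_refl 2) (@lev_le 2) (scocycle2_y p_pr) (IH _ lt_i)).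
rewrite (_ : scup 1 coc_y (_ - e) = scup 1 coc_y (meval gens2 n b) - scup 1 coc_y e).
  by rewrite addrA subrK.
exact: linearB.
Qed.

Lemma contCohomology2 :
  gradedAlg_iso (contCohomology F (hol_tower p_pr)) (exterior_xuyAlg F).
Proof.
apply: (contCohomology_presented K_trans K_mul K_dil (coh_basis2 p_pr) (rels := rels2)
  (a := gens2) _ _ _ _ (bs := polys2) _ _ _ _).
- exact: gens2_cocycle.
- by move=> i j; apply: scup11_comm2; apply: gens2_cocycle.
- case=> [|[|i]] hi; last by [].
    exact: (dhomogM (homogX 0) (homogX 0)).
  apply: dhomogD; first exact: (dhomogM (homogX 1) (homogX 1)).
  by rewrite dhomogN; apply: dhomogD; apply: (dhomogM (homogX _) (homogX _)).
- exact: rels2_cobound.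
- exact: size_polys2.
- exact: polys2_homog.
- exact: meval_polys2.
apply: homog_spanned; first exact: (@spanned_mem _ _ _ polys2 0%N 0%N).
exact: polys2_span.
Qed.

End PrimeTwo.

(** * The Poincare series *)

Lemma expands_to_size_basis2 :
  expands_to ((1 + 'X) ^+ 2) (1 - 'X) (fun n => (size (basis2 n))%:Z).
Proof.
have Q0 : (1 - 'X : {poly int})`_0 = 1 by rewrite coefB coef1 coefX.
have Q1 : (1 - 'X : {poly int})`_1 = -1 by rewrite coefB coef1 coefX.
have Q2 i : (1 - 'X : {poly int})`_i.+2 = 0 by rewrite coefB coef1 coefX.
have P n : ((1 + 'X) ^+ 2 :
  {poly int})`_n = (n == 0)%:R + ((n == 1)%:R + (n == 1)%:R) + (n == 2)%:R.
  by rewrite sqrrD expr1n mul1r mulr2n !coefD coef1 coefX coefXn.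
split=> [|n]; first by rewrite Q0 unitr1.
case: n => [|n]; first by rewrite big_ord1 Q0 P.
rewrite big_ord_recl big_ord_recl big1 => [|i _]; last by rewrite Q2 mul0r.
rewrite Q0 Q1 addr0 mul1r mulN1r subn0 subSS subn0 P.
(* Multiplying by 1 - t cancels the part inherited from the previous degree; the sizes 2, 1, 0, ...
   of [basis_ext] in positive degrees are the coefficients of (1 + t)^2. *)
rewrite [basis2 n.+1]/(basis_ext n.+1 ++ _) size_cat size_map PoszD addrK.
by case: n => [|[|n]].
Qed.

Theorem theorem3p9p1 (p : nat) (p_pr : prime p) :
  gradedAlg_iso (contCohomology 'F_p (hol_tower p_pr))
    (if p == 2%N then exterior_xuyAlg 'F_p else exteriorAlg1 'F_p) /\
  exists s : nat -> int,
    poincare_series (contCohomology 'F_2 (hol_tower (isT : prime 2))) s /\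
    expands_to ((1 + 'X) ^+ 2) (1 - 'X) s.
Proof.
split.
  case: eqP => [e|/eqP p2]; last exact: contCohomology_odd.
  by subst p; apply: contCohomology2.
exists (fun n => (size (basis2 n))%:Z); split; last exact: expands_to_size_basis2.
by move=> n; exists (size (basis2 n)) => //; apply: contCohomology2_has_dim.
Qed.
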